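(* Let assumptions (A1) and (A2b) be satisfied. Assume that $\epsilon_i$ is $N(0,\sigma^2I_T)$-distributed, that $\kappa^2$ and $\phi_{\min}(\Gamma_{J,J})$ are bounded from below (away from zero) and that $\phi_{\max}(\Gamma_{J,J})$ is bounded from above. For a sequence $a_{N,T}\ge e$ choose $\lambda_{N,T}=\sqrt{4NT\log(p)^3\log(a_{N,T})^3}$ and $\mu_{N,T}=\sqrt{4T\log(N)^3\log(a_{N,T})^3}$. Let $$t=\frac{\kappa^2}{(s_1+s_2)\left(\frac{\log p}{\log N}\vee\frac{\log N}{\log p}\right)^3}$$ and suppose $Nt^2\ge1$. Then, when the Lasso detects the correct sparsity pattern (i.e. $\{j:\hat\gamma_j\neq0\}=J$), it holds with probability at least $$1-\exp(-c_1|J|)-A(p^2+Np)e^{-B(t^2N)^{1/3}}$$ that $$\|S_{J,J}(\hat\gamma_J-\gamma_J^* )\|\ge c_2\,\xi_{N,T}$$ for absolute constants $c_1,c_2,A,B$, where $\xi_{N,T}=16\log(a_{N,T})^{3/2}\left[\log(p)^{3/2}\sqrt{s_1}+\log(N)^{3/2}\sqrt{s_2}\right]/\kappa^2$. (That is, there is an event of at least the stated probability on whose intersection with $\{\{j:\hat\gamma_j\ne0\}=J\}$ the lower bound holds.)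
   Context: Model: for $i=1,\dots,N$, $t=1,\dots,T$, $y_{i,t}=x_{i,t}'\beta^*+c_i^*+\epsilon_{i,t}$ with random covariates $x_{i,t}=(x_{i,t,1},\dots,x_{i,t,p})'\in\mathbb{R}^p$, unknown deterministic vectors $\beta^*\in\mathbb{R}^p$, $c^*\in\mathbb{R}^N$ and random errors $\epsilon_{i,t}$; $p,N\ge e$. Put $X_i=(x_{i,1},\dots,x_{i,T})'$, $X=(X_1',\dots,X_N')'$, $\epsilon_i=(\epsilon_{i,1},\dots,\epsilon_{i,T})'$, $\epsilon=(\epsilon_1',\dots,\epsilon_N')'$, $y$ stacked in the same way, $D=I_N\otimes\iota$ with $\iota$ the $T\times1$ vector of ones, $Z=(X,D)$, $\gamma^*=({\beta^*}',{c^*}')'$, so $y=Z\gamma^*+\epsilon$. Let $J_1=\{j:\beta_j^*\ne0\}$, $J_2=\{i:c_i^*\neq0\}$, $s_1=|J_1|$, $s_2=|J_2|$, and $J=J_1\cup(J_2+p)\subseteq\{1,\dots,p+N\}$ (the support of $\gamma^*$). $\|\cdot\|$, $\|\cdot\|_{\ell_1}$ are the $\ell_2$- and $\ell_1$-norms; $\phi_{\min},\phi_{\max}$ are the smallest and largest eigenvalues; $M_{J,J}$ is the submatrix with rows and columns in $J$; $v_A$ is the subvector of $v$ indexed by $A$; $a\vee b=\max(a,b)$; $\log$ is the natural logarithm. Panel Lasso: $\hat\gamma=(\hat\beta',\hat c')'$ minimizes $\|y-Z\gamma\|^2+2\lambda_{N,T}\|\beta\|_{\ell_1}+2\mu_{N,T}\|c\|_{\ell_1}$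 over $\gamma=(\beta',c')'\in\mathbb{R}^{p+N}$. Let $S=\mathrm{diag}(\sqrt{NT}\,I_p,\sqrt T\,I_N)$ and $\Gamma=\mathrm{diag}(E(X'X/(NT)),I_N)$ (block diagonal). Let $\kappa^2$ be the minimum of $\delta'\Gamma\delta/\|\delta\|^2$ over all $\delta=({\delta^1}',{\delta^2}')'\in\mathbb{R}^{p+N}\setminus\{0\}$ ($\delta^1\in\mathbb{R}^p$, $\delta^2\in\mathbb{R}^N$) and all $R_1\subseteq\{1,\dots,p\}$, $R_2\subseteq\{1,\dots,N\}$ with $|R_1|\le s_1$, $|R_2|\le s_2$ and $\frac{\lambda_{N,T}}{\sqrt{NT}}\|\delta^1_{R_1^c}\|_{\ell_1}+\frac{\mu_{N,T}}{\sqrt T}\|\delta^2_{R_2^c}\|_{\ell_1}\le 3\frac{\lambda_{N,T}}{\sqrt{NT}}\|\delta^1_{R_1}\|_{\ell_1}+3\frac{\mu_{N,T}}{\sqrt T}\|\delta^2_{R_2}\|_{\ell_1}$. (A1): (a) $\{(X_i,\epsilon_i)\}_{i=1}^N$ are independent and identically distributed; (b) $X_i$ and $\epsilon_i$ are independent for each $i$; (c) for each $i$, $\{\epsilon_{i,t},\mathcal{F}_{i,t}\}_{t=1}^T$ with $\mathcal{F}_{i,t}=\sigma(\epsilon_{i,1},\dots,\epsilon_{i,t})$ is a martingale difference sequence. (A2b): there are constants $C,K>0$ with $P(|x_{1,t,k}|\ge u)\le\frac12Ke^{-Cu^2}$ and $P(|\epsilon_{1,t}|\ge u)\le\frac12Ke^{-Cu^2}$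 for all $u>0$, $1\le t\le T$, $1\le k\le p$. The constants $C,K$, $\sigma^2>0$ and the bounds on $\kappa^2$, $\phi_{\min}(\Gamma_{J,J})$, $\phi_{\max}(\Gamma_{J,J})$ are regarded as fixed; ''absolute constants'' means positive constants that may depend on these but on nothing else. *)

(* Defs.v *)
(* MathComp / MathComp-Analysis *)
From HB Require Import structures.
From mathcomp Require Import all_boot all_order all_algebra.
From mathcomp Require Import all_classical all_reals all_analysis.

Set Implicit Arguments.
Unset Strict Implicit.
Unset Printing Implicit Defensive.

Import Order.TTheory GRing.Theory Num.Theory.
Import numFieldNormedType.Exports.

Local Open Scope ring_scope.

Section LinearAlgebra.
Context {R : realType}.

(* The library norm `|v| on column vectors is the sup norm. *)
Definition l2norm n (v : 'cV[R]_n) : R := Num.sqrt (\sum_i v i 0 ^+ 2).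

Definition l1norm n (v : 'cV[R]_n) : R := \sum_i `|v i 0|.

Definition supp n (v : 'cV[R]_n) : {set 'I_n} := [set j | v j 0 != 0]%SET.

Definition subvec n (A : {set 'I_n}) (v : 'cV[R]_n) : 'cV[R]_#|A| :=
  rowsub (fun k : 'I_#|A| => enum_val k) v.

Definition submat n (A : {set 'I_n}) (M : 'M[R]_n) : 'M[R]_#|A| :=
  mxsub (fun k : 'I_#|A| => enum_val k) (fun k : 'I_#|A| => enum_val k) M.

(* For a symmetric matrix of positive size the spectrum is a nonempty finite set
   of reals, and inf, sup are its minimum and maximum. For size 0 both are 0. *)
Definition phi_min n (M : 'M[R]_n) : R := inf [set a | eigenvalue M a]%classic.

Definition phi_max n (M : 'M[R]_n) : R := sup [set a | eigenvalue M a]%classic.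

(* The stacked vector (u_1', ..., u_N')', where u_i' is row i of U. *)
Definition stack N T (U : 'M[R]_(N, T)) : 'cV[R]_(N * T) := (mxvec U)^T.

End LinearAlgebra.

Section Probability.
Context {R : realType} {d : measure_display} {Omega : measurableType d}.
Variable P : probability Omega R.

Definition mutually_independent (I : finType) d' (V : measurableType d')
    (Y : I -> Omega -> V) : Prop :=
  forall (S : {set I}) (B : I -> set V), (forall i, measurable (B i)) ->
    (P (\bigcap_(i in [set i | i \in S]) (Y i @^-1` B i))%classic
     = \prod_(i in S) P (Y i @^-1` B i)%classic)%E.

Definition independent2 d1 (V1 : measurableType d1) d2 (V2 : measurableType d2)
    (Y1 : Omega -> V1) (Y2 : Omega -> V2) : Prop :=
  forall (B1 : set V1) (B2 : set V2), measurable B1 -> measurable B2 ->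
    (P (Y1 @^-1` B1 `&` Y2 @^-1` B2)%classic
     = P (Y1 @^-1` B1)%classic * P (Y2 @^-1` B2)%classic)%E.

Definition identically_distributed (I : Type) d' (V : measurableType d')
    (Y : I -> Omega -> V) : Prop :=
  forall (i j : I) (B : set V), measurable B ->
    P (Y i @^-1` B)%classic = P (Y j @^-1` B)%classic.

(* Z is a version of E[Y | G], for a sub-sigma-algebra G. *)
Definition is_cond_expectation (G : set (set Omega)) (Y Z : Omega -> R) : Prop :=
  [/\ (preimage_set_system setT Z measurable `<=` G)%classic,
      P.-integrable setT (EFin \o Z) &
      forall A, G A -> (\int[P]_(w in A) (Z w)%:E = \int[P]_(w in A) (Y w)%:E)%E].

(* sigma(e_1, ..., e_t) where e_s has index s.-1 : 'I_T; trivial for t = 0. *)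
Definition history T (e : 'I_T -> Omega -> R) (t : nat) : set (set Omega) :=
  (<<s \bigcup_(s in [set s : 'I_T | (s < t)%N])
         preimage_set_system setT (e s) measurable >>)%classic.

(* (F t) is indexed by the number t of observed periods, so that the time
   period with index t : 'I_T is F t.+1 - measurable and centered given F t. *)
Definition martingale_difference T (e : 'I_T -> Omega -> R)
    (F : nat -> set (set Omega)) : Prop :=
  forall t : 'I_T,
    [/\ (preimage_set_system setT (e t) measurable `<=` F t.+1)%classic,
        P.-integrable setT (EFin \o e t) &
        is_cond_expectation (F t) (e t) (fun=> 0)].

(* N(0, v I_T), for v > 0: the coordinates are independent N(0, v) variables.
   The second parameter of normal_prob is the standard deviation. *)
Definition isotropic_normal T (v : R) (e : 'I_T -> Omega -> R) : Prop :=
  mutually_independent e /\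
  forall (t : 'I_T) (B : set R), measurable B ->
    P (e t @^-1` B)%classic = normal_prob 0 (Num.sqrt v) B.

End Probability.

Section PanelModel.
Context {R : realType} {d : measure_display} {Omega : measurableType d}.
Variable P : probability Omega R.
Variables N T p : nat.
(* x i w is the T-tuple of the rows x_{i,1}', ..., x_{i,T}' of X_i. *)
Variable x : 'I_N -> {RV P >-> T.-tuple (p.-tuple R)}.
Variable eps : 'I_N -> {RV P >-> T.-tuple R}.

Definition cov i (t : 'I_T) (k : 'I_p) (w : Omega) : R :=
  tnth (tnth (x i w) t) k.

Definition err i (t : 'I_T) (w : Omega) : R := tnth (eps i w) t.

Definition Xmat (w : Omega) : 'M[R]_(N * T, p) :=
  \matrix_(r, k) stack (\matrix_(i, t) cov i t k w) r 0.

(* I_N (x) iota: in column j, the dummy of individual j. *)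
Definition Dmat : 'M[R]_(N * T, N) :=
  \matrix_(r, j) stack (\matrix_(i < N, t < T) (i == j)%:R) r 0.

Definition Zmat (w : Omega) : 'M[R]_(N * T, p + N) := row_mx (Xmat w) Dmat.

Definition response (beta : 'cV[R]_p) (c : 'cV[R]_N) (w : Omega) :
    'cV[R]_(N * T) :=
  stack (\matrix_(i, t)
    (\sum_(k < p) cov i t k w * beta k 0 + c i 0 + err i t w)).

Definition lasso_objective (lam mu : R) (beta : 'cV[R]_p) (c : 'cV[R]_N)
    (w : Omega) (g : 'cV[R]_(p + N)) : R :=
  l2norm (response beta c w - Zmat w *m g) ^+ 2
  + 2 * lam * l1norm (usubmx g) + 2 * mu * l1norm (dsubmx g).

(* ghat is a panel Lasso estimate computed from the data at w, the true
   parameters being beta and c. *)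
Definition is_panel_lasso (lam mu : R) (beta : 'cV[R]_p) (c : 'cV[R]_N)
    (w : Omega) (ghat : 'cV[R]_(p + N)) : Prop :=
  forall g, lasso_objective lam mu beta c w ghat
            <= lasso_objective lam mu beta c w g.

Definition Smat : 'M[R]_(p + N) :=
  block_mx (Num.sqrt (N * T)%:R)%:M 0 0 (Num.sqrt T%:R)%:M.

Definition Gamma : 'M[R]_(p + N) :=
  block_mx
    (\matrix_(k, l)
       fine ('E_P[fun w => ((N * T)%:R^-1 *: ((Xmat w)^T *m Xmat w)) k l])%E)
    0 0 1%:M.

Definition kappa_cone (lam mu : R) (R1 : {set 'I_p}) (R2 : {set 'I_N})
    (d1 : 'cV[R]_p) (d2 : 'cV[R]_N) : Prop :=
  lam / Num.sqrt (N * T)%:R * l1norm (subvec (~: R1)%SET d1)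
  + mu / Num.sqrt T%:R * l1norm (subvec (~: R2)%SET d2)
  <= 3 * (lam / Num.sqrt (N * T)%:R) * l1norm (subvec R1 d1)
     + 3 * (mu / Num.sqrt T%:R) * l1norm (subvec R2 d2).

(* If s1 + s2 > 0 (and lam, mu > 0), the infimum is attained: the quotient is
   homogeneous and the constraint set is a finite union of closed cones. *)
Definition kappa2 (lam mu : R) (s1 s2 : nat) : R :=
  inf [set q | exists (R1 : {set 'I_p}) (R2 : {set 'I_N})
                      (d1 : 'cV[R]_p) (d2 : 'cV[R]_N),
    [/\ (#|R1| <= s1)%N, (#|R2| <= s2)%N, col_mx d1 d2 != 0,
        kappa_cone lam mu R1 R2 d1 d2 &
        q = ((col_mx d1 d2)^T *m Gamma *m col_mx d1 d2) 0 0
            / l2norm (col_mx d1 d2) ^+ 2]]%classic.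

(* J_1 together with J_2 shifted by p *)
Definition joint_support (beta : 'cV[R]_p) (c : 'cV[R]_N) : {set 'I_(p + N)} :=
  (@lshift p N @: supp beta :|: @rshift p N @: supp c)%SET.

Definition iid_panel : Prop :=
  mutually_independent P (fun i w => (x i w, eps i w)) /\
  identically_distributed P (fun i w => (x i w, eps i w)).

Definition exogenous_panel : Prop := forall i, independent2 P (x i) (eps i).

Definition mds_panel : Prop :=
  forall i, martingale_difference P (err i) (history (err i)).

(* Only the first individual is constrained. *)
Definition subgaussian_panel (C K : R) : Prop :=
  forall (i : 'I_N) (t : 'I_T) (u : R), i = 0%N :> nat -> 0 < u ->
    (forall k : 'I_p,
       (P [set w | (u <= `|cov i t k w|)%R]%classic
        <= (2^-1 * K * expR (- C * u ^+ 2))%:E)%E) /\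
    (P [set w | (u <= `|err i t w|)%R]%classic
     <= (2^-1 * K * expR (- C * u ^+ 2))%:E)%E.

End PanelModel.

Definition lambda_NT {R : realType} (N T p : nat) (a : R) : R :=
  Num.sqrt (4 * N%:R * T%:R * ln p%:R ^+ 3 * ln a ^+ 3).

Definition mu_NT {R : realType} (N T : nat) (a : R) : R :=
  Num.sqrt (4 * T%:R * ln N%:R ^+ 3 * ln a ^+ 3).

(* If s1 + s2 = 0, the convention x / 0 = 0 yields 0, and 1 <= N t^2 fails. *)
Definition rate_t {R : realType} (N p : nat) (k2 : R) (s1 s2 : nat) : R :=
  k2 / ((s1 + s2)%:R
        * Num.max (ln p%:R / ln N%:R) (ln N%:R / ln p%:R) ^+ 3).

Definition xi_NT {R : realType} (N p : nat) (a k2 : R) (s1 s2 : nat) : R :=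
  16 * ln a `^ (3 / 2)
  * (ln p%:R `^ (3 / 2) * Num.sqrt s1%:R + ln N%:R `^ (3 / 2) * Num.sqrt s2%:R)
  / k2.

(* Main.v *)
Require Import Defs.
From HB Require Import structures.
From mathcomp Require Import all_boot all_order all_algebra.
From mathcomp Require Import all_classical all_reals all_analysis.
From mathcomp Require Import measurable_realfun.
From mathcomp Require Import ring lra.

Set Implicit Arguments.
Unset Strict Implicit.
Unset Printing Implicit Defensive.

Import Order.TTheory GRing.Theory Num.Theory.
Import numFieldNormedType.Exports.

Local Open Scope classical_set_scope.
Local Open Scope ring_scope.

(** Let Psi = S^-1 Z'Z S^-1 be the normalized Gram matrix, G = S^-1 Z' eps the
    normalized noise and d = S (ghat - gstar) the normalized error.  When ghat
    has support J, the stationarity conditions of the Lasso at the coordinates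
    of J read Psi_JJ d_J = G_J - r_J, where r_j is the normalized penalty level
    of coordinate j with the sign of ghat_j.  Pairing them with a vector v
    supported in J and applying the Cauchy-Schwarz inequality gives
      (<v, G> - <v, r>)^2 <= M^2 |v|^2 |d|^2   whenever Psi_JJ <= M
    ([error_lower_bound]).  The sample enters r through its signs alone: the
    |r_j| are deterministic, and rho = |r|^2 has the order of xi^2
    ([xi_NT_le]).  So it suffices to bound Psi_JJ and to find a direction v in
    which G differs from r by a fraction of |r|, for all signs at once.

    Bound on Psi_JJ.  The inequality (a + b)^2 <= 2 a^2 + 2 b^2 decouples the
    regressors from the dummies, whose own block of Psi is the identity.  The
    entries of X'X/(NT) are averages over independent individuals of variables
    with an exponential moment, so by Chernoff's method they all lie within t
    of their means off an event whose probability is at most a multiple of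
    p^2 exp(-B t^2 N) ([gram_bad_prob]).  Since t |J| <= kappa^2, and kappa^2
    is at most a diagonal entry of Gamma, hence bounded, this perturbs the
    quadratic form of Gamma on J by a bounded amount; that form itself is at
    most phi_max ([energy_le]).

    Large penalties: rho >= L |J| for a suitable constant L.  Take v = r, for a
    fixed sign pattern.  Given the regressors, <r, G> is centered Gaussian, and
    its variance is at most sigma^2 M rho when Psi_JJ <= M, so on that event it
    exceeds rho/2 with probability at most exp(-rho / (8 sigma^2 M)), hence at
    most exp(-2 |J|); a union bound over the 2^|J| sign patterns leaves
    exp(-|J|) ([large_penalty_event]).

    Small penalties: rho < L |J|. If at least half of J consists of
    individuals, then log N <= L, so t^2 N is bounded and the exceptional
    probability allowed in the statement is at least one for a suitable A
    ([exception_trivial]). Otherwise log p <= L, so |J| is bounded, and the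
    required probability 1 - exp(-c_1 |J|) is a small constant when c_1 is
    small. Then a single coordinate is enough: by a second moment argument for
    cosh (th G_k), the Gaussian G_k stays away from both points +|r_k| and
    -|r_k| with probability bounded below ([two_point_anticoncentration]).

    Normality of the errors enters through the identity
    E exp <z, eps_i> = exp (sigma^2 |z|^2 / 2), applied conditionally on the
    regressors ([panel_gaussian_mgf]). *)

(** * Independence and integrals of products *)

Section LevelSets.
Context {R : realType} {d : measure_display} {Omega : measurableType d}.
Variables (g : Omega -> R) (c : R).

Lemma measurable_superlevel :
  measurable_fun setT g -> measurable [set w | (c <= g w)%R].
Proof.
move=> mg; rewrite (_ : [set w | _] = g @^-1` `[c, +oo[).
  by rewrite -[X in measurable X]setTI; exact: mg.
by apply/seteqP; split => w /=; rewrite in_itv/= andbT.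
Qed.

Lemma measurable_strict_superlevel :
  measurable_fun setT g -> measurable [set w | (c < g w)%R].
Proof.
move=> mg; rewrite (_ : [set w | _] = g @^-1` `]c, +oo[).
  by rewrite -[X in measurable X]setTI; exact: mg.
by apply/seteqP; split => w /=; rewrite in_itv/= andbT.
Qed.

End LevelSets.

Section DensityTransfer.
Context {R : realType} {d d' : measure_display} {Omega : measurableType d}
  {V : measurableType d'}.
Variables (mu : {measure set Omega -> \bar R}) (nu : {measure set V -> \bar R}).
Import HBNNSimple.

(** Monotone limits of simple functions reduce the claim to indicators of [f].
    It serves twice: to integrate against a density, with [Y] the identity, and
    to split off one independent factor, with [g] a product of the others. *)
Lemma ge0_integral_weight (g : Omega -> R) (Y : Omega -> V) (f : V -> R)
    (c : R) :
  measurable_fun setT g -> (forall w, 0 <= g w) ->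
  measurable_fun setT Y -> measurable_fun setT f -> (forall v, 0 <= f v) ->
  0 <= c ->
  (forall B, measurable B ->
    \int[mu]_w (g w * \1_B (Y w))%:E = c%:E * nu B)%E ->
  (\int[mu]_w (g w * f (Y w))%:E = c%:E * \int[nu]_v (f v)%:E)%E.
Proof.
move=> mg g0 mY mf f0 c0 gB.
have mEf : measurable_fun [set: V] (EFin \o f) by exact/measurable_EFinP.
pose f_ := nnsfun_approx measurableT mEf.
have mfY n : measurable_fun setT (fun w => f_ n (Y w)).
  by apply: measurableT_comp => //; exact: measurable_funP.
have cvf v : (EFin \o f_^~ v) @ \oo --> (f v)%:E.
  by apply: (@cvg_nnsfun_approx _ _ _ _ measurableT _ mEf) => // u _; rewrite lee_fin.
have ndf v : {homo (fun n => f_ n v) : m n / (m <= n)%N >-> m <= n}.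
  by move=> m n mn; exact/lefP/nd_nnsfun_approx.
have mgYB B : measurable B -> measurable_fun setT (fun w => g w * \1_B (Y w)).
  by move=> mB; apply: measurable_funM => //; apply: measurableT_comp.
transitivity (limn (fun n => \int[mu]_w (g w * f_ n (Y w))%:E))%E.
  rewrite -monotone_convergence//.
  - apply: eq_integral => w _; apply/esym/cvg_lim => //.
    under eq_fun do rewrite EFinM.
    by rewrite EFinM; apply: cvgeZl => //; exact: cvf.
  - by move=> n; apply/measurable_EFinP; exact: measurable_funM.
  - by move=> n w _; rewrite lee_fin mulr_ge0.
  - by move=> w _ m n mn; rewrite lee_fin ler_wpM2l// ndf.
rewrite (_ : (fun n => _) = (fun n => c%:E * \int[nu]_v (f_ n v)%:E)%E); last first.
  apply/funext => n.
  transitivity (\int[mu]_w \sum_(k \in range (f_ n))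
      (k * (g w * \1_(f_ n @^-1` [set k]) (Y w)))%:E)%E.
    apply: eq_integral => w _; rewrite {1}fimfunE fsumEFin//; congr EFin.
    rewrite mulrC mulr_fsuml; apply: eq_fsbigr => k _.
    by rewrite mulrAC mulrA.
  have mB k : measurable (f_ n @^-1` [set k]) by exact: measurable_funPTI.
  rewrite ge0_integral_fsum//; last 2 first.
  - by move=> k; apply/measurable_EFinP; apply: measurable_funM => //; exact: mgYB.
  - move=> k w _; rewrite lee_fin.
    rewrite mulrCA mulr_ge0//.
    rewrite indicE; case: (boolP (_ \in _)); last by rewrite mulr0.
    by rewrite mulr1 inE => <-.
  have -> : (\int[nu]_v (f_ n v)%:E = \int[nu]_v \sum_(k \in range (f_ n))
      (k * \1_(f_ n @^-1` [set k]) v)%:E)%E.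
    by apply: eq_integral => w _; rewrite {1}fimfunE fsumEFin.
  rewrite [in RHS]ge0_integral_fsum//; last 2 first.
  - by move=> k; apply/measurable_EFinP; apply: measurable_funM.
  - by move=> k w _; rewrite nnfun_muleindic_ge0.
  rewrite ge0_mule_fsumr; last first.
    move=> k; apply: integral_ge0 => w _; exact: nnfun_muleindic_ge0.
  apply: eq_fsbigr => k /set_mem[v _ <-{k}].
  set k := f_ n v.
  under eq_integral do rewrite EFinM.
  rewrite ge0_integralZl_EFin//; last 2 first.
  - by move=> w _; rewrite lee_fin mulr_ge0.
  - by apply/measurable_EFinP; exact: mgYB.
  rewrite gB//.
  under [in RHS]eq_integral do rewrite EFinM.
  rewrite ge0_integralZl_EFin//; last exact/measurable_EFinP.
  by rewrite integral_indic// ?setIT muleCA.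
apply/cvg_lim => //; apply: cvgeZl => //.
have -> : (fun v => (f v)%:E) = fun v => limn (fun n => (f_ n v)%:E).
  by apply/funext => v; apply/esym/cvg_lim => //; exact: cvf.
apply: cvg_monotone_convergence => //.
- by move=> n; exact/measurable_EFinP.
- by move=> n v _; rewrite lee_fin.
- by move=> v _ m n mn; rewrite lee_fin ndf.
Qed.

End DensityTransfer.

Section ProductFormula.
Context {R : realType} {d : measure_display} {Omega : measurableType d}.
Variable P : probability Omega R.

(** Mutual independence only speaks of events.  By induction on a set [S] of
    indices, the factors with index in [S] are arbitrary functions while the
    others are still indicators of arbitrary measurable sets. *)
Lemma integral_prod_indep (I : finType) d' (V : measurableType d')
    (Y : I -> Omega -> V) (f : I -> V -> R) (m : I -> R) :
  (forall i, measurable_fun setT (Y i)) -> mutually_independent P Y ->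
  (forall i, measurable_fun setT (f i)) -> (forall i v, 0 <= f i v) ->
  (forall i, \int[P]_w (f i (Y i w))%:E = (m i)%:E)%E ->
  (\int[P]_w (\prod_i f i (Y i w))%:E = (\prod_i m i)%:E)%E.
Proof.
move=> mY iY mf f0 fm.
have m0 i : 0 <= m i.
  by rewrite -lee_fin -fm; apply: integral_ge0 => w _; rewrite lee_fin.
pose h (S : {set I}) B i v : R := if i \in S then f i v else \1_(B i) v.
pose q (S : {set I}) (B : I -> set V) i : R :=
  if i \in S then m i else fine (P (Y i @^-1` B i)).
have mYB i B : measurable B -> measurable (Y i @^-1` B).
  by move=> mB; rewrite -[X in measurable X]setTI; exact: mY.
have mh S B i : (forall j, measurable (B j)) -> measurable_fun setT (h S B i).
  move=> mB; rewrite /h; case: (i \in S); first exact: mf.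
  exact: measurable_indic.
have h0 S B i v : 0 <= h S B i v by rewrite /h; case: (i \in S).
have q0 S B i : 0 <= q S B i by rewrite /q; case: (i \in S) => //; rewrite fine_ge0.
suff key n (S : {set I}) B : (forall i, measurable (B i)) -> #|S| = n ->
    (\int[P]_w (\prod_i h S B i (Y i w))%:E = (\prod_i q S B i)%:E)%E.
  have := key _ [set: I]%SET (fun=> set0) (fun=> measurable0) erefl.
  rewrite (eq_bigr m) => [<-|i _]; last by rewrite /q finset.in_setT.
  apply: eq_integral => w _; congr EFin.
  by apply: eq_bigr => i _; rewrite /h finset.in_setT.
elim: n S B => [|n IH] S B mB.
  move/cards0_eq => ->.
  have := iY [set: I]%SET B mB.
  set U := (X in P X = _) => PU.
  transitivity (\int[P]_w (\1_U w)%:E)%E.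
    apply: eq_integral => w _; congr EFin.
    rewrite /h; under eq_bigr do rewrite finset.in_set0.
    rewrite indicE; case: (boolP (w \in U)).
      move=> /set_mem Uw; rewrite big1// => i _; rewrite indicE mem_set//.
      by apply: (Uw i) => /=; rewrite finset.in_setT.
    move=> /negP Uw; have [i Bi] : exists i, ~ B i (Y i w).
      apply: contrapT => /forallNP H; apply/Uw/mem_set => i _ /=.
      by apply: contrapT; exact: H.
    by rewrite (bigD1 i)//= indicE memNset ?mul0r.
  rewrite integral_indic ?setIT//; last first.
    by apply: fin_bigcap_measurable => [|i _]; [exact: finite_finpred|exact: mYB].
  apply: (eq_trans PU); rewrite -prodEFin; apply: eq_big => [i|i _]; rewrite ?finset.in_setT//.
  rewrite /q finset.in_set0.
  by rewrite fineK// fin_num_measure//; exact: mYB.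
move=> Sn; have [j jS] : exists j, j \in S by apply/set0Pn; rewrite -card_gt0 Sn.
pose S' := S :\ j.
have S'n : #|S'| = n by move: Sn; rewrite (cardsD1 j) jS => -[].
pose g w := \prod_(i | i != j) h S B i (Y i w).
pose c := \prod_(i | i != j) q S B i.
transitivity (\int[P]_w (g w * f j (Y j w))%:E)%E.
  apply: eq_integral => w _; rewrite (bigD1 j)//= mulrC {2}/h jS//.
rewrite (bigD1 j)//= {1}/q jS mulrC EFinM -fm.
rewrite -(ge0_integral_pushforward (mY j) P (f := EFin \o f j) measurableT)//=;
  [|exact/measurable_EFinP|by move=> v _; rewrite lee_fin].
apply: ge0_integral_weight => //.
- rewrite /g; under eq_fun do rewrite -big_filter.
  apply: measurable_prod => i _; apply: measurableT_comp => //; exact: mh.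
- by move=> w; exact: prodr_ge0.
- exact: prodr_ge0.
- move=> B' mB'.
  (* The hypothesis of [ge0_integral_weight] is the induction hypothesis with the
   test set B' at the index j being converted. *)
pose B2 i := if i == j then B' else B i.
  have mB2 i : measurable (B2 i) by rewrite /B2; case: (i == j).
  have := IH S' B2 mB2 S'n.
  rewrite [in X in _ = X -> _](bigD1 j)//= {1}/q /S' finset.setD11 /B2 eqxx mulrC EFinM.
  rewrite fineK; last by rewrite fin_num_measure//; exact: mYB.
  rewrite [X in (X%:E * _)%E](_ : _ = c); last first.
    by apply: eq_bigr => i ij; rewrite /q /S' !inE ij /= (negbTE ij).
  move=> <-; apply: eq_integral => w _; congr EFin.
  rewrite [RHS](bigD1 j)//= [RHS]mulrC; congr (_ * _).
    by apply: eq_bigr => i ij; rewrite /h /S' !inE ij /= (negbTE ij).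
  by rewrite /h /S' finset.setD11 eqxx.
Qed.
End ProductFormula.

(** * Gaussian exponential moments *)

Section Gaussian.
Context {R : realType}.

(** Completing the square: an exponential tilt of a centered normal density is
    a multiple of a shifted normal density. *)
Lemma normal_pdf_tilt (s z x : R) : s != 0 ->
  normal_pdf 0 s x * expR (z * x)
  = expR (s ^+ 2 * z ^+ 2 / 2) * normal_pdf (s ^+ 2 * z) s x.
Proof.
move=> s0; rewrite !normal_pdfE// /normal_fun.
rewrite mulrAC -mulrA -expRD mulrCA -expRD; congr (_ * expR _).
by field.
Qed.

Lemma normal_mgf d (Omega : measurableType d) (P : probability Omega R)
    (Y : Omega -> R) (s z : R) : s != 0 -> measurable_fun setT Y ->
  (forall B, measurable B -> P (Y @^-1` B) = normal_prob 0 s B) ->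
  (\int[P]_w (expR (z * Y w))%:E = (expR (s ^+ 2 * z ^+ 2 / 2))%:E)%E.
Proof.
move=> s0 mY lawY.
have mf : measurable_fun setT (fun u : R => expR (z * u)).
  by apply: measurableT_comp => //; exact: measurable_funM.
rewrite -(ge0_integral_pushforward mY P
  (f := fun u => (expR (z * u))%:E) measurableT); last 2 first.
- exact/measurable_EFinP.
- by move=> u _; rewrite lee_fin expR_ge0.
rewrite -[LHS]mul1e.
rewrite -(@ge0_integral_weight R _ _ _ _ lebesgue_measure (pushforward P Y)
  (normal_pdf 0 s) (fun u => u) (fun u => expR (z * u)) 1)//; last 3 first.
- exact: measurable_normal_pdf.
- by move=> x; exact: normal_pdf_ge0.
- move=> B mB; rewrite mul1e -[RHS]/(P (Y @^-1` B)).
  apply: etrans (esym (lawY _ mB)); rewrite /normal_prob [RHS]integral_mkcond.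
  by apply: eq_integral => x _; rewrite /= epatch_indic EFinM.
under eq_integral do rewrite normal_pdf_tilt// EFinM.
rewrite ge0_integralZl_EFin//; last 2 first.
- by move=> x _; rewrite lee_fin normal_pdf_ge0.
- by apply/measurable_EFinP; exact: measurable_normal_pdf.
by rewrite integral_normal_pdf mule1.
Qed.

End Gaussian.

Section PairIndependence.
Context {R : realType} {d : measure_display} {Omega : measurableType d}.
Variable P : probability Omega R.

(** Independence identifies the joint law with the product of the laws, to
    which Tonelli's theorem applies. *)
Lemma ge0_integral_independent2 d1 (V1 : measurableType d1)
    d2 (V2 : measurableType d2) (X : {RV P >-> V1}) (Y : {RV P >-> V2})
    (f : V1 * V2 -> R) :
  independent2 P X Y -> measurable_fun setT f -> (forall v, 0 <= f v) ->
  (\int[P]_w (f (X w, Y w))%:E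
   = \int[P]_w \int[P]_w' (f (X w, Y w'))%:E)%E.
Proof.
move=> iXY mf f0.
have mXY : measurable_fun setT (fun w => (X w, Y w)).
  by apply: measurable_fun_pair; exact: measurable_funP.
have mEf : measurable_fun setT (EFin \o f) by exact/measurable_EFinP.
pose XY : {mfun Omega >-> (V1 * V2)%type} :=
  HB.pack (fun w => (X w, Y w)) (isMeasurableFun.Build _ _ _ _ _ mXY).
transitivity (\int[distribution P XY]_v (f v)%:E)%E.
  by rewrite ge0_integral_distribution.
transitivity (\int[distribution P X \x distribution P Y]_v (f v)%:E)%E.
  apply: eq_measure_integral => A mA _; apply/esym.
  by apply: product_measure_unique => // A1 A2 mA1 mA2; exact: iXY.
rewrite (fubini_tonelli1 (EFin \o f))//.
rewrite ge0_integral_distribution; last 2 first.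
- by apply: measurable_fun_fubini_tonelli_F => // v; rewrite lee_fin.
- by move=> v; apply: integral_ge0 => u _; rewrite lee_fin.
apply: eq_integral => w _; rewrite /= /fubini_F.
rewrite ge0_integral_distribution//.
  by apply: measurableT_comp => //; exact: measurable_pair1.
by move=> v; rewrite lee_fin.
Qed.

Lemma isotropic_normal_mgf T (v : R) (e : 'I_T -> Omega -> R) (z : 'I_T -> R) :
  0 < v -> (forall t, measurable_fun setT (e t)) -> isotropic_normal P v e ->
  (\int[P]_w (expR (\sum_t z t * e t w))%:E
   = (expR (v / 2 * \sum_t z t ^+ 2))%:E)%E.
Proof.
move=> v0 me [ie ne].
under eq_integral do rewrite expR_sum.
rewrite mulr_sumr expR_sum.
have mz t : measurable_fun setT (fun u : R => expR (z t * u)).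
  by apply: measurableT_comp => //; exact: measurable_funM.
apply: (@integral_prod_indep _ _ _ P _ _ _ e (fun t u => expR (z t * u))) => //.
move=> t; rewrite (@normal_mgf _ _ _ _ _ (Num.sqrt v))//; last 2 first.
- by rewrite gt_eqF// sqrtr_gt0.
- exact: ne.
by rewrite sqr_sqrtr ?ltW// mulrAC.
Qed.

End PairIndependence.

Section PanelExpectations.
Context {R : realType} {d : measure_display} {Omega : measurableType d}.
Variable P : probability Omega R.
Variables N T p : nat.
Variable x : 'I_N -> {RV P >-> T.-tuple (p.-tuple R)}.
Variable eps : 'I_N -> {RV P >-> T.-tuple R}.

Lemma measurable_regressor (t : 'I_T) (k : 'I_p) :
  measurable_fun setT (fun v : T.-tuple (p.-tuple R) => tnth (tnth v t) k).
Proof.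
exact: (measurableT_comp (measurable_tnth k) (measurable_tnth t)).
Qed.

Lemma measurable_cov i t k : measurable_fun setT (cov x i t k).
Proof. exact: (measurableT_comp (measurable_regressor t k)). Qed.

Lemma measurable_err i t : measurable_fun setT (err eps i t).
Proof. exact: (measurableT_comp (measurable_tnth t)). Qed.

Lemma panel_integral_prod (f : 'I_N -> T.-tuple (p.-tuple R) * T.-tuple R -> R)
    (m : 'I_N -> R) :
  iid_panel x eps -> (forall i, measurable_fun setT (f i)) ->
  (forall i v, 0 <= f i v) ->
  (forall i, \int[P]_w (f i (x i w, eps i w))%:E = (m i)%:E)%E ->
  (\int[P]_w (\prod_i f i (x i w, eps i w))%:E = (\prod_i m i)%:E)%E.
Proof.
move=> [ind _] mf f0 fm.
apply: (@integral_prod_indep _ _ _ P _ _ _ (fun i w => (x i w, eps i w))) => //.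
by move=> i; apply: measurable_fun_pair; exact: measurable_funP.
Qed.

(** Conditioning on the regressors turns a linear form in the errors of one
    individual into a function of the regressors of that individual; the
    individuals then factor.  The weights [g] allow other functions of the
    regressors, such as a compensating exponential, to be carried along. *)
Lemma panel_gaussian_mgf (sigma2 : R) (g : 'I_N -> T.-tuple (p.-tuple R) -> R)
    (z : 'I_N -> 'I_T -> T.-tuple (p.-tuple R) -> R) (m : 'I_N -> R) :
  0 < sigma2 -> iid_panel x eps -> exogenous_panel x eps ->
  (forall i, isotropic_normal P sigma2 (err eps i)) ->
  (forall i, measurable_fun setT (g i)) -> (forall i v, 0 <= g i v) ->
  (forall i t, measurable_fun setT (z i t)) ->
  (forall i, \int[P]_w (g i (x i w)
     * expR (sigma2 / 2 * \sum_t z i t (x i w) ^+ 2))%:E = (m i)%:E)%E ->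
  (\int[P]_w (\prod_i (g i (x i w)
     * expR (\sum_t z i t (x i w) * err eps i t w)))%:E = (\prod_i m i)%:E)%E.
Proof.
move=> s0 iid exo gauss mg g0 mz gm.
pose f i (v : T.-tuple (p.-tuple R) * T.-tuple R) :=
  g i v.1 * expR (\sum_t z i t v.1 * tnth v.2 t).
have mf i : measurable_fun setT (f i).
  apply: measurable_funM; first exact: (measurableT_comp (mg i)).
  apply: measurableT_comp => //; apply: measurable_sum => t.
  apply: measurable_funM; first exact: (measurableT_comp (mz i t)).
  exact: (measurableT_comp (measurable_tnth t)).
have f0 i v : 0 <= f i v by rewrite mulr_ge0// expR_ge0.
apply: (@panel_integral_prod f) => // i.
rewrite ge0_integral_independent2//.
rewrite -gm; apply: eq_integral => w _; rewrite /f/=.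
under eq_integral do rewrite EFinM.
rewrite ge0_integralZl_EFin//; last first.
- apply/measurable_EFinP; apply: measurableT_comp => //.
  by apply: measurable_sum => t; apply: measurable_funM => //; exact: measurable_err.
rewrite (@isotropic_normal_mgf _ _ _ P T sigma2 (err eps i))//.
by move=> t; exact: measurable_err.
Qed.

End PanelExpectations.

(** * Exponential moments and concentration *)

Section Subgaussian.
Context {R : realType} {d : measure_display} {Omega : measurableType d}.
Variable P : probability Omega R.

(** Sum of a geometric series of ratio exp (- C/2). *)
Definition square_mgf_bound (C K : R) : R :=
  (1 + K / 2) * expR (C / 2) / (1 - expR (- (C / 2))).

Lemma square_mgf_bound_ge1 C K : 0 < C -> 0 < K -> 1 <= square_mgf_bound C K.
Proof.
move=> C0 K0; rewrite /square_mgf_bound.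
have q1 : expR (- (C / 2)) < 1 by rewrite expR_lt1; lra.
have q0 := expR_gt0 (- (C / 2)).
have e1 : 1 <= expR (C / 2) by rewrite -[leLHS]expR0 ler_expR; lra.
rewrite ler_pdivlMr; last lra.
by nra.
Qed.

(** Slice at the integer values of Y^2: on n <= Y^2 < n + 1 the integrand is at
    most exp (C/2 (n + 1)), and the tail exp (- C n) beats it. *)
Lemma subgaussian_square_mgf (C K : R) (Y : Omega -> R) :
  0 < C -> 0 < K -> measurable_fun setT Y ->
  (forall u : R, 0 < u ->
    (P [set w | (u <= `|Y w|)%R] <= (2^-1 * K * expR (- C * u ^+ 2))%:E)%E) ->
  (\int[P]_w (expR (C / 2 * Y w ^+ 2))%:E <= (square_mgf_bound C K)%:E)%E.
Proof.
move=> C0 K0 mY tailY.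
set c := C / 2.
have c0 : 0 < c by rewrite divr_gt0.
pose A n := [set w | (n%:R <= Y w ^+ 2)%R].
have mA n : measurable (A n).
  by apply: measurable_superlevel; exact: measurable_funX.
have PA n : (P (A n) <= ((1 + K / 2) * expR (- C * n%:R))%:E)%E.
  case: n => [|n].
    rewrite mulr0 expR0 mulr1; apply: (le_trans (probability_le1 _ (mA 0%N))).
    by rewrite lee_fin; lra.
  have -> : A n.+1 = [set w | (Num.sqrt n.+1%:R <= `|Y w|)%R].
    by apply/seteqP; split => w; rewrite /A/= -sqrtr_sqr ler_sqrt// sqr_ge0.
  apply: (le_trans (tailY _ _)); first by rewrite sqrtr_gt0.
  rewrite lee_fin sqr_sqrtr// ler_wpM2r ?expR_ge0//; lra.
pose a n w : R := expR (c * n.+1%:R) * \1_(A n) w.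
have a0 n w : (0 <= (a n w)%:E)%E by rewrite lee_fin mulr_ge0 ?expR_ge0.
have ma n : measurable_fun [set: Omega] (EFin \o a n).
  by apply/measurable_EFinP; apply: measurable_funM.
apply: (@le_trans _ _ (\int[P]_w (\sum_(n <oo) (a n w)%:E))%E).
  apply: ge0_le_integral => //.
  - apply/measurable_EFinP; apply: measurableT_comp => //.
    by apply: measurable_funM => //; exact: measurable_funX.
  - by apply: ge0_emeasurable_sum => [n w _ _|n _]; [exact: a0|exact: ma].
  - move=> w _; pose n := Num.truncn (Y w ^+ 2).
    have /andP[n1 n2] := truncn_itv (sqr_ge0 (Y w)).
    rewrite (@nneseriesD1 _ _ n)//.
    apply: (@le_trans _ _ (a n w)%:E); last first.
      by rewrite leeDl//; apply: nneseries_ge0 => k _ _.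
    rewrite lee_fin /a indicE mem_set// mulr1 ler_expR.
    by rewrite ler_wpM2l ?ltW.
rewrite integral_nneseries//.
apply: lime_le; first by apply: is_cvg_nneseries => n _ _; exact: integral_ge0.
apply: nearW => n.
pose M := (1 + K / 2) * expR c.
apply: (@le_trans _ _ (\sum_(0 <= k < n) (M * expR (- c) ^+ k)%:E)%E).
  apply: lee_sum => k _.
  under eq_integral do rewrite /a EFinM.
  rewrite ge0_integralZl_EFin ?expR_ge0//; last exact/measurable_EFinP.
  rewrite integral_indic// setIT.
  apply: (le_trans (lee_pmul _ _ (lexx _) (PA k))) => //.
  rewrite -EFinM lee_fin /M -expRM_natl mulrCA -mulrA ler_wpM2l ?addr_ge0//.
    by rewrite divr_ge0 ?ltW.
  rewrite -!expRD ler_expR -natr1 mulrDr mulr1.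
  rewrite /c; lra.
rewrite sumEFin lee_fin.
have q1 : expR (- c) < 1 by rewrite expR_lt1; lra.
apply: (@geometric_le_lim _ n M (expR (- c))).
- by rewrite mulr_ge0 ?expR_ge0// addr_ge0// divr_ge0// ltW.
- exact: expR_gt0.
- by rewrite ger0_norm// expR_ge0.
Qed.

End Subgaussian.

Section RealInequalities.
Context {R : realType}.

(** For |y| >= 1/2 the factor 4 lets the quadratic term dominate; for smaller
    |y|, use exp y <= 1 / (1 - y). *)
Lemma expR_le_quadratic (y : R) : expR y <= 1 + y + 4 * y ^+ 2 * expR `|y|.
Proof.
have y2 : 0 <= y ^+ 2 := sqr_ge0 y.
have e1 : 1 <= expR `|y| by rewrite -[leLHS]expR0 ler_expR.
have q4 : 4 * y ^+ 2 <= 4 * y ^+ 2 * expR `|y| by rewrite ler_peMr// mulr_ge0.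
have [y_ge|y_lt] := lerP 2^-1 y.
  have -> : expR `|y| = expR y by rewrite ger0_norm//; lra.
  have e0 := expR_gt0 y; have y4 : 1 <= 4 * y ^+ 2 by nra.
  have : expR y <= 4 * y ^+ 2 * expR y by rewrite ler_peMl// ltW.
  lra.
have [y_le|y_gt] := lerP y (- 2^-1).
  have : expR y <= 1 by rewrite -[leRHS]expR0 ler_expR; lra.
  nra.
have := expR_ge1Dx (- y); rewrite expRN => h.
have e0 := expR_gt0 y.
have h' : expR y * (1 - y) <= 1.
  by rewrite -[leRHS](@mulfV _ (expR y)) ?gt_eqF// ler_pM2l.
nra.
Qed.

Lemma sqr_le_expR (y : R) : 0 <= y -> y ^+ 2 <= 4 * expR y.
Proof.
move=> y0.
have -> : expR y = expR (y / 2) ^+ 2 by rewrite -expRM_natl; congr expR; lra.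
have h := expR_ge1Dx (y / 2).
nra.
Qed.

(** Jensen's inequality, from the tangent of exp at the mean.  Averaging in this
    way over the periods of one individual is what allows them to be arbitrarily
    dependent. *)
Lemma expR_mean_le n (u : 'I_n -> R) : (0 < n)%N ->
  expR (n%:R^-1 * \sum_i u i) <= n%:R^-1 * \sum_i expR (u i).
Proof.
move=> n0; set m := _ * _.
have nR : (n%:R : R) != 0 by rewrite pnatr_eq0 -lt0n.
have tangent i : expR m * (1 + (u i - m)) <= expR (u i).
  rewrite -[in leRHS](subrK m (u i)) expRD mulrC ler_pM2r ?expR_gt0//.
  exact: expR_ge1Dx.
have : \sum_i expR m * (1 + (u i - m)) <= \sum_i expR (u i).
  by apply: ler_sum => i _.
rewrite -mulr_sumr big_split/= sumrB !sumr_const card_ord.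
have -> : \sum_i u i = m *+ n by rewrite -mulr_natr /m mulrAC mulVf ?mul1r.
rewrite subrr addr0 => h.
by rewrite mulrC ler_pdivlMr// ltr0n.
Qed.

Lemma expR_half_sum_le (a b : R) : expR ((a + b) / 2) <= (expR a + expR b) / 2.
Proof.
have -> : expR ((a + b) / 2) = expR (a / 2) * expR (b / 2).
  by rewrite -expRD; congr expR; lra.
have -> : expR a = expR (a / 2) ^+ 2 by rewrite -expRM_natl; congr expR; lra.
have -> : expR b = expR (b / 2) ^+ 2 by rewrite -expRM_natl; congr expR; lra.
have h := sqr_ge0 (expR (a / 2) - expR (b / 2)); nra.
Qed.

End RealInequalities.

Section ExponentialMoments.
Context {R : realType} {d : measure_display} {Omega : measurableType d}.
Variable P : probability Omega R.

Lemma markov_le (A : set Omega) (g : Omega -> R) (c : R) :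
  measurable A -> measurable_fun setT g -> (forall w, 0 <= g w) -> 0 < c ->
  (forall w, A w -> c <= g w) ->
  (P A <= (c^-1)%:E * \int[P]_w (g w)%:E)%E.
Proof.
move=> mA mg g0 c0 cg.
have : (c%:E * P A <= \int[P]_w (g w)%:E)%E.
  have -> : (c%:E * P A = \int[P]_w (c * \1_A w)%:E)%E.
    under eq_integral do rewrite EFinM.
    rewrite ge0_integralZl_EFin ?ltW//; last exact/measurable_EFinP.
    by rewrite integral_indic// setIT.
  apply: ge0_le_integral => //.
  - by move=> w _; rewrite lee_fin mulr_ge0// ltW.
  - by apply/measurable_EFinP/measurable_funM.
  - by apply/measurable_EFinP.
  - move=> w _; rewrite lee_fin indicE.
    case: (boolP (w \in A)) => [/set_mem Aw|_]; last by rewrite mulr0.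
    by rewrite mulr1 cg.
move=> h; rewrite -(@lee_pmul2l _ c%:E)// muleA -EFinM mulfV ?gt_eqF// mul1e//.
Qed.

Lemma integrable_of_exp_moment (V : Omega -> R) (s K1 : R) :
  0 < s -> measurable_fun setT V ->
  (\int[P]_w (expR (s * `|V w|))%:E <= K1%:E)%E ->
  P.-integrable setT (EFin \o V).
Proof.
move=> s0 mV hV; apply/integrableP; split; first exact/measurable_EFinP.
apply: (@le_lt_trans _ _ (s^-1%:E * \int[P]_w (expR (s * `|V w|))%:E)%E).
  have mE : measurable_fun setT (fun w => expR (s * `|V w|)).
    apply: measurableT_comp => //; apply: measurable_funM => //.
    exact: measurableT_comp.
  have -> : (s^-1%:E * \int[P]_w (expR (s * `|V w|))%:E
             = \int[P]_w (s^-1 * expR (s * `|V w|))%:E)%E.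
    under [RHS]eq_integral do rewrite EFinM.
    rewrite ge0_integralZl_EFin ?invr_ge0 ?ltW//; first exact/measurable_EFinP.
  apply: ge0_le_integral => //.
  - by apply: measurableT_comp => //; exact/measurable_EFinP.
  - by apply/measurable_EFinP/measurable_funM.
  - move=> w _; rewrite /= lee_fin mulrC ler_pdivlMr// mulrC.
    have := expR_ge1Dx (s * `|V w|); lra.
apply: (le_lt_trans (lee_wpmul2l _ hV)); first by rewrite lee_fin invr_ge0 ltW.
by rewrite -EFinM ltry.
Qed.

(** The factor 64 is the product of the constant 4 of [expR_le_quadratic] and of
    the constant 16 / s^2 that [sqr_le_expR] gives at y = s z / 2. *)
Definition variance_proxy (s K1 : R) : R := 64 * K1 * expR K1 / s ^+ 2.

Lemma abs_mean_le_exp_moment (V : Omega -> R) (s K1 : R) :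
  0 < s -> measurable_fun setT V ->
  (\int[P]_w (expR (s * `|V w|))%:E <= K1%:E)%E ->
  `|fine (\int[P]_w (V w)%:E)%E| <= K1 / s.
Proof.
move=> s0 mV hV; have iV := integrable_of_exp_moment s0 mV hV.
rewrite -lee_fin -fine_abse ?integrable_fin_num//.
rewrite fineK ?abse_fin_num ?integrable_fin_num//.
apply: (le_trans (le_abse_integral _ measurableT _)); first exact/measurable_EFinP.
rewrite EFinM lee_pdivlMr// muleC.
apply: le_trans hV.
have mE : measurable_fun setT (fun w => expR (s * `|V w|)).
  apply: measurableT_comp => //; apply: measurable_funM => //.
  exact: measurableT_comp.
have mN : measurable_fun setT (fun w => `|V w|) by exact: measurableT_comp.
have -> : (s%:E * \int[P]_w `|(V w)%:E| = \int[P]_w (s * `|V w|)%:E)%E.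
  under [RHS]eq_integral do rewrite EFinM.
  by rewrite ge0_integralZl_EFin ?ltW//; exact/measurable_EFinP.
apply: ge0_le_integral => //.
- by move=> w _; rewrite lee_fin mulr_ge0// ltW.
- by apply/measurable_EFinP/measurable_funM.
- exact/measurable_EFinP.
- move=> w _; rewrite /= lee_fin.
  have := expR_ge1Dx (s * `|V w|); lra.
Qed.

Lemma integral_affine2 (k a b : R) (f h : Omega -> R) :
  P.-integrable setT (EFin \o f) -> P.-integrable setT (EFin \o h) ->
  (\int[P]_w (k + a * f w + b * h w)%:E
   = k%:E + a%:E * \int[P]_w (f w)%:E + b%:E * \int[P]_w (h w)%:E)%E.
Proof.
move=> fi hi; under eq_integral do rewrite !EFinD !EFinM.
have ki : P.-integrable setT (fun=> k%:E).
  exact: finite_measure_integrable_cst.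
have afi := integrableZl measurableT a fi.
have bhi := integrableZl measurableT b hi.
rewrite (integralD measurableT (integrableD measurableT ki afi) bhi).
rewrite (integralD measurableT ki afi).
rewrite (integralZl measurableT fi) (integralZl measurableT hi).
by rewrite integral_cst//= probability_setT mule1.
Qed.

(** In the second order expansion of exp the linear term has mean zero.  The
    quadratic term is dominated by exp (s |V|) because [th] is at most s / 2. *)
Lemma centered_mgf_le (V : Omega -> R) (s K1 th : R) :
  0 < s -> measurable_fun setT V ->
  (\int[P]_w (expR (s * `|V w|))%:E <= K1%:E)%E -> `|th| <= s / 2 ->
  (\int[P]_w (expR (th * (V w - fine (\int[P]_w' (V w')%:E)%E)))%:E
   <= (expR (variance_proxy s K1 * th ^+ 2))%:E)%E.
Proof.
move=> s0 mV hV ths; have iV := integrable_of_exp_moment s0 mV hV.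
have m_le := abs_mean_le_exp_moment s0 mV hV.
set m := fine _ in m_le *.
have mEV : measurable_fun setT (fun w => expR (s * `|V w|)).
  apply: measurableT_comp => //; apply: measurable_funM => //.
  exact: measurableT_comp.
have iE : P.-integrable setT (fun w => (expR (s * `|V w|))%:E).
  apply/integrableP; split; first exact/measurable_EFinP.
  under eq_integral do rewrite /= ger0_norm ?expR_ge0//.
  by apply: (le_lt_trans hV); rewrite ltry.
pose c := 64 * expR K1 / s ^+ 2 * th ^+ 2.
have c0 : 0 <= c by rewrite mulr_ge0 ?sqr_ge0// divr_ge0 ?sqr_ge0// mulr_ge0 ?expR_ge0.
pose g w := 1 - th * m + th * V w + c * expR (s * `|V w|).
have pointwise w : expR (th * (V w - m)) <= g w.
  set y := th * (V w - m).
  have := expR_le_quadratic y.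
  set z := `|V w - m|.
  have z0 : 0 <= z by exact: normr_ge0.
  have zle : z <= `|V w| + K1 / s.
    by apply: (le_trans (ler_normB _ _)); rewrite lerD2l.
  have yz : expR `|y| <= expR (s / 2 * z).
    by rewrite ler_expR /y normrM ler_wpM2r.
  have y2 : y ^+ 2 = th ^+ 2 * z ^+ 2 by rewrite /y exprMn /z real_normK ?num_real.
  have z2 : z ^+ 2 <= 16 / s ^+ 2 * expR (s / 2 * z).
    have sz0 : 0 <= s / 2 * z by rewrite mulr_ge0// divr_ge0// ltW.
    have h := sqr_le_expR sz0.
    have -> : z ^+ 2 = 4 / s ^+ 2 * (s / 2 * z) ^+ 2 by field; lra.
    have -> : 16 / s ^+ 2 * expR (s / 2 * z) = 4 / s ^+ 2 * (4 * expR (s / 2 * z)).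
      by field; lra.
    by rewrite ler_wpM2l// divr_ge0 ?sqr_ge0.
  have sz : expR (s / 2 * z) ^+ 2 <= expR K1 * expR (s * `|V w|).
    rewrite -expRM_natl -expRD ler_expR.
    have : s * z <= s * (`|V w| + K1 / s) by rewrite ler_pM2l.
    rewrite mulrDr mulrCA mulfV ?gt_eqF// mulr1; lra.
  move=> h; apply: (le_trans h); rewrite /g.
  have -> : 1 + y = 1 - th * m + th * V w by rewrite /y; ring.
  rewrite lerD2l y2.
  apply: (@le_trans _ _ (4 * th ^+ 2 * (z ^+ 2 * expR (s / 2 * z)))).
    have := mulr_ge0 (sqr_ge0 th) (sqr_ge0 z); nra.
  have -> : c * expR (s * `|V w|)
      = 4 * th ^+ 2 * (16 / s ^+ 2 * (expR K1 * expR (s * `|V w|))).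
    by rewrite /c; field; lra.
  apply: ler_wpM2l; first by rewrite mulr_ge0 ?sqr_ge0.
  set e := expR (s / 2 * z) in z2 sz *.
  have e0 : 0 <= e by exact: expR_ge0.
  apply: (@le_trans _ _ (16 / s ^+ 2 * e * e)); first exact: ler_wpM2r.
  rewrite -mulrA -expr2; apply: ler_wpM2l => //.
  by rewrite divr_ge0 ?sqr_ge0.
apply: (@le_trans _ _ (\int[P]_w (g w)%:E)%E).
  apply: ge0_le_integral => //.
  - by apply/measurable_EFinP; apply: measurableT_comp => //;
      apply: measurable_funM => //; exact: measurable_funB.
  - apply/measurable_EFinP; rewrite /g; apply: measurable_funD; last exact: measurable_funM.
    by apply: measurable_funD => //; exact: measurable_funM.
  - by move=> w _; rewrite lee_fin.
have -> : (\int[P]_w (g w)%:E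
    = (1 - th * m)%:E + th%:E * \int[P]_w (V w)%:E
      + c%:E * \int[P]_w (expR (s * `|V w|))%:E)%E.
  exact: integral_affine2.
have -> : (\int[P]_w (V w)%:E = m%:E)%E by rewrite /m fineK ?integrable_fin_num.
apply: (@le_trans _ _ ((1 - th * m)%:E + th%:E * m%:E + c%:E * K1%:E)%E).
  by rewrite leeD2l// lee_wpmul2l// lee_fin.
rewrite -!EFinM -!EFinD lee_fin subrK.
apply: le_trans (expR_ge1Dx _).
rewrite lerD2l /c /variance_proxy le_eqVlt; apply/orP; left; apply/eqP; ring.
Qed.

End ExponentialMoments.

Section PanelConcentration.
Context {R : realType} {d : measure_display} {Omega : measurableType d}.
Variable P : probability Omega R.
Variables N T p : nat.
Variable x : 'I_N -> {RV P >-> T.-tuple (p.-tuple R)}.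
Variable eps : 'I_N -> {RV P >-> T.-tuple R}.

Definition panel_mean (h : T.-tuple (p.-tuple R) -> R) (i : 'I_N) : R :=
  fine (\int[P]_w (h (x i w))%:E)%E.

(** Chernoff's method: the exponential moment of the sum is a product over the
    independent individuals. *)
Lemma panel_mean_upper_tail (h : T.-tuple (p.-tuple R) -> R) (s K1 th tau : R) :
  iid_panel x eps -> measurable_fun setT h -> 0 < s ->
  (forall i, \int[P]_w (expR (s * `|h (x i w)|))%:E <= K1%:E)%E ->
  0 <= th <= s / 2 ->
  (P [set w | (N%:R * tau <= \sum_i (h (x i w) - panel_mean h i))%R]
   <= (expR (N%:R * (variance_proxy s K1 * th ^+ 2 - th * tau)))%:E)%E.
Proof.
move=> iid mh s0 hK1 /andP[th0 ths]; set m := panel_mean h.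
pose f i (v : T.-tuple (p.-tuple R) * T.-tuple R) := expR (th * (h v.1 - m i)).
have mhx i : measurable_fun setT (fun w => h (x i w)) by exact: measurableT_comp.
have mf i : measurable_fun setT (f i).
  apply: measurableT_comp => //; apply: measurable_funM => //.
  by apply: measurable_funB => //; exact: (measurableT_comp mh).
pose b := expR (variance_proxy s K1 * th ^+ 2).
have fb i : (\int[P]_w (f i (x i w, eps i w))%:E <= b%:E)%E.
  by apply: (@centered_mgf_le _ _ _ P (fun w => h (x i w))) => //; rewrite ger0_norm.
have f0 i : (0 <= \int[P]_w (f i (x i w, eps i w))%:E)%E.
  by apply: integral_ge0 => w _; rewrite lee_fin expR_ge0.
pose q i := fine (\int[P]_w (f i (x i w, eps i w))%:E)%E.
have qE i : (\int[P]_w (f i (x i w, eps i w))%:E = (q i)%:E)%E.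
  by rewrite /q fineK// ge0_fin_numE// (le_lt_trans (fb i)) ?ltry.
have Eprod := panel_integral_prod iid mf (fun i v => expR_ge0 _) qE.
pose S w := \sum_i (h (x i w) - m i).
have mS : measurable_fun setT S.
  by apply: measurable_sum => i; exact: measurable_funB.
have mexp : measurable_fun setT (fun w => expR (th * S w)).
  by apply: measurableT_comp => //; exact: measurable_funM.
have mA : measurable [set w | (N%:R * tau <= S w)%R].
  exact: measurable_superlevel.
apply: (le_trans (@markov_le _ _ _ P _ (fun w => expR (th * S w))
   (expR (th * (N%:R * tau))) mA mexp _ _ _)).
- by move=> w; exact: expR_ge0.
- exact: expR_gt0.
- by move=> w /= hw; rewrite ler_expR ler_wpM2l.
rewrite (_ : (\int[P]_w _)%E = (\prod_i q i)%:E); last first.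
  rewrite -Eprod; apply: eq_integral => w _.
  by rewrite /f /S mulr_sumr expR_sum.
rewrite -EFinM lee_fin -expRN mulrBr expRD mulrC ler_pM ?expR_ge0//.
- by apply: prodr_ge0 => i _; rewrite fine_ge0.
- rewrite -[leRHS]/(expR _) expRM_natl.
  rewrite -[N in leRHS]card_ord -prodr_const.
  by apply: ler_prod => i _; rewrite fine_ge0//= -lee_fin -qE.
- by rewrite ler_expR lerN2; rewrite mulrCA.
Qed.

Lemma panel_mean_concentration (h : T.-tuple (p.-tuple R) -> R) (s K1 th tau : R) :
  (0 < N)%N -> iid_panel x eps -> measurable_fun setT h -> 0 < s ->
  (forall i, \int[P]_w (expR (s * `|h (x i w)|))%:E <= K1%:E)%E ->
  0 <= th <= s / 2 ->
  (P [set w | (tau < `|N%:R^-1 * \sum_i h (x i w) - N%:R^-1 * \sum_i panel_mean h i|)%R]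
   <= (2 * expR (N%:R * (variance_proxy s K1 * th ^+ 2 - th * tau)))%:E)%E.
Proof.
move=> N0 iid mh s0 hK1 ths; set m := panel_mean h.
have NR : 0 < N%:R :> R by rewrite ltr0n.
have mhx i : measurable_fun setT (fun w => h (x i w)) by exact: measurableT_comp.
pose h' v := - h v.
have mh' : measurable_fun setT h' by exact: measurableT_comp.
have up := panel_mean_upper_tail tau iid mh s0 hK1 ths.
have hK1' i : (\int[P]_w (expR (s * `|h' (x i w)|))%:E <= K1%:E)%E.
  by rewrite /h'; under eq_integral do rewrite normrN.
have dn := panel_mean_upper_tail tau iid mh' s0 hK1' ths.
pose m' := panel_mean h'.
have m'E i : m' i = - m i.
  rewrite /m' /m /panel_mean -fineN -integralN//.
  exact: (integrable_add_def measurableT (integrable_of_exp_moment s0 (mhx i) (hK1 i))).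
pose S w := \sum_i (h (x i w) - m i).
have SE w : N%:R^-1 * \sum_i h (x i w) - N%:R^-1 * \sum_i m i = N%:R^-1 * S w.
  by rewrite -mulrBr /S sumrB.
pose S' w := \sum_i (h' (x i w) - m' i).
have S'E w : S' w = - S w.
  by rewrite /S' /S -sumrN; apply: eq_bigr => i _; rewrite m'E /h' opprB opprK addrC.
have mS : measurable_fun setT S.
  by apply: measurable_sum => i; exact: measurable_funB.
have mS' : measurable_fun setT S'.
  by apply: measurable_sum => i; apply: measurable_funB => //; exact: measurableT_comp.
apply: (@le_trans _ _ (P ([set w | (N%:R * tau <= S w)%R]
    `|` [set w | (N%:R * tau <= S' w)%R]))).
  apply: le_measure; rewrite ?inE.
  - apply: measurable_strict_superlevel; apply: measurableT_comp => //.
    under eq_fun do rewrite SE.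
    exact: measurable_funM.
  - by apply: measurableU; exact: measurable_superlevel.
  - move=> w /=; rewrite SE S'E lter_normr => /orP[h1|h1]; [left|right].
      by move: h1; rewrite mulrC ltr_pdivlMr// mulrC => /ltW.
    by move: h1; rewrite -mulrN mulrC ltr_pdivlMr// mulrC => /ltW.
apply: (le_trans (measureU2 _ _ _)); [exact: measurable_superlevel..|].
rewrite mulrDl mul1r EFinD.
by apply: leeD; [exact: up|exact: dn].
Qed.

End PanelConcentration.

(** * The sample Gram matrix *)

Section ElementaryBounds.
Context {R : realType} {d : measure_display} {Omega : measurableType d}.
Variable P : probability Omega R.

Lemma union_bound (I : finType) (A : I -> set Omega) :
  (forall i, measurable (A i)) ->
  measurable [set w | exists i, A i w] /\
  (P [set w | exists i, A i w] <= \sum_i P (A i))%E.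
Proof.
move=> mA.
suff key (s : seq I) : measurable [set w | exists2 i, i \in s & A i w] /\
    (P [set w | exists2 i, i \in s & A i w] <= \sum_(i <- s) P (A i))%E.
  rewrite (_ : [set w | exists i, A i w]
               = [set w | exists2 i, i \in enum I & A i w]).
    by have := key (enum I); rewrite big_enum.
  by apply/seteqP; split => w [i]; exists i => //; rewrite mem_enum.
elim: s => [|i s [ms Ps]].
  rewrite (_ : [set w | _] = set0); first by rewrite measure0 big_nil.
  by apply/seteqP; split => w // [].
rewrite (_ : [set w | _] = A i `|` [set w | exists2 j, j \in s & A j w]).
  split; first exact: measurableU.
  rewrite big_cons; apply: (le_trans (measureU2 _ _ _)) => //.
  exact: leeD2l.
apply/seteqP; split => w.
  move=> [j]; rewrite inE => /orP[/eqP ->|js Aj]; first by left.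
  by right; exists j.
move=> [Ai|[j js Aj]]; first by exists i; rewrite // inE eqxx.
by exists j; rewrite // inE js orbT.
Qed.

Lemma integral_mean_le n (f : 'I_n -> Omega -> R) (K : R) : (0 < n)%N ->
  (forall i, measurable_fun setT (f i)) -> (forall i w, 0 <= f i w) ->
  (forall i, \int[P]_w (f i w)%:E <= K%:E)%E ->
  (\int[P]_w (n%:R^-1 * \sum_i f i w)%:E <= K%:E)%E.
Proof.
move=> n0 mf f0 fK; have nR : 0 < n%:R :> R by rewrite ltr0n.
have -> : (\int[P]_w (n%:R^-1 * \sum_i f i w)%:E
    = n%:R^-1%:E * \sum_i \int[P]_w (f i w)%:E)%E.
  rewrite -ge0_integral_sum//; last 2 first.
  - by move=> i; exact/measurable_EFinP.
  - by move=> i w _; rewrite lee_fin.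
  rewrite -ge0_integralZl_EFin ?invr_ge0//; last 2 first.
  - by move=> w _; apply: sume_ge0 => i _; rewrite lee_fin.
  - by apply: emeasurable_sum => i; exact/measurable_EFinP.
  by apply: eq_integral => w _; rewrite EFinM -sumEFin.
apply: (@le_trans _ _ (n%:R^-1%:E * \sum_(i < n) K%:E)%E).
  by rewrite lee_wpmul2l ?lee_fin ?invr_ge0//; exact: lee_sum.
by rewrite sumEFin sumr_const card_ord -EFinM lee_fin -[K *+ n]mulr_natr mulrC mulfK ?gt_eqF.
Qed.

End ElementaryBounds.

Section Gram.
Context {R : realType} {d : measure_display} {Omega : measurableType d}.
Variable P : probability Omega R.
Variables N T p : nat.
Variable x : 'I_N -> {RV P >-> T.-tuple (p.-tuple R)}.
Variable eps : 'I_N -> {RV P >-> T.-tuple R}.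

Lemma sum_stack_index (F : 'I_(N * T) -> R) :
  \sum_r F r = \sum_i \sum_t F (mxvec_index i t).
Proof.
rewrite pair_bigA (reindex _ (curry_mxvec_bij N T)).
by apply: eq_bigr => -[i t] _.
Qed.

(** Entry (k, l) of X_i'X_i / T, as a function of the regressors of individual
    i. *)
Definition gram_entry (k l : 'I_p) (v : T.-tuple (p.-tuple R)) : R :=
  T%:R^-1 * \sum_t tnth (tnth v t) k * tnth (tnth v t) l.

Definition sample_gram k l w : R := N%:R^-1 * \sum_i gram_entry k l (x i w).

Lemma sample_gramE k l w :
  sample_gram k l w
  = (N * T)%:R^-1 * \sum_i \sum_t cov x i t k w * cov x i t l w.
Proof.
rewrite /sample_gram /gram_entry -mulr_sumr natrM invfM -mulrA.
by congr (_ * _); rewrite mulrA.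
Qed.

Lemma measurable_gram_entry k l : measurable_fun setT (gram_entry k l).
Proof.
apply: measurable_funM => //; apply: measurable_sum => t.
by apply: measurable_funM; exact: measurable_regressor.
Qed.

Lemma measurable_sample_gram k l : measurable_fun setT (sample_gram k l).
Proof.
apply: measurable_funM => //; apply: measurable_sum => i.
by apply: measurableT_comp => //; exact: measurable_gram_entry.
Qed.

Variables C K : R.
Hypotheses (C0 : 0 < C) (K0 : 0 < K) (T0 : (0 < T)%N).
Hypotheses (iid : iid_panel x eps) (sub : subgaussian_panel x eps C K).
Local Notation K1 := (square_mgf_bound C K).

Lemma panel_square_mgf i t k :
  (\int[P]_w (expR (C / 2 * cov x i t k w ^+ 2))%:E <= K1%:E)%E.
Proof.
apply: subgaussian_square_mgf => //; first exact: measurable_cov.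
move=> u u0; have N0 : (0 < N)%N by exact: leq_ltn_trans (ltn_ord i).
have [h _] := sub t (i := Ordinal N0) erefl u0.
have [_ idd] := iid.
pose B : set (T.-tuple (p.-tuple R) * T.-tuple R) :=
  [set v | (u <= `|tnth (tnth v.1 t) k|)%R].
have mB : measurable B.
  apply: measurable_superlevel.
  apply: (@measurableT_comp _ _ _ _ _ _ (fun y : R => `|y|)) => //.
  exact: (measurableT_comp (measurable_regressor t k)).
have := idd i (Ordinal N0) B mB.
by rewrite /= => ->; exact: h.
Qed.

(** |x_k x_l| <= (x_k^2 + x_l^2) / 2, followed by Jensen's inequality over the
    periods and over the pair (k, l). *)
Lemma gram_entry_exp_moment i k l :
  (\int[P]_w (expR (C / 2 * `|gram_entry k l (x i w)|))%:E <= K1%:E)%E.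
Proof.
have TR : 0 < T%:R :> R by rewrite ltr0n.
have mE t j : measurable_fun setT (fun w => expR (C / 2 * cov x i t j w ^+ 2)).
  apply: measurableT_comp => //; apply: measurable_funM => //.
  by apply: measurable_funX; exact: measurable_cov.
(* The average of two exponentials is written as a sum over 'I_2 so that
   [integral_mean_le] applies to it as well. *)
pose kl (j : 'I_2) := if val j == 0%N then k else l.
pose g w := T%:R^-1 * \sum_t (2^-1 * \sum_j expR (C / 2 * cov x i t (kl j) w ^+ 2)).
apply: (@le_trans _ _ (\int[P]_w (g w)%:E)%E).
  apply: ge0_le_integral => //.
  - apply/measurable_EFinP; apply: measurableT_comp => //.
    apply: measurable_funM => //; apply: measurableT_comp => //.
    by apply: measurableT_comp => //; exact: measurable_gram_entry.
  - apply/measurable_EFinP; apply: measurable_funM => //.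
    apply: measurable_sum => t; apply: measurable_funM => //.
    exact: measurable_sum.
  - move=> w _; rewrite lee_fin.
    apply: (@le_trans _ _ (expR (T%:R^-1 * \sum_t
        ((C / 2 * cov x i t k w ^+ 2 + C / 2 * cov x i t l w ^+ 2) / 2)))).
      rewrite ler_expR /gram_entry normrM ger0_norm ?invr_ge0//.
      rewrite mulrCA ler_wpM2l ?invr_ge0//.
      rewrite -ler_pdivlMl ?divr_gt0//.
      apply: (le_trans (ler_norm_sum _ _ _)); rewrite mulr_sumr.
      apply: ler_sum => t _.
      rewrite /cov; set a := tnth _ k; set b := tnth _ l.
      have -> : (C / 2)^-1 * ((C / 2 * a ^+ 2 + C / 2 * b ^+ 2) / 2)
        = (a ^+ 2 + b ^+ 2) / 2 by field; rewrite gt_eqF.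
      have := sqr_ge0 (a - b); have := sqr_ge0 (a + b).
      by rewrite ler_norml; nra.
    apply: (le_trans (expR_mean_le _ T0)); rewrite ler_wpM2l ?invr_ge0//.
    apply: ler_sum => t _; rewrite !big_ord_recl big_ord0 addr0 [leRHS]mulrC.
    exact: expR_half_sum_le.
apply: integral_mean_le => // [t|t w|t].
- by apply: measurable_funM => //; apply: measurable_sum => j.
- by rewrite mulr_ge0// sumr_ge0// => j _; exact: expR_ge0.
- by apply: integral_mean_le => // j; exact: panel_square_mgf.
Qed.

End Gram.

Section GramDeviation.
Context {R : realType} {d : measure_display} {Omega : measurableType d}.
Variable P : probability Omega R.
Variables N T p : nat.
Variable x : 'I_N -> {RV P >-> T.-tuple (p.-tuple R)}.
Variable eps : 'I_N -> {RV P >-> T.-tuple R}.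
Variables C K : R.
Hypotheses (C0 : 0 < C) (K0 : 0 < K) (T0 : (0 < T)%N).
Hypotheses (iid : iid_panel x eps) (sub : subgaussian_panel x eps C K).
Local Notation K1 := (square_mgf_bound C K).

Lemma Xmat_gram k l w :
  ((N * T)%:R^-1 *: ((Xmat x w)^T *m Xmat x w)) k l = sample_gram x k l w.
Proof.
rewrite !mxE sample_gramE sum_stack_index; congr (_ * _).
by apply: eq_bigr => i _; apply: eq_bigr => t _; rewrite !mxE !mxvecE !mxE.
Qed.

Lemma sample_gram_mean k l :
  (\int[P]_w (sample_gram x k l w)%:E
   = (N%:R^-1 * \sum_i panel_mean x (gram_entry k l) i)%:E)%E.
Proof.
have s0 : 0 < C / 2 by rewrite divr_gt0.
have mh i : measurable_fun setT (fun w => gram_entry k l (x i w)).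
  by apply: measurableT_comp => //; exact: measurable_gram_entry.
have hi i := integrable_of_exp_moment s0 (mh i)
  (gram_entry_exp_moment C0 K0 T0 iid sub i k l).
rewrite /sample_gram; under eq_integral do rewrite EFinM -sumEFin.
rewrite integralZl//; last by apply: integrable_sum => // i _; exact: hi.
rewrite integral_sum// EFinM -sumEFin; congr (_ * _)%E.
apply: eq_bigr => i _; rewrite /panel_mean fineK//. exact: (integrable_fin_num measurableT (hi i)).
Qed.

Lemma Gamma_lshift k l :
  Gamma x (lshift N k) (lshift N l)
  = N%:R^-1 * \sum_i panel_mean x (gram_entry k l) i.
Proof.
rewrite /Gamma block_mxEul mxE unlock.
rewrite -[RHS]/(fine (_)%:E) -sample_gram_mean; congr fine.
by apply: eq_integral => w _; rewrite Xmat_gram.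
Qed.

(** The Chernoff parameter at deviation tau is [deviation_slope kmax * tau].  The
    first bound keeps it in the range of [centered_mgf_le] for tau <= kmax; the
    second keeps the quadratic term below half of the linear one. *)
Definition deviation_slope (kmax : R) : R :=
  Num.min (C / 4 / kmax) (2 * variance_proxy (C / 2) K1)^-1.

Lemma deviation_slope_gt0 kmax : 0 < kmax -> 0 < deviation_slope kmax.
Proof.
move=> k0; have K1pos := lt_le_trans ltr01 (square_mgf_bound_ge1 C0 K0).
rewrite lt_min !divr_gt0//= invr_gt0 mulr_gt0// divr_gt0 ?exprn_gt0 ?divr_gt0//.
by rewrite mulr_gt0 ?expR_gt0// mulr_gt0.
Qed.

Lemma gram_entry_deviation k l (kmax tau : R) :
  (0 < N)%N -> 0 < kmax -> 0 <= tau <= kmax ->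
  (P [set w | (tau < `|sample_gram x k l w
                       - Gamma x (lshift N k) (lshift N l)|)%R]
   <= (2 * expR (- (deviation_slope kmax / 2) * (tau ^+ 2 * N%:R)))%:E)%E.
Proof.
move=> N0 k0 /andP[t0 tk]; have s0 : 0 < C / 2 by rewrite divr_gt0.
set q := deviation_slope kmax.
have q0 : 0 < q := deviation_slope_gt0 k0.
have qs : q * kmax <= C / 4 by rewrite -ler_pdivlMr// ge_min lexx.
have K1pos := lt_le_trans ltr01 (square_mgf_bound_ge1 C0 K0).
set b := variance_proxy (C / 2) K1.
have b0 : 0 < b.
  by rewrite divr_gt0 ?exprn_gt0// mulr_gt0 ?expR_gt0// mulr_gt0.
have qb : q * b <= 1 / 2.
  have : q <= (2 * b)^-1 by rewrite ge_min lexx orbT.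
  rewrite -[(2 * b)^-1]mul1r ler_pdivlMr => [h|]; [lra|exact: mulr_gt0].
have th : 0 <= q * tau <= C / 2 / 2.
  apply/andP; split; first by apply: mulr_ge0 => //; exact: ltW.
  apply: (@le_trans _ _ (q * kmax)); last lra.
  by rewrite ler_pM2l.
rewrite Gamma_lshift.
have := panel_mean_concentration tau N0 iid (measurable_gram_entry k l) s0
  (fun i => gram_entry_exp_moment C0 K0 T0 iid sub i k l) th.
move=> /le_trans; apply; rewrite lee_fin ler_pM2l// ler_expR -/b.
have NR : 0 <= N%:R :> R by [].
have -> : - (q / 2) * (tau ^+ 2 * N%:R) = N%:R * (q * tau ^+ 2 * (- (1 / 2))).
  by field.
apply: ler_wpM2l => //.
have -> : b * (q * tau) ^+ 2 - q * tau * tau = q * tau ^+ 2 * (q * b - 1) by ring.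
apply: ler_wpM2l; last lra.
by apply: mulr_ge0; [exact: ltW|exact: sqr_ge0].
Qed.

Definition gram_bad tau w := exists kl : 'I_p * 'I_p,
  tau < `|sample_gram x kl.1 kl.2 w - Gamma x (lshift N kl.1) (lshift N kl.2)|.

Lemma gram_bad_prob (kmax tau : R) :
  (0 < N)%N -> 0 < kmax -> 0 <= tau <= kmax ->
  measurable [set w | gram_bad tau w] /\
  (P [set w | gram_bad tau w]
   <= ((p ^ 2)%:R * (2 * expR (- (deviation_slope kmax / 2) * (tau ^+ 2 * N%:R))))%:E)%E.
Proof.
move=> N0 k0 tk.
pose A (kl : 'I_p * 'I_p) := [set w | (tau < `|sample_gram x kl.1 kl.2 w
  - Gamma x (lshift N kl.1) (lshift N kl.2)|)%R].
have mA kl : measurable (A kl).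
  apply: measurable_strict_superlevel; apply: measurableT_comp => //.
  by apply: measurable_funB => //; exact: measurable_sample_gram.
have [mU PU] := union_bound P mA; split => //.
apply: (le_trans PU).
set q := (X in (_ <= (_ * X)%:E)%E).
apply: (@le_trans _ _ (\sum_(kl : 'I_p * 'I_p) q%:E)%E).
  by apply: lee_sum => kl _; exact: gram_entry_deviation.
rewrite sumEFin sumr_const card_prod !card_ord -mulnn lee_fin.
by rewrite -[q *+ _]mulr_natl.
Qed.

End GramDeviation.

(** * Anti-concentration away from two opposite points *)

Section HasMean.
Context {R : realType} {d : measure_display} {Omega : measurableType d}.
Variable P : probability Omega R.

(** Integrability and value are bundled so that linear combinations of known
    moments can be compared pointwise. *)
Definition has_mean (f : Omega -> R) (m : R) : Prop :=
  P.-integrable setT (EFin \o f) /\ (\int[P]_w (f w)%:E = m%:E)%E.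

Lemma has_mean_ge0 (f : Omega -> R) (m : R) : measurable_fun setT f -> (forall w, 0 <= f w) ->
  (\int[P]_w (f w)%:E = m%:E)%E -> has_mean f m.
Proof.
move=> mf f0 fm; split=> //; apply/integrableP; split; first exact/measurable_EFinP.
by under eq_integral do rewrite /= ger0_norm//; rewrite fm ltry.
Qed.

Lemma has_mean_cst c : has_mean (fun=> c) c.
Proof.
split; first exact: finite_measure_integrable_cst.
by rewrite integral_cst//= probability_setT mule1.
Qed.

Lemma has_meanD f g m n :
  has_mean f m -> has_mean g n -> has_mean (fun w => f w + g w) (m + n).
Proof.
move=> [fi fm] [gi gn]; split.
  exact: (integrableD measurableT fi gi).
under eq_integral do rewrite EFinD.
by rewrite (integralD measurableT fi gi) EFinD -fm -gn.
Qed.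

Lemma has_meanZ c f m : has_mean f m -> has_mean (fun w => c * f w) (c * m).
Proof.
move=> [fi fm]; split; first exact: (integrableZl measurableT c fi).
under eq_integral do rewrite EFinM.
by rewrite (integralZl measurableT fi) EFinM -fm.
Qed.

Lemma has_mean_le f g m n :
  has_mean f m -> has_mean g n -> (forall w, f w <= g w) -> m <= n.
Proof.
move=> [fi fm] [gi gn] fg; rewrite -lee_fin -fm -gn.
by apply: le_integral => // w _; rewrite lee_fin.
Qed.

Lemma has_mean_indic (A : set Omega) : measurable A ->
  has_mean (\1_A : Omega -> R) (fine (P A)).
Proof.
move=> mA; apply: has_mean_ge0 => //.
by rewrite integral_indic// setIT fineK// fin_num_measure.
Qed.

End HasMean.

Section TwoPoint.
Context {R : realType} {d : measure_display} {Omega : measurableType d}.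
Variable P : probability Omega R.

Lemma expR_lipschitz (x y b : R) : x <= b -> y <= b ->
  `|expR x - expR y| <= `|x - y| * expR b.
Proof.
wlog xy : x y / y <= x.
  move=> H xb yb; have [yx|/ltW xy] := leP y x; first exact: H.
  by rewrite distrC [`|x - y|]distrC; exact: H.
move=> xb yb; rewrite !ger0_norm ?subr_ge0 ?ler_expR//.
apply: (@le_trans _ _ ((x - y) * expR x)); last first.
  by rewrite ler_wpM2l ?subr_ge0// ler_expR.
have := expR_ge1Dx (y - x); rewrite expRD expRN.
have e0 := expR_gt0 x => h.
have : expR x * (1 + (y - x)) <= expR y.
  by rewrite -[leRHS](divfK (lt0r_neq0 e0)) mulrC ler_pM2r.
lra.
Qed.

Definition cosh (x : R) : R := (expR x + expR (- x)) / 2.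

Lemma cosh_ge0 x : 0 <= cosh x.
Proof. by rewrite divr_ge0// addr_ge0// expR_ge0. Qed.

Lemma cosh_norm x : cosh `|x| = cosh x.
Proof.
have [x0|x0] := lerP 0 x; first by rewrite ger0_norm.
by rewrite ltr0_norm// /cosh opprK addrC.
Qed.

Lemma cosh_sqr x : cosh x ^+ 2 = (expR (2 * x) + expR (- (2 * x)) + 2) / 4.
Proof.
have -> : expR (2 * x) = expR x ^+ 2 by rewrite -expRM_natl.
have -> : expR (- (2 * x)) = expR (- x) ^+ 2.
  by rewrite -expRM_natl; congr expR; ring.
have e1 : expR x * expR (- x) = 1 by rewrite -expRD subrr expR0.
have -> : (expR x ^+ 2 + expR (- x) ^+ 2 + 2) / 4
  = (expR x ^+ 2 + expR (- x) ^+ 2 + 2 * (expR x * expR (- x))) / 4.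
  by rewrite e1 mulr1.
by rewrite /cosh; field.
Qed.

Lemma cosh_pow4_le x : cosh x ^+ 4 <= (expR (4 * x) + expR (- (4 * x))) / 2.
Proof.
have -> : expR (4 * x) = expR x ^+ 4 by rewrite -expRM_natl.
have -> : expR (- (4 * x)) = expR (- x) ^+ 4.
  by rewrite -expRM_natl; congr expR; ring.
rewrite /cosh; set a := expR x; set b := expR (- x).
have -> : ((a + b) / 2) ^+ 4 = (((a + b) / 2) ^+ 2) ^+ 2 by rewrite -exprM.
have -> : a ^+ 4 = (a ^+ 2) ^+ 2 by rewrite -exprM.
have -> : b ^+ 4 = (b ^+ 2) ^+ 2 by rewrite -exprM.
have ab : ((a + b) / 2) ^+ 2 <= (a ^+ 2 + b ^+ 2) / 2.
  have := sqr_ge0 (a - b); nra.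
apply: (@le_trans _ _ (((a ^+ 2 + b ^+ 2) / 2) ^+ 2)).
  by rewrite ler_sqr ?nnegrE ?sqr_ge0// divr_ge0// addr_ge0 ?sqr_ge0.
have := sqr_ge0 (a ^+ 2 - b ^+ 2); nra.
Qed.

Lemma cosh_lipschitz x y b : 0 <= x <= b -> 0 <= y <= b ->
  `|cosh x - cosh y| <= `|x - y| * expR b.
Proof.
move=> /andP[x0 xb] /andP[y0 yb]; have b0 := le_trans x0 xb.
have -> : cosh x - cosh y
  = ((expR x - expR y) + (expR (- x) - expR (- y))) / 2 by rewrite /cosh; field.
rewrite normrM [`|2^-1|]ger0_norm// ler_pdivrMr//.
apply: (le_trans (ler_normD _ _)).
rewrite mulr_natr mulr2n; apply: lerD; first exact: expR_lipschitz.
have -> : `|x - y| = `|- x - - y| by rewrite -opprD normrN.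
by apply: expR_lipschitz; lra.
Qed.

(** Small enough for cosh (th G) to be within [a * q] of cosh (th lam) whenever
    |G| is within the gap of lam <= lmax. *)
Definition two_point_gap (th a q lmax : R) : R :=
  Num.min 1 (a * q / (th * expR (th * (lmax + 1)))).

(** V^2 / (4 W), where V bounds the second moment of cosh (th G) - cosh (th lam)
    from below and W its fourth moment from above. *)
Definition two_point_mass (th a q K1 lmax : R) : R :=
  (2 * (a * q) ^+ 2) ^+ 2 / (4 * (K1 + expR (4 * (th * lmax)))).

(** If |G| were concentrated at [lam], then H = cosh (th G) would be
    concentrated at h = cosh (th lam).  But H has mean m1 and second moment
    (m4 + 1) / 2 with m4 >= m1^4, so its variance is at least
    (m1^2 - 1)^2 / 2 >= 2 (a q)^2.  The fourth moment of H is at most m16, and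
    the Paley-Zygmund argument for (H - h)^2 concludes.  In the application G is
    Gaussian given the regressors, with variance proportional to Q. *)
Lemma two_point_anticoncentration (G Q : Omega -> R)
    (th a q qm m1 m4 m16 K1 lmax lam : R) :
  0 < th -> 0 < a -> 0 < q -> q <= qm -> m16 <= K1 -> 0 <= lam <= lmax ->
  measurable_fun setT G ->
  has_mean P Q qm ->
  has_mean P (fun w => expR (a * Q w)) m1 ->
  has_mean P (fun w => expR (4 * a * Q w)) m4 ->
  has_mean P (fun w => expR (th * G w)) m1 ->
  has_mean P (fun w => expR (- (th * G w))) m1 ->
  has_mean P (fun w => expR (2 * (th * G w))) m4 ->
  has_mean P (fun w => expR (- (2 * (th * G w)))) m4 ->
  has_mean P (fun w => expR (4 * (th * G w))) m16 ->
  has_mean P (fun w => expR (- (4 * (th * G w)))) m16 ->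
  ((two_point_mass th a q K1 lmax)%:E
   <= P [set w | (two_point_gap th a q lmax <= `| `|G w| - lam |)%R])%E.
Proof.
move=> th0 a0 q0 qqm m16K /andP[lam0 lamM] mG hQ hQ1 hQ4 h1 h1' h2 h2' h4 h4'.
set c := two_point_gap _ _ _ _; set A := [set w | _].
have mA : measurable A.
  apply: measurable_superlevel; apply: measurableT_comp => //.
  by apply: measurable_funB => //; exact: measurableT_comp.
have m1_ge : 1 + a * q <= m1.
  apply: (@le_trans _ _ (1 + a * qm)); first by rewrite lerD2l ler_pM2l.
  apply: (has_mean_le (has_meanD (has_mean_cst P 1) (has_meanZ a hQ)) hQ1) => w.
  exact: expR_ge1Dx.
have aq0 : 0 < a * q by exact: mulr_gt0.
(* Jensen's inequality for y |-> y^4, through its tangent at m1. *)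
have m4_ge : m1 ^+ 4 <= m4.
  have := has_mean_le (has_meanD (has_mean_cst P (m1 ^+ 4 - 4 * m1 ^+ 3 * m1))
    (has_meanZ (4 * m1 ^+ 3) hQ1)) hQ4.
  rewrite subrK; apply => w.
  have -> : expR (4 * a * Q w) = expR (a * Q w) ^+ 4.
    by rewrite -expRM_natl mulrA.
  set y := expR _; have y0 : 0 <= y by exact: expR_ge0.
  have -> : y ^+ 4 = m1 ^+ 4 - 4 * m1 ^+ 3 * m1 + 4 * m1 ^+ 3 * y
     + (y - m1) ^+ 2 * ((y + m1) ^+ 2 + 2 * m1 ^+ 2) by ring.
  rewrite lerDl; apply: mulr_ge0; first exact: sqr_ge0.
  by apply: addr_ge0; [exact: sqr_ge0|apply: mulr_ge0 => //; exact: sqr_ge0].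
set h := cosh (th * lam).
have h0 : 0 <= h by exact: cosh_ge0.
set V := 2 * (a * q) ^+ 2.
set W := K1 + expR (4 * (th * lmax)).
have V0 : 0 < V by rewrite mulr_gt0// exprn_gt0.
have W0 : 0 < W.
  rewrite ltr_wpDl ?expR_gt0//; apply: le_trans m16K.
  by apply: (has_mean_le (has_mean_cst P 0) h4) => w; exact: expR_ge0.
set al := V / (2 * W).
have al0 : 0 < al by rewrite divr_gt0 ?mulr_gt0.
have hW : h ^+ 4 <= expR (4 * (th * lmax)).
  apply: (le_trans (cosh_pow4_le _)).
  have tl : 0 <= th * lam by rewrite mulr_ge0// ltW.
  have e1 : expR (4 * (th * lam)) <= expR (4 * (th * lmax)).
    by rewrite ler_expR !ler_pM2l.
  have e2 : expR (- (4 * (th * lam))) <= expR (4 * (th * lam)).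
    by rewrite ler_expR; lra.
  lra.
(* With U = (H - h)^2: off A one has U <= V / 2, and everywhere
   U <= al / 2 * U^2 + 1 / (2 al).  Expanding U and bounding U^2 by H^4 + h^4
   leaves only exponentials of multiples of th * G, whose means are known. *)
have pointwise w :
    4^-1 * expR (2 * (th * G w)) + 4^-1 * expR (- (2 * (th * G w)))
      + (2^-1 + h ^+ 2)
    <= h * expR (th * G w) + h * expR (- (th * G w))
       + (al / 4 * expR (4 * (th * G w)) + al / 4 * expR (- (4 * (th * G w)))
          + (V / 2 + al / 2 * h ^+ 4) + (2 * al)^-1 * \1_A w).
  set H := cosh (th * G w).
  have H0 : 0 <= H by exact: cosh_ge0.
  have := cosh_sqr (th * G w); rewrite -/H => H2.
  have := cosh_pow4_le (th * G w); rewrite -/H => H4.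
  have H1 : expR (th * G w) + expR (- (th * G w)) = 2 * H by rewrite /H /cosh; field.
  set U := (H - h) ^+ 2.
  have U0 : 0 <= U := sqr_ge0 _.
  have U2 : U ^+ 2 <= H ^+ 4 + h ^+ 4.
    have -> : U ^+ 2 = H ^+ 4 + h ^+ 4
       - H * h * (4 * (H - h) ^+ 2 + 2 * (H * h)) by rewrite /U; ring.
    rewrite gerBl mulr_ge0 ?mulr_ge0// addr_ge0// mulr_ge0 ?sqr_ge0//.
    exact: mulr_ge0.
  have UE : U = H ^+ 2 - h * (expR (th * G w) + expR (- (th * G w))) + h ^+ 2.
    by rewrite H1 /U; ring.
  suff : U <= V / 2 + al / 2 * U ^+ 2 + (2 * al)^-1 * \1_A w.
    move=> Ule.
    have a1 : al / 2 * U ^+ 2 <= al / 2 * (H ^+ 4 + h ^+ 4).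
      by rewrite ler_wpM2l// divr_ge0// ltW.
    have a2 : al / 2 * H ^+ 4 <= al / 2 * ((expR (4 * (th * G w)) +
        expR (- (4 * (th * G w)))) / 2).
      by rewrite ler_wpM2l// divr_ge0// ltW.
    move: Ule; rewrite {1}UE H2 => Ule; lra.
  have alU : 0 <= al / 2 * U ^+ 2 by rewrite mulr_ge0 ?sqr_ge0// divr_ge0// ltW.
  rewrite indicE; case: (boolP (w \in A)) => [_|/negP nA].
    rewrite mulr1.
    have : U <= al / 2 * U ^+ 2 + (2 * al)^-1.
      have al2 : 0 < 2 * al by apply: mulr_gt0.
      rewrite -(ler_pM2l al2) mulrDr (mulfV (lt0r_neq0 al2)).
      have := sqr_ge0 (al * U - 1); nra.
    have := V0; lra.
  rewrite mulr0 addr0.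
  suff : U <= V / 2 by lra.
  have nAw : `| `|G w| - lam | < c.
    by rewrite ltNge; apply/negP => ?; apply: nA; rewrite inE.
  have c1 : c <= 1 by rewrite ge_min lexx.
  have := nAw; rewrite ltr_norml => /andP[n1 n2].
  have e0 := expR_gt0 (th * (lmax + 1)).
  have cle : c * (th * expR (th * (lmax + 1))) <= a * q.
    by rewrite -ler_pdivlMr ?mulr_gt0// ge_min lexx orbT.
  have Hh : `|H - h| <= a * q.
    rewrite /H -cosh_norm /h.
    rewrite normrM (gtr0_norm th0).
    apply: (le_trans (@cosh_lipschitz _ _ (th * (lmax + 1)) _ _)).
    - apply/andP; split; first by apply: mulr_ge0 => //; exact: ltW.
      by rewrite ler_pM2l//; lra.
    - apply/andP; split; first by apply: mulr_ge0 => //; exact: ltW.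
      by rewrite ler_pM2l//; lra.
    apply: le_trans cle; rewrite -mulrBr normrM (gtr0_norm th0).
    rewrite [th * `|_|]mulrC -mulrA; apply: ler_wpM2r; last exact: ltW.
    by apply: mulr_ge0; exact: ltW.
  rewrite /U -(real_normK (num_real (H - h))) /V mulrAC mulfV// mul1r.
  by rewrite ler_sqr ?nnegrE// ltW.
have meanL := has_meanD (has_meanD (has_meanZ 4^-1 h2) (has_meanZ 4^-1 h2'))
  (has_mean_cst P (2^-1 + h ^+ 2)).
have meanR := has_meanD (has_meanD (has_meanZ h h1) (has_meanZ h h1'))
  (has_meanD (has_meanD (has_meanD (has_meanZ (al / 4) h4) (has_meanZ (al / 4) h4'))
     (has_mean_cst P (V / 2 + al / 2 * h ^+ 4)))
     (has_meanZ (2 * al)^-1 (has_mean_indic P mA))).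
have := has_mean_le meanL meanR pointwise.
set pA := fine (P A) => main.
have -> : (P A = pA%:E)%E by rewrite /pA fineK// fin_num_measure.
rewrite lee_fin /two_point_mass -/V -/W.
have vm : V <= (m1 ^+ 2 - 1) ^+ 2 / 2.
  rewrite /V; have : 2 * (a * q) <= m1 ^+ 2 - 1 by nra.
  nra.
have alW : al * W = V / 2 by rewrite /al; field; rewrite gt_eqF.
have b1 : al / 2 * (m16 + h ^+ 4) <= V / 4.
  have : al / 2 * (m16 + h ^+ 4) <= al / 2 * W.
    by apply: ler_wpM2l; [apply: divr_ge0 => //; exact: ltW|exact: lerD].
  lra.
have b2 : V <= V / 2 + V / 4 + (2 * al)^-1 * pA.
  have := sqr_ge0 (h - m1); nra.
have -> : V ^+ 2 / (4 * W) = 2 * al * (V / 4).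
  by rewrite /al; field; rewrite gt_eqF.
have al2 : 0 < 2 * al by apply: mulr_gt0.
by rewrite -ler_pdivlMl//; lra.
Qed.

End TwoPoint.

(** * The normalized noise *)

Section Noise.
Context {R : realType} {d : measure_display} {Omega : measurableType d}.
Variable P : probability Omega R.
Variables N T p : nat.
Variable x : 'I_N -> {RV P >-> T.-tuple (p.-tuple R)}.
Variable eps : 'I_N -> {RV P >-> T.-tuple R}.

(** Entry (i, t) of Z S^-1 v, as a function of the regressors of individual i.
    So [noise v] below is v' S^-1 Z' eps, and [energy v] is the quadratic form
    v' S^-1 Z'Z S^-1 v. *)
Definition score (v : 'cV[R]_(p + N)) (i : 'I_N) (t : 'I_T)
    (u : T.-tuple (p.-tuple R)) : R :=
  (Num.sqrt (N * T)%:R)^-1 * (\sum_k tnth (tnth u t) k * v (lshift N k) 0)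
  + (Num.sqrt T%:R)^-1 * v (rshift p i) 0.

Definition noise v w : R := \sum_i \sum_t score v i t (x i w) * err eps i t w.

Definition energy v w : R := \sum_i \sum_t score v i t (x i w) ^+ 2.

Lemma measurable_score v i t : measurable_fun setT (score v i t).
Proof.
apply: measurable_funD => //; apply: measurable_funM => //.
apply: measurable_sum => k; apply: measurable_funM => //.
exact: measurable_regressor.
Qed.

Lemma measurable_score_x v i t : measurable_fun setT (fun w => score v i t (x i w)).
Proof. exact: (measurableT_comp (measurable_score v i t)). Qed.

Lemma measurable_noise v : measurable_fun setT (noise v).
Proof.
apply: measurable_sum => i; apply: measurable_sum => t.
by apply: measurable_funM; [exact: measurable_score_x|exact: measurable_err].
Qed.

Lemma measurable_energy v : measurable_fun setT (energy v).
Proof.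
apply: measurable_sum => i; apply: measurable_sum => t.
by apply: measurable_funX; exact: measurable_score_x.
Qed.

Lemma measurable_noise_exceeds v r s :
  measurable [set w | (r < noise v w)%R /\ (energy v w <= s)%R].
Proof.
apply: (@measurableI _ _ [set w | (r < noise v w)%R]
  [set w | (energy v w <= s)%R]).
  by apply: measurable_strict_superlevel; exact: measurable_noise.
rewrite (_ : [set w | _] = [set w | (- s <= - energy v w)%R]).
  apply: measurable_superlevel; apply: measurableT_comp => //.
  exact: measurable_energy.
by apply/seteqP; split => w /=; rewrite lerN2.
Qed.

Variable sigma2 : R.
Hypotheses (s0 : 0 < sigma2) (iid : iid_panel x eps) (exo : exogenous_panel x eps).
Hypothesis gauss : forall i, isotropic_normal P sigma2 (err eps i).

(** Given the regressors, [noise v] is centered Gaussian with variance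
    sigma2 * energy v.  Compensating by this random variance gives an exact
    exponential moment whatever the law of the regressors. *)
Lemma noise_exp_martingale v th :
  (\int[P]_w (expR (th * noise v w - sigma2 / 2 * th ^+ 2 * energy v w))%:E = 1)%E.
Proof.
pose z i t u := th * score v i t u.
pose g i u := expR (- (sigma2 / 2 * \sum_t z i t u ^+ 2)).
have mz i t : measurable_fun setT (z i t).
  by apply: measurable_funM => //; exact: measurable_score.
have mg i : measurable_fun setT (g i).
  apply: measurableT_comp => //; apply: measurableT_comp => //.
  apply: measurable_funM => //; apply: measurable_sum => t.
  exact: measurable_funX.
have := @panel_gaussian_mgf _ _ _ P N T p x eps sigma2 g z (fun=> 1) s0 iid exo gauss
  mg (fun i u => expR_ge0 _) mz.
rewrite big1// => <- //; last first.
  move=> i; under eq_integral do rewrite -expRD addNr expR0.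
  by rewrite integral_cst//= probability_setT mule1.
apply: eq_integral => w _; congr EFin.
have -> : th * noise v w - sigma2 / 2 * th ^+ 2 * energy v w
    = \sum_i (- (sigma2 / 2 * \sum_t z i t (x i w) ^+ 2)
              + \sum_t z i t (x i w) * err eps i t w).
  rewrite /noise /energy !mulr_sumr -sumrB; apply: eq_bigr => i _.
  rewrite addrC; congr (_ + _); last first.
    by rewrite mulr_sumr; apply: eq_bigr => t _; rewrite mulrA.
  congr (- _); rewrite -mulrA; congr (_ * _).
  by rewrite mulr_sumr; apply: eq_bigr => t _; rewrite exprMn.
by rewrite expR_sum; apply: eq_bigr => i _; rewrite expRD.
Qed.

(** Chernoff's method with th = 1 / (2 sigma2 M), the best parameter for a
    Gaussian of variance sigma2 M rho at level rho / 2. *)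
Lemma noise_tail v (M rho : R) : 0 < M -> 0 < rho ->
  (P [set w | (rho / 2 < noise v w)%R /\ (energy v w <= M * rho)%R]
   <= (expR (- (rho / (8 * sigma2 * M))))%:E)%E.
Proof.
move=> M0 r0; pose th := (2 * sigma2 * M)^-1.
have th0 : 0 < th by rewrite invr_gt0 !mulr_gt0.
pose g w := th * noise v w - sigma2 / 2 * th ^+ 2 * energy v w.
have mg : measurable_fun setT (fun w => expR (g w)).
  apply: measurableT_comp => //; apply: measurable_funB.
    by apply: measurable_funM => //; exact: measurable_noise.
  by apply: measurable_funM => //; exact: measurable_energy.
have mA := measurable_noise_exceeds v (rho / 2) (M * rho).
apply: (le_trans (@markov_le _ _ _ P _ (fun w => expR (g w))
  (expR (rho / (8 * sigma2 * M))) mA mg _ _ _)).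
- by move=> w; exact: expR_ge0.
- exact: expR_gt0.
- move=> w /= [h1 h2]; rewrite ler_expR /g.
  have -> : rho / (8 * sigma2 * M)
      = th * (rho / 2) - sigma2 / 2 * th ^+ 2 * (M * rho).
    by rewrite /th; field; rewrite !gt_eqF.
  apply: lerB; first by rewrite ler_pM2l// ltW.
  apply: ler_wpM2l => //.
  by apply: mulr_ge0; [rewrite divr_ge0// ltW|exact: sqr_ge0].
by rewrite noise_exp_martingale mule1 expRN.
Qed.

Lemma noise_mgf v th (m : 'I_N -> R) :
  (forall i, \int[P]_w (expR (sigma2 / 2 * th ^+ 2
     * \sum_t score v i t (x i w) ^+ 2))%:E = (m i)%:E)%E ->
  (\int[P]_w (expR (th * noise v w))%:E = (\prod_i m i)%:E)%E /\
  (\int[P]_w (expR (sigma2 / 2 * th ^+ 2 * energy v w))%:E = (\prod_i m i)%:E)%E.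
Proof.
move=> hm; pose z i t u := th * score v i t u.
have mz i t : measurable_fun setT (z i t).
  by apply: measurable_funM => //; exact: measurable_score.
have zE i w : sigma2 / 2 * \sum_t z i t (x i w) ^+ 2
    = sigma2 / 2 * th ^+ 2 * \sum_t score v i t (x i w) ^+ 2.
  rewrite -[RHS]mulrA; congr (_ * _); rewrite mulr_sumr.
  by apply: eq_bigr => t _; rewrite exprMn.
split.
  rewrite -(@panel_gaussian_mgf _ _ _ P N T p x eps sigma2 (fun _ _ => 1) z m)//.
    apply: eq_integral => w _; congr EFin.
    rewrite /noise mulr_sumr expR_sum; apply: eq_bigr => i _.
    rewrite mul1r mulr_sumr; congr expR.
    by apply: eq_bigr => t _; rewrite mulrA.
  by move=> i; rewrite -hm; apply: eq_integral => w _; rewrite mul1r zE.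
pose f i (u : T.-tuple (p.-tuple R) * T.-tuple R) :=
  expR (sigma2 / 2 * th ^+ 2 * \sum_t score v i t u.1 ^+ 2).
rewrite -(@panel_integral_prod _ _ _ P N T p x eps f m iid)//.
- by apply: eq_integral => w _; rewrite /energy mulr_sumr expR_sum.
- move=> i; apply: measurableT_comp => //; apply: measurable_funM => //.
  apply: measurable_sum => t; apply: measurable_funX.
  exact: (measurableT_comp (measurable_score v i t)).
- by move=> i u; exact: expR_ge0.
Qed.

End Noise.

Section CoordinateNoise.
Context {R : realType} {d : measure_display} {Omega : measurableType d}.
Variable P : probability Omega R.
Variables N T p : nat.
Variable x : 'I_N -> {RV P >-> T.-tuple (p.-tuple R)}.
Variable eps : 'I_N -> {RV P >-> T.-tuple R}.
Variables C K sigma2 : R.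
Hypotheses (C0 : 0 < C) (K0 : 0 < K) (N0 : (0 < N)%N) (T0 : (0 < T)%N).
Hypotheses (iid : iid_panel x eps) (sub : subgaussian_panel x eps C K).
Hypotheses (s0 : 0 < sigma2) (exo : exogenous_panel x eps).
Hypothesis gauss : forall i, isotropic_normal P sigma2 (err eps i).
Local Notation K1 := (square_mgf_bound C K).

Definition coord (k : 'I_p) : 'cV[R]_(p + N) := delta_mx (lshift N k) 0.

Lemma score_coord k i t (u : T.-tuple (p.-tuple R)) :
  score (coord k) i t u = (Num.sqrt (N * T)%:R)^-1 * tnth (tnth u t) k.
Proof.
rewrite /score (bigD1 k)//= big1 => [|l lk]; last first.
  by rewrite mxE (inj_eq (@lshift_inj _ _)) (negbTE lk) mulr0.
by rewrite !mxE eqxx eq_rlshift mulr1 addr0 mulr0 addr0.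
Qed.

Lemma sum_score_coord_sqr k i (u : T.-tuple (p.-tuple R)) :
  \sum_t score (coord k) i t u ^+ 2 = N%:R^-1 * gram_entry k k u.
Proof.
rewrite /gram_entry mulrA -invfM -natrM mulr_sumr; apply: eq_bigr => t _.
by rewrite score_coord exprMn exprVn sqr_sqrtr// expr2.
Qed.

Lemma energy_coord k w : energy x (coord k) w = sample_gram x k k w.
Proof.
rewrite /energy /sample_gram mulr_sumr; apply: eq_bigr => i _.
by rewrite sum_score_coord_sqr.
Qed.

Lemma gram_entry_ge0 k (u : T.-tuple (p.-tuple R)) : 0 <= gram_entry k k u.
Proof. by rewrite mulr_ge0 ?invr_ge0// sumr_ge0// => t _; rewrite -expr2 sqr_ge0. Qed.

Lemma sample_gram_exp_moment k l :
  (\int[P]_w (expR (C / 2 * `|sample_gram x k l w|))%:E <= K1%:E)%E.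
Proof.
pose f i w := expR (C / 2 * `|gram_entry k l (x i w)|).
have mf i : measurable_fun setT (f i).
  apply: measurableT_comp => //; apply: measurable_funM => //.
  by do 2 apply: measurableT_comp => //; exact: measurable_gram_entry.
apply: (@le_trans _ _ (\int[P]_w (N%:R^-1 * \sum_i f i w)%:E)%E).
  apply: ge0_le_integral => //.
  - apply/measurable_EFinP; apply: measurableT_comp => //.
    apply: measurable_funM => //; apply: measurableT_comp => //.
    exact: measurable_sample_gram.
  - apply/measurable_EFinP; apply: measurable_funM => //.
    exact: measurable_sum.
  - move=> w _; rewrite lee_fin.
    apply: le_trans (expR_mean_le _ N0); rewrite ler_expR.
    rewrite /sample_gram normrM ger0_norm ?invr_ge0// mulrCA.
    apply: ler_wpM2l; first by rewrite invr_ge0.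
    rewrite -[leRHS]mulr_sumr; apply: ler_wpM2l; first by rewrite divr_ge0// ltW.
    exact: ler_norm_sum.
apply: (@integral_mean_le _ _ _ P N f) => // [i w|i]; first exact: expR_ge0.
exact: (gram_entry_exp_moment C0 K0 T0 iid sub i k l).
Qed.

Lemma has_mean_sample_gram k l :
  has_mean P (sample_gram x k l) (Gamma x (lshift N k) (lshift N l)).
Proof.
have c0 : 0 < C / 2 by rewrite divr_gt0.
split.
  exact: (integrable_of_exp_moment c0 (measurable_sample_gram x k l)
            (sample_gram_exp_moment k l)).
by rewrite (Gamma_lshift C0 K0 T0 iid sub) (sample_gram_mean C0 K0 T0 iid sub).
Qed.

Lemma coordinate_noise_exp k th : sigma2 / 2 * th ^+ 2 <= C / 2 ->
  let m := fine (\int[P]_w (expR (sigma2 / 2 * th ^+ 2 * sample_gram x k k w))%:E)%E in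
  [/\ m <= K1,
      has_mean P (fun w => expR (sigma2 / 2 * th ^+ 2 * sample_gram x k k w)) m &
      has_mean P (fun w => expR (th * noise x eps (coord k) w)) m].
Proof.
move=> thC m; set a := sigma2 / 2 * th ^+ 2 in thC m *.
have a0 : 0 <= a.
  by apply: mulr_ge0; [rewrite divr_ge0// ltW|exact: sqr_ge0].
pose f i w := expR (a * \sum_t score (coord k) i t (x i w) ^+ 2).
have mf i : measurable_fun setT (f i).
  apply: measurableT_comp => //; apply: measurable_funM => //.
  apply: measurable_sum => t; apply: measurable_funX.
  exact: measurable_score_x.
have fle i : (\int[P]_w (f i w)%:E <= K1%:E)%E.
  apply: le_trans (gram_entry_exp_moment C0 K0 T0 iid sub i k k).
  apply: ge0_le_integral => //.
  - by move=> w _; rewrite lee_fin expR_ge0.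
  - exact/measurable_EFinP.
  - apply/measurable_EFinP; apply: measurableT_comp => //.
    apply: measurable_funM => //; do 2 apply: measurableT_comp => //.
    exact: measurable_gram_entry.
  - move=> w _; rewrite lee_fin ler_expR sum_score_coord_sqr.
    rewrite ger0_norm ?gram_entry_ge0//.
    apply: ler_pM => //; first by rewrite mulr_ge0 ?invr_ge0// gram_entry_ge0.
    by rewrite ler_piMl ?gram_entry_ge0// invf_le1 ?ltr0n// ler1n.
have fE i : (\int[P]_w (f i w)%:E = (fine (\int[P]_w (f i w)%:E))%:E)%E.
  rewrite fineK// ge0_fin_numE ?(le_lt_trans (fle i)) ?ltry//.
  by apply: integral_ge0 => w _; rewrite lee_fin expR_ge0.
have [E1 E2] := noise_mgf s0 iid exo gauss fE.
have E3 : (\int[P]_w (expR (a * sample_gram x k k w))%:E = m%:E)%E.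
  have E2' : (\int[P]_w (expR (a * sample_gram x k k w))%:E
      = (\prod_i fine (\int[P]_w (f i w)%:E)%E)%:E)%E.
    by rewrite -E2; apply: eq_integral => w _; rewrite energy_coord.
  by rewrite /m E2'.
have mQ : measurable_fun setT (fun w => expR (a * sample_gram x k k w)).
  apply: measurableT_comp => //; apply: measurable_funM => //.
  exact: measurable_sample_gram.
split.
- rewrite -lee_fin -E3; apply: le_trans (sample_gram_exp_moment k k).
  apply: ge0_le_integral => //.
  + exact/measurable_EFinP.
  + apply/measurable_EFinP; apply: measurableT_comp => //.
    apply: measurable_funM => //; apply: measurableT_comp => //.
    exact: measurable_sample_gram.
  + move=> w _; rewrite lee_fin ler_expR.
    have q0 : 0 <= sample_gram x k k w.
      by rewrite mulr_ge0 ?invr_ge0// sumr_ge0// => i _; exact: gram_entry_ge0.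
    by rewrite ger0_norm// ler_wpM2r.
- by apply: has_mean_ge0 => // w; exact: expR_ge0.
- apply: has_mean_ge0 => [|w|]; [|exact: expR_ge0|].
    apply: measurableT_comp => //; apply: measurable_funM => //.
    exact: measurable_noise.
  rewrite E1 -E2 -E3; apply: eq_integral => w _; by rewrite energy_coord.
Qed.

(** The exponents used are at most 4 th in absolute value, and
    sigma2 / 2 * (4 th)^2 = C / 2 is the largest admissible exponential moment of
    the squared regressors. *)
Definition noise_scale : R := Num.sqrt (C / (16 * sigma2)).

Lemma coordinate_noise_anticoncentration k q lam lmax :
  0 < q -> q <= Gamma x (lshift N k) (lshift N k) -> 0 <= lam <= lmax ->
  ((two_point_mass noise_scale (C / 32) q K1 lmax)%:E
   <= P [set w | (two_point_gap noise_scale (C / 32) q lmax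
                  <= `| `|noise x eps (coord k) w| - lam |)%R])%E.
Proof.
move=> q0 qG lamM; set th := noise_scale.
have th0 : 0 < th by rewrite sqrtr_gt0 divr_gt0// mulr_gt0.
have th2 : th ^+ 2 = C / (16 * sigma2).
  by rewrite sqr_sqrtr// divr_ge0 ?ltW// mulr_gt0.
have mult j : sigma2 / 2 * (j * th) ^+ 2 = j ^+ 2 * (C / 32).
  by rewrite exprMn th2; field; rewrite gt_eqF.
have le4 j : j ^+ 2 <= 16 -> sigma2 / 2 * (j * th) ^+ 2 <= C / 2.
  by move=> j16; rewrite mult; have := C0; nra.
pose M c := fine (\int[P]_w (expR (c * sample_gram x k k w))%:E)%E.
have key j : j ^+ 2 <= 16 ->
    [/\ M (j ^+ 2 * (C / 32)) <= K1,
        has_mean P (fun w => expR (j ^+ 2 * (C / 32) * sample_gram x k k w))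
          (M (j ^+ 2 * (C / 32))) &
        has_mean P (fun w => expR (j * (th * noise x eps (coord k) w)))
          (M (j ^+ 2 * (C / 32)))].
  move=> j16; have := coordinate_noise_exp k (le4 _ j16); rewrite mult.
  by move=> [h1 h2 h3]; split => //; under eq_fun do rewrite mulrA.
have E1 : 1 ^+ 2 * (C / 32) = C / 32 :> R by rewrite expr1n mul1r.
have E2 : 2 ^+ 2 * (C / 32) = 4 * (C / 32) :> R by rewrite -natrX.
have E4 : 4 ^+ 2 * (C / 32) = 16 * (C / 32) :> R by rewrite -natrX.
have neg j : (- j) ^+ 2 <= 16 -> has_mean P
    (fun w => expR (- (j * (th * noise x eps (coord k) w)))) (M (j ^+ 2 * (C / 32))).
  move=> /key[_ _]; rewrite sqrrN.
  by under eq_fun do rewrite mulNr.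
have [|_ hQ1] := key 1; first by rewrite expr1n; lra.
rewrite E1; under eq_fun do rewrite mul1r; move=> h1.
rewrite E1 in hQ1.
have [|_ hQ4] := key 2; first by rewrite -natrX; lra.
rewrite E2 => h2; rewrite E2 in hQ4.
have [|m16 _] := key 4; first by rewrite -natrX; lra.
rewrite E4 => h4; rewrite E4 in m16.
have := neg 1; rewrite sqrrN E1; under eq_fun do rewrite mul1r; move=> n1.
have := neg 2; rewrite sqrrN E2 => n2.
have := neg 4; rewrite sqrrN E4 => n4.
apply: (two_point_anticoncentration th0 _ q0 qG m16 lamM
  (measurable_noise x eps (coord k)) (has_mean_sample_gram k k)
  hQ1 hQ4 h1 (n1 _) h2 (n2 _) h4 (n4 _)).
- by rewrite divr_gt0.
- by rewrite expr1n; lra.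
- by rewrite -natrX; lra.
- by rewrite -natrX; lra.
Qed.

End CoordinateNoise.

(** * Stationarity of the Lasso *)

(** At a nonzero coordinate [b] the objective is differentiable; unless the
    derivative -2 D vanishes, a small step h = - e D decreases it. *)
Lemma soft_threshold_stationarity (R : realType) (O : finType) (r z : O -> R)
    (l b : R) : b != 0 ->
  (forall h, \sum_o r o ^+ 2 + 2 * l * `|b|
             <= \sum_o (r o - h * z o) ^+ 2 + 2 * l * `|b + h|) ->
  \sum_o z o * r o = l * Num.sg b.
Proof.
move=> b0 opt.
set A := \sum_o z o * r o; set Q := \sum_o z o ^+ 2.
have Q0 : 0 <= Q by apply: sumr_ge0 => o _; exact: sqr_ge0.
have expand h : \sum_o (r o - h * z o) ^+ 2 = \sum_o r o ^+ 2 - 2 * h * A + h ^+ 2 * Q.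
  rewrite /A /Q !mulr_sumr -sumrB -big_split/=; apply: eq_bigr => o _; ring.
have absE h : `|h| <= `|b| -> `|b + h| = `|b| + h * Num.sg b.
  case: (ltrgt0P b) b0 => // bs _; rewrite ler_norml => /andP[h1 h2].
    by rewrite gtr0_sg// mulr1 ger0_norm//; lra.
  by rewrite ltr0_sg// ler0_norm; lra.
set D := l * Num.sg b - A.
have ineq h : `|h| <= `|b| -> 0 <= 2 * h * D + h ^+ 2 * Q.
  by move=> hb; have := opt h; rewrite expand absE// /D; lra.
suff : D = 0 by rewrite /D => /subr0_eq.
apply/eqP/negPn/negP => D0.
(* The first bound keeps b + h from crossing 0; the second keeps the quadratic
   term below the linear one. *)
pose e := Num.min (`|b| / `|D|) (Q + 1)^-1.
have Dn : 0 < `|D| by rewrite normr_gt0.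
have Q1 : 0 < Q + 1 by rewrite ltr_wpDl.
have e0 : 0 < e.
  by rewrite lt_min invr_gt0 Q1 andbT; apply: divr_gt0 => //; rewrite normr_gt0.
have eD : `|- (e * D)| <= `|b|.
  by rewrite normrN normrM (gtr0_norm e0) -ler_pdivlMr// ge_min lexx.
have eQ : e * (Q + 1) <= 1.
  by rewrite -ler_pdivlMr// div1r ge_min lexx orbT.
have := ineq _ eD.
have D2 : 0 < D ^+ 2 by rewrite exprn_even_gt0.
have -> : 2 * - (e * D) * D + (- (e * D)) ^+ 2 * Q = e * D ^+ 2 * (e * Q - 2).
  by ring.
have eD2 : 0 < e * D ^+ 2 by apply: mulr_gt0.
rewrite pmulr_rge0//; lra.
Qed.

Section Stationarity.
Context {R : realType} {d : measure_display} {Omega : measurableType d}.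
Variable P : probability Omega R.
Variables N T p : nat.
Variable x : 'I_N -> {RV P >-> T.-tuple (p.-tuple R)}.
Variable eps : 'I_N -> {RV P >-> T.-tuple R}.
Hypotheses (N0 : (0 < N)%N) (T0 : (0 < T)%N).
Variables (lam mu : R) (beta : 'cV[R]_p) (c : 'cV[R]_N) (w : Omega).

(** Entry (i, t) of Z v at the sample point [w]. *)
Definition fit (v : 'cV[R]_(p + N)) (i : 'I_N) (t : 'I_T) : R :=
  \sum_k cov x i t k w * v (lshift N k) 0 + v (rshift p i) 0.

Definition scale (j : 'I_(p + N)) : R := (Smat N T p : 'M[R]_(p + N)) j j.

Definition penalty (j : 'I_(p + N)) : R :=
  if fintype.split j is inl _ then lam else mu.

Lemma scale_lshift k : scale (lshift N k) = Num.sqrt (N * T)%:R.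
Proof. by rewrite /scale /Smat block_mxEul mxE eqxx. Qed.

Lemma scale_rshift i : scale (rshift p i) = Num.sqrt T%:R.
Proof. by rewrite /scale /Smat block_mxEdr mxE eqxx. Qed.

Lemma scale_gt0 j : 0 < scale j.
Proof.
rewrite -(fintype.splitK j); case: (fintype.split j) => [k|i] /=.
  by rewrite scale_lshift sqrtr_gt0 ltr0n muln_gt0 N0.
by rewrite scale_rshift sqrtr_gt0 ltr0n.
Qed.

Lemma Smat_offdiag i j : i != j -> (Smat N T p : 'M[R]_(p + N)) i j = 0.
Proof.
rewrite -(fintype.splitK i) -(fintype.splitK j) /Smat.
case: (fintype.split i) => [k|k]; case: (fintype.split j) => [l|l] /= kl.
- by rewrite block_mxEul mxE; rewrite (negbTE (_ : k != l))//; apply: contraNneq kl => ->.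
- by rewrite block_mxEur mxE.
- by rewrite block_mxEdl mxE.
- rewrite block_mxEdr mxE; by rewrite (negbTE (_ : k != l))//; apply: contraNneq kl => ->.
Qed.

Lemma score_fit (v : 'cV[R]_(p + N)) i t :
  score (\col_j (scale j * v j 0)) i t (x i w) = fit v i t.
Proof.
rewrite /score /fit mxE scale_rshift mulKf ?gt_eqF ?sqrtr_gt0 ?ltr0n//.
congr (_ + _); rewrite mulr_sumr; apply: eq_bigr => k _.
rewrite mxE scale_lshift mulrCA mulKf// gt_eqF// sqrtr_gt0 ltr0n muln_gt0 N0//.
Qed.

Lemma fitD u v i t : fit (u + v) i t = fit u i t + fit v i t.
Proof.
rewrite /fit mxE addrACA; congr (_ + _); rewrite -big_split/=.
by apply: eq_bigr => k _; rewrite mxE mulrDr.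
Qed.

Lemma fitZ a v i t : fit (a *: v) i t = a * fit v i t.
Proof.
rewrite /fit mxE mulrDr; congr (_ + _); rewrite mulr_sumr.
by apply: eq_bigr => k _; rewrite mxE mulrCA.
Qed.

Lemma l2norm_sqr n (v : 'cV[R]_n) : l2norm v ^+ 2 = \sum_i v i 0 ^+ 2.
Proof. by rewrite sqr_sqrtr// sumr_ge0// => i _; exact: sqr_ge0. Qed.

Lemma Zmat_fit (v : 'cV[R]_(p + N)) i t : (Zmat x w *m v) (mxvec_index i t) 0 = fit v i t.
Proof.
have -> : Zmat x w *m v = Xmat x w *m usubmx v + Dmat N T *m dsubmx v.
  by rewrite -{1}[v]vsubmxK mul_row_col.
rewrite !mxE /fit; congr (_ + _).
  by apply: eq_bigr => k _; rewrite !mxE mxvecE !mxE.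
rewrite (bigD1 i)//= big1 => [|j ji]; last first.
  by rewrite !mxE mxvecE !mxE eq_sym (negbTE ji) mul0r.
by rewrite !mxE mxvecE !mxE eqxx mul1r addr0.
Qed.

Lemma lasso_objectiveE g :
  lasso_objective x eps lam mu beta c w g
  = \sum_i \sum_t (err eps i t w - fit (g - col_mx beta c) i t) ^+ 2
    + 2 * \sum_j penalty j * `|g j 0|.
Proof.
rewrite /lasso_objective l2norm_sqr sum_stack_index -addrA; congr (_ + _).
  apply: eq_bigr => i _; apply: eq_bigr => t _; congr (_ ^+ 2).
  have := Zmat_fit g i t; rewrite !mxE => ->; rewrite mxvecE mxE.
  have -> : fit (g - col_mx beta c) i t = fit g i t - fit (col_mx beta c) i t.
    by rewrite fitD -scaleN1r fitZ mulN1r.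
  have -> : fit (col_mx beta c) i t = \sum_k cov x i t k w * beta k 0 + c i 0.
    by rewrite /fit col_mxEd; under eq_bigr do rewrite col_mxEu.
  ring.
rewrite big_split_ord/= mulrDr /l1norm; congr (_ + _).
  rewrite -mulrA mulr_sumr; congr (_ * _); apply: eq_bigr => k _.
  by rewrite /penalty (unsplitK (inl k)) mxE.
rewrite -mulrA mulr_sumr; congr (_ * _); apply: eq_bigr => k _.
by rewrite /penalty (unsplitK (inr k)) mxE.
Qed.

Lemma lasso_stationarity ghat j :
  is_panel_lasso x eps lam mu beta c w ghat -> ghat j 0 != 0 ->
  \sum_i \sum_t fit (delta_mx j 0) i t
      * (err eps i t w - fit (ghat - col_mx beta c) i t)
  = penalty j * Num.sg (ghat j 0).
Proof.
move=> opt gj; rewrite pair_bigA/=.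
apply: (@soft_threshold_stationarity _ _
  (fun it : 'I_N * 'I_T => err eps it.1 it.2 w - fit (ghat - col_mx beta c) it.1 it.2)
  (fun it => fit (delta_mx j 0) it.1 it.2)) => // h.
have := opt (ghat + h *: delta_mx j 0); rewrite !lasso_objectiveE !pair_bigA/=.
rewrite (bigD1 j)//= [X in _ <= _ + 2 * X](bigD1 j)//= !mulrDr !mulrA !addrA.
set r1 := (X in _ + 2 * X <= _); set r2 := (X in _ <= _ + 2 * X).
have -> : r2 = r1.
  apply: eq_bigr => l lj; rewrite !mxE (negbTE lj) /= mulr0 addr0 //.
rewrite lerD2r => /le_trans; apply.
rewrite !mxE !eqxx /= mulr1 lerD2r le_eqVlt; apply/orP; left; apply/eqP.
apply: eq_bigr => -[i t] _ /=; congr (_ ^+ 2).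
have -> : fit (ghat + h *: delta_mx j 0 - col_mx beta c) i t
    = fit (ghat - col_mx beta c) i t + h * fit (delta_mx j 0) i t.
  by rewrite addrAC [LHS]fitD fitZ.
ring.
Qed.

End Stationarity.

(** * Rayleigh quotients *)

Section Rayleigh.
Context {R : realType}.

Definition rdot n (u v : 'rV[R]_n) : R := (u *m v^T) 0 0.

Lemma rdotE n (u v : 'rV[R]_n) : rdot u v = \sum_i u 0 i * v 0 i.
Proof. by rewrite /rdot mxE; apply: eq_bigr => i _; rewrite mxE. Qed.

Lemma rdotC n (u v : 'rV[R]_n) : rdot u v = rdot v u.
Proof. by rewrite !rdotE; apply: eq_bigr => i _; rewrite mulrC. Qed.

Lemma rdotDl n (u v z : 'rV[R]_n) : rdot (u + v) z = rdot u z + rdot v z.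
Proof. by rewrite /rdot mulmxDl mxE. Qed.

Lemma rdotZl n a (u v : 'rV[R]_n) : rdot (a *: u) v = a * rdot u v.
Proof. by rewrite /rdot -scalemxAl mxE. Qed.

Lemma rdotDr n (u v z : 'rV[R]_n) : rdot z (u + v) = rdot z u + rdot z v.
Proof. by rewrite rdotC rdotDl !(rdotC z). Qed.

Lemma rdotZr n a (u v : 'rV[R]_n) : rdot u (a *: v) = a * rdot u v.
Proof. by rewrite rdotC rdotZl rdotC. Qed.

Lemma rdot_ge0 n (u : 'rV[R]_n) : 0 <= rdot u u.
Proof. by rewrite rdotE sumr_ge0// => i _; rewrite -expr2 sqr_ge0. Qed.

Lemma rdot_eq0 n (u : 'rV[R]_n) : (rdot u u == 0) = (u == 0).
Proof.
rewrite rdotE psumr_eq0 => [|i _]; last by rewrite -expr2 sqr_ge0.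
apply/idP/eqP => [/allP h|->]; last by apply/allP => i _; rewrite /= mxE mulr0 eqxx.
apply/rowP => i; rewrite mxE; apply/eqP.
by have := h i (mem_index_enum i); rewrite mulf_eq0 orbb.
Qed.

Lemma continuous_quadratic n (M : 'M[R]_n) :
  continuous (fun u : 'rV[R]_n => rdot (u *m M) u).
Proof.
have coordc (j : 'I_n) : continuous (fun u : 'rV[R]_n => u 0 j).
  by move=> u; exact: coord_continuous.
have sumc (I : Type) (s : seq I) (f : I -> 'rV[R]_n -> R) :
    (forall i, continuous (f i)) -> continuous (fun u => \sum_(i <- s) f i u).
  move=> fc; elim: s => [|i s IH] u.
    by under eq_fun do rewrite big_nil; exact: cst_continuous.
  under eq_fun do rewrite big_cons.
  by apply: (@continuousD _ R^o); [exact: fc|exact: IH].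
have -> : (fun u : 'rV[R]_n => rdot (u *m M) u)
  = (fun u => \sum_j (\sum_i u 0 i * M i j) * u 0 j).
  by apply/funext => u; rewrite rdotE; apply: eq_bigr => j _; rewrite mxE.
apply: (sumc _ _ _) => j u; apply: (@continuousM R); last exact: coordc.
apply: (sumc _ _ (fun i u => u 0 i * M i j)) => i v.
by apply: (@continuousM R); [exact: coordc|exact: cst_continuous].
Qed.

Lemma sphere_compact n : compact [set u : 'rV[R]_n.+1 | rdot u u = 1].
Proof.
have E : (fun u : 'rV[R]_n.+1 => rdot (u *m 1%:M) u) = fun u => rdot u u.
  by apply/funext => u; rewrite mulmx1.
apply: bounded_closed_compact.
  exists 1; split => // y y1 u /= u1.
  apply: (le_trans _ (ltW y1)).
  rewrite [leLHS]/Num.Def.normr/= mx_normrE; apply: bigmax_le => // -[i j] _ /=.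
  rewrite ord1 -(@expr_le1 _ 2)// real_normK ?num_real// -u1 rdotE.
  by rewrite (bigD1 j)//= -expr2 lerDl sumr_ge0// => l _; rewrite -expr2 sqr_ge0.
have := @continuous_quadratic n.+1 1%:M; rewrite E => cq.
rewrite (_ : [set u | _] = (fun u => rdot u u) @^-1` [set 1])//.
by apply: preimage_closed => //; exact: closed_eq.
Qed.

(** A maximizer v of the quadratic form on the unit sphere is an eigenvector:
    with a the maximum, moving v along the residual z = v M - a v raises the
    Rayleigh quotient to first order unless z = 0. *)
Lemma rayleigh_max n (M : 'M[R]_n.+1) : M^T = M ->
  exists a, eigenvalue M a /\ forall u, rdot (u *m M) u <= a * rdot u u.
Proof.
move=> Ms.
have sym u v : rdot (u *m M) v = rdot u (v *m M).
  by rewrite /rdot trmx_mul Ms mulmxA.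
have [||v vS vmax] := @EVT_max_rV R n.+1 (fun u => rdot (u *m M) u)
  [set u | rdot u u = 1] _ (@sphere_compact n).
- exists (delta_mx 0 0) => /=; rewrite rdotE (bigD1 0)//= big1 => [|i i0].
    by rewrite mxE !eqxx mulr1 addr0.
  by rewrite mxE (negbTE i0) andbF mul0r.
- by apply: continuous_subspaceT; exact: continuous_quadratic.
have v1 : rdot v v = 1 by move: vS; rewrite inE.
pose a := rdot (v *m M) v; exists a.
have bound u : rdot (u *m M) u <= a * rdot u u.
  have [->|u0] := eqVneq u 0; first by rewrite mul0mx !rdotE !big1 ?mulr0// => i _; rewrite mxE mul0r.
  have uu0 : 0 < rdot u u by rewrite lt_def rdot_eq0 u0 rdot_ge0.
  pose s := Num.sqrt (rdot u u).
  have s0 : 0 < s by rewrite sqrtr_gt0.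
  have s2 : s ^+ 2 = rdot u u by rewrite sqr_sqrtr// ltW.
  have := vmax (s^-1 *: u); rewrite inE /= rdotZl rdotZr -scalemxAl rdotZl rdotZr.
  rewrite -s2 -/a => h.
  have /h : s^-1 * (s^-1 * s ^+ 2) = 1 by field; rewrite gt_eqF.
  by rewrite mulrA -invfM -expr2 mulrC ler_pdivrMr ?exprn_gt0.
split => //; apply/eigenvalueP; exists v; last by rewrite -rdot_eq0 v1 oner_eq0.
have [z zdef] : exists z, z = v *m M - a *: v by eexists.
apply/eqP; rewrite -subr_eq0 -zdef -rdot_eq0.
have first_order h : 0 <= - (2 * h * rdot z z) + h ^+ 2 * (a * rdot z z - rdot (z *m M) z).
  have := bound (v + h *: z).
  rewrite mulmxDl -scalemxAl !(rdotDl, rdotDr, rdotZl, rdotZr) v1 -/a.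
  have -> : rdot (z *m M) v = rdot z (v *m M) by exact: sym.
  have zE : rdot (v *m M) z - a * rdot v z = rdot z z.
    transitivity (rdot (v *m M - a *: v) z); last by rewrite -zdef.
    by rewrite rdotDl -[- (a *: v)]scaleN1r !rdotZl mulN1r.
  rewrite (rdotC z (v *m M)) (rdotC z v); 
  have -> : rdot (v *m M) z = rdot z z + a * rdot v z by rewrite -zE; ring.
  lra.
have zz := rdot_ge0 z.
apply/eqP/le_anti; rewrite zz andbT leNgt; apply/negP => zpos.
set Q := a * _ - _ in first_order.
(* A step small enough for the quadratic term not to exceed half of the linear
   one. *)
pose e := rdot z z / (`|Q| + 1).
have Q1 : 0 < `|Q| + 1 by rewrite ltr_wpDl.
have e0 : 0 < e by apply: divr_gt0.
have eQ : e * Q <= rdot z z.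
  rewrite /e mulrAC ler_pdivrMr//; apply: ler_wpM2l => //.
  by have := ler_norm Q; lra.
have := first_order e; have -> : - (2 * e * rdot z z) + e ^+ 2 * Q
  = e * (e * Q - 2 * rdot z z) by ring.
rewrite pmulr_rge0//; lra.
Qed.

Lemma phi_max_rayleigh n (M : 'M[R]_n) (u : 'rV[R]_n) : M^T = M ->
  rdot (u *m M) u <= phi_max M * rdot u u.
Proof.
case: n M u => [|n] M u Ms.
  by rewrite !rdotE !big_ord0 mulr0.
have [a [Ma bound]] := rayleigh_max Ms.
apply: (le_trans (bound u)); apply: ler_wpM2r; first exact: rdot_ge0.
apply: sup_upper_bound => //; split; first by exists a.
exists a => b /= /eigenvalueP[v vM v0].
have := bound v; rewrite vM rdotZl ler_pM2r//.
by rewrite lt_def rdot_eq0 v0 rdot_ge0.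
Qed.

End Rayleigh.

(** * Quadratic forms on the support *)

Section Support.
Context {R : realType} {d : measure_display} {Omega : measurableType d}.
Variable P : probability Omega R.
Variables N T p : nat.
Variable x : 'I_N -> {RV P >-> T.-tuple (p.-tuple R)}.
Variable eps : 'I_N -> {RV P >-> T.-tuple R}.
Hypotheses (N0 : (0 < N)%N) (T0 : (0 < T)%N).
Variables (beta : 'cV[R]_p) (c : 'cV[R]_N).
Local Notation J := (joint_support beta c).

Lemma joint_support_lshift k : (lshift N k \in J) = (k \in supp beta).
Proof.
rewrite inE (mem_imset _ _ (@lshift_inj p N)) orbC.
case: imsetP => // -[i _ /eqP]; by rewrite eq_lrshift.
Qed.

Lemma joint_support_rshift i : (rshift p i \in J) = (i \in supp c).
Proof.
rewrite inE (mem_imset _ _ (@rshift_inj p N)).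
case: imsetP => // -[k _ /eqP]; by rewrite eq_rlshift.
Qed.

Lemma card_joint_support : #|J| = (#|supp beta| + #|supp c|)%N.
Proof.
rewrite cardsU (_ : _ :&: _ = finset.set0) ?cards0 ?subn0.
  by rewrite !card_imset//; [exact: rshift_inj|exact: lshift_inj].
apply/setP => j; rewrite !inE; apply/negP => /andP[/imsetP[k _ ->]].
by case/imsetP => i _ /eqP; rewrite eq_lrshift.
Qed.

Lemma joint_support_col_mx : supp (col_mx beta c) = J.
Proof.
apply/setP => j; rewrite -(fintype.splitK j).
case: (fintype.split j) => [k|k] /=.
  by rewrite joint_support_lshift !inE col_mxEu.
by rewrite joint_support_rshift !inE col_mxEd.
Qed.

Lemma Gamma_sym : (Gamma x)^T = Gamma x.
Proof.
rewrite /Gamma tr_block_mx trmx0 trmx0 trmx1; congr block_mx.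
apply/matrixP => k l; rewrite !mxE; congr fine.
rewrite unlock; apply: eq_integral => w _.
by rewrite !Xmat_gram /sample_gram /gram_entry; congr (_ * _)%:E;
  apply: eq_bigr => i _; congr (_ * _); apply: eq_bigr => t _; rewrite mulrC.
Qed.

Lemma phi_max_quadratic (A : {set 'I_(p + N)}) (M : 'M[R]_(p + N))
    (v : 'cV[R]_(p + N)) : M^T = M -> (forall j, j \notin A -> v j 0 = 0) ->
  \sum_i \sum_j v i 0 * v j 0 * M i j
  <= phi_max (submat A M) * \sum_j v j 0 ^+ 2.
Proof.
move=> Ms vA.
have toA (F : 'I_(p + N) -> R) : (forall j, j \notin A -> F j = 0) ->
    \sum_j F j = \sum_(a < #|A|) F (enum_val a).
  move=> F0; rewrite -(big_enum_val F) [RHS]big_mkcond/=.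
  by apply: eq_bigr => j _; case: ifPn => // /F0.
have sM : (submat A M)^T = submat A M.
  by apply/matrixP => a b; rewrite !mxE -[in RHS]Ms mxE.
have := phi_max_rayleigh (\row_a v (enum_val a) 0) sM.
rewrite !rdotE; congr (_ <= _ * _).
  rewrite toA => [|j jA]; last by apply: big1 => l _; rewrite (vA _ jA) !mul0r.
  under [RHS]eq_bigr => a _.
    rewrite toA; last by move=> j jA; rewrite (vA _ jA) mulr0 mul0r.
    over.
  rewrite exchange_big/=; apply: eq_bigr => b _.
  rewrite !mxE mulr_suml; apply: eq_bigr => a _; rewrite !mxE; ring.
rewrite toA => [|j jA]; last by rewrite (vA _ jA) expr0n.
by apply: eq_bigr => a _; rewrite !mxE expr2.
Qed.

(** (a + b)^2 <= 2 a^2 + 2 b^2 separates the regressors from the dummies. *)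
Lemma energy_gram (v : 'cV[R]_(p + N)) w :
  energy x v w <= 2 * (\sum_k \sum_l v (lshift N k) 0 * v (lshift N l) 0
                                     * sample_gram x k l w)
                  + 2 * \sum_i v (rshift p i) 0 ^+ 2.
Proof.
pose al i t := (Num.sqrt (N * T)%:R)^-1
  * (\sum_k cov x i t k w * v (lshift N k) 0).
pose be i := (Num.sqrt T%:R)^-1 * v (rshift p i) 0.
have -> : \sum_k \sum_l v (lshift N k) 0 * v (lshift N l) 0 * sample_gram x k l w
    = \sum_i \sum_t al i t ^+ 2.
  under eq_bigr do under eq_bigr do rewrite sample_gramE.
  transitivity (\sum_k \sum_l \sum_i \sum_t (N * T)%:R^-1
     * (cov x i t k w * v (lshift N k) 0) * (cov x i t l w * v (lshift N l) 0)).
    apply: eq_bigr => k _; apply: eq_bigr => l _; rewrite mulrA mulr_sumr.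
    apply: eq_bigr => i _; rewrite mulr_sumr; apply: eq_bigr => t _; ring.
  under eq_bigr do rewrite exchange_big/=.
  rewrite exchange_big/=; apply: eq_bigr => i _.
  under eq_bigr do rewrite exchange_big/=.
  rewrite exchange_big/=; apply: eq_bigr => t _.
  rewrite /al exprMn exprVn sqr_sqrtr// expr2 mulr_suml mulr_sumr.
  apply: eq_bigr => k _; rewrite mulr_sumr mulr_sumr.
  by apply: eq_bigr => l _; rewrite mulrA.
have -> : \sum_i v (rshift p i) 0 ^+ 2 = \sum_(i < N) \sum_(t < T) be i ^+ 2.
  apply: eq_bigr => i _; rewrite sumr_const card_ord /be exprMn exprVn sqr_sqrtr//.
  by rewrite -[_ *+ T]mulr_natl mulrA mulfV ?mul1r// pnatr_eq0 -lt0n.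
rewrite -mulrDr -big_split/= mulr_sumr; apply: ler_sum => i _.
rewrite -big_split/= mulr_sumr; apply: ler_sum => t _.
rewrite /score -/(cov x i t _ w) -/(al i t) -/(be i).
have := sqr_ge0 (al i t - be i); nra.
Qed.

(** On vectors supported in J, an entrywise error [tau] of the Gram matrix costs
    at most tau |v|_1^2 <= tau |J| |v|^2. *)
Lemma energy_le (v : 'cV[R]_(p + N)) w (tau phi : R) : phi_max (submat J (Gamma x)) <= phi ->
  0 <= phi -> 0 <= tau -> ~ gram_bad x tau w ->
  (forall j, j \notin J -> v j 0 = 0) ->
  energy x v w <= 2 * (phi + tau * #|J|%:R + 1) * \sum_j v j 0 ^+ 2.
Proof.
move=> phiJ phi0 tau0 good vJ.
apply: (le_trans (energy_gram v w)).
set A := supp beta.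
have vA k : k \notin A -> v (lshift N k) 0 = 0.
  by move=> kA; apply: vJ; rewrite joint_support_lshift.
rewrite [in leRHS]big_split_ord/=.
set V1 := \sum_k v (lshift N k) 0 ^+ 2; set V2 := \sum_i v (rshift p i) 0 ^+ 2.
have V10 : 0 <= V1 by apply: sumr_ge0 => k _; exact: sqr_ge0.
have V20 : 0 <= V2 by apply: sumr_ge0 => k _; exact: sqr_ge0.
pose G k l := Gamma x (lshift N k) (lshift N l).
have gamma_part : \sum_k \sum_l v (lshift N k) 0 * v (lshift N l) 0 * G k l
    <= phi * V1.
  pose v1 : 'cV[R]_(p + N) := col_mx (usubmx v) 0.
  have v1l k : v1 (lshift N k) 0 = v (lshift N k) 0 by rewrite col_mxEu mxE.
  have v1r i : v1 (rshift p i) 0 = 0 by rewrite col_mxEd mxE.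
  have v1J j : j \notin J -> v1 j 0 = 0.
    move=> /vJ; rewrite -(fintype.splitK j).
    by case: (fintype.split j) => [k|k] /=; rewrite ?v1l ?v1r.
  have := phi_max_quadratic Gamma_sym v1J.
  rewrite !big_split_ord/=.
  rewrite [X in _ + X <= _ -> _]big1 => [|i _]; last first.
    by rewrite big1 // => j _; rewrite v1r !mul0r.
  rewrite [X in _ <= _ * (_ + X) -> _]big1 => [|i _]; last by rewrite v1r expr0n.
  rewrite !addr0.
  have -> : \sum_k v1 (lshift N k) 0 ^+ 2 = V1.
    by apply: eq_bigr => k _; rewrite v1l.
  move=> h; apply: le_trans (ler_wpM2r V10 phiJ); apply: le_trans h.
  rewrite le_eqVlt; apply/orP; left; apply/eqP; apply: eq_bigr => k _.
  rewrite big_split_ord/= [X in _ = _ + X]big1 ?addr0 => [|i _]; last first.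
    by rewrite v1r mulr0 mul0r.
  by apply: eq_bigr => l _; rewrite !v1l.
have dev_part : \sum_k \sum_l v (lshift N k) 0 * v (lshift N l) 0
      * (sample_gram x k l w - G k l) <= tau * #|A|%:R * V1.
  pose ind k : R := (k \in A)%:R.
  apply: (@le_trans _ _ (\sum_k \sum_l tau / 2
      * (ind l * v (lshift N k) 0 ^+ 2 + ind k * v (lshift N l) 0 ^+ 2))).
    apply: ler_sum => k _; apply: ler_sum => l _; rewrite /ind.
    have [kA|/vA ->] := boolP (k \in A); last first.
      by rewrite !mul0r expr0n/= mulr0 addr0 mulr0.
    have [lA|/vA ->] := boolP (l \in A); last first.
      by rewrite mulr0 !mul0r expr0n/= mulr0 addr0 mulr0.
    rewrite !mul1r; set a := v _ 0; set b := v _ 0.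
    have : `|sample_gram x k l w - G k l| <= tau.
      by rewrite leNgt; apply/negP => h; apply: good; exists (k, l).
    rewrite ler_norml; set D := _ - G k l => /andP[D1 D2].
    have := sqr_ge0 (a + b); have := sqr_ge0 (a - b) => h1 h2.
    have [ab|ab] := lerP 0 (a * b).
      apply: (@le_trans _ _ (a * b * tau)); first exact: ler_wpM2l.
      nra.
    apply: (@le_trans _ _ (a * b * - tau)); first by rewrite ler_wnM2l// ltW.
    nra.
  under eq_bigr do rewrite -mulr_sumr big_split/=.
  rewrite -mulr_sumr big_split/=.
  have cardA : \sum_(l < p) ind l = #|A|%:R.
    rewrite /ind -sum1_card natr_sum [RHS]big_mkcond/=; apply: eq_bigr => l _.
    by case: (l \in A).
  have -> : \sum_(k < p) \sum_(l < p) ind l * v (lshift N k) 0 ^+ 2 = #|A|%:R * V1.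
    rewrite /V1 mulr_sumr; apply: eq_bigr => k _.
    by rewrite -mulr_suml cardA.
  have -> : \sum_(k < p) \sum_(l < p) ind k * v (lshift N l) 0 ^+ 2 = #|A|%:R * V1.
    rewrite -cardA mulr_suml; apply: eq_bigr => k _.
    by rewrite -mulr_sumr.
  lra.
have -> : \sum_k \sum_l v (lshift N k) 0 * v (lshift N l) 0 * sample_gram x k l w
  = \sum_k \sum_l v (lshift N k) 0 * v (lshift N l) 0 * G k l
   + \sum_k \sum_l v (lshift N k) 0 * v (lshift N l) 0
      * (sample_gram x k l w - G k l).
  rewrite -big_split/=; apply: eq_bigr => k _; rewrite -big_split/=.
  by apply: eq_bigr => l _; ring.
have AJ : tau * #|A|%:R * V1 <= tau * #|J|%:R * V1.
  apply: ler_wpM2r => //; apply: ler_wpM2l => //.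
  by rewrite ler_nat card_joint_support leq_addr.
have h3 : 0 <= tau * #|J|%:R by rewrite mulr_ge0.
have h4 : 0 <= (phi + tau * #|J|%:R) * V2 by rewrite mulr_ge0// addr_ge0.
nra.
Qed.

(** A basis vector e_j with j in J belongs to the cone, as its l1 norm is carried
    by R_1 or R_2.  Positivity of kappa^2 ensures that the set of quotients is
    bounded below: otherwise its infimum would be 0 by convention. *)
Lemma kappa2_le_diag (lam mu : R) (s1 s2 : nat) j :
  0 <= lam -> 0 <= mu -> 0 < kappa2 x lam mu s1 s2 -> j \in J ->
  s1 = #|supp beta| -> s2 = #|supp c| -> kappa2 x lam mu s1 s2 <= Gamma x j j.
Proof.
move=> lam0 mu0 k20 jJ s1E s2E.
have l10 n (B : {set 'I_n}) : l1norm (subvec B (0 : 'cV[R]_n)) = 0.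
  by apply: big1 => a _; rewrite !mxE normr0.
have l1ge n (v : 'cV[R]_n) : 0 <= l1norm v by apply: sumr_ge0.
have l1C n (k : 'I_n) : l1norm (subvec (~: [set k])%SET (delta_mx k 0 : 'cV[R]_n)) = 0.
  apply: big1 => a _; rewrite !mxE.
  have := enum_valP a; rewrite !inE => /negbTE ->.
  by rewrite normr0.
have lN : 0 <= lam / Num.sqrt (N * T)%:R by rewrite divr_ge0.
have mN : 0 <= mu / Num.sqrt T%:R by rewrite divr_ge0.
have quad (v : 'cV[R]_(p + N)) : v = delta_mx j 0 ->
    (v^T *m Gamma x *m v) 0 0 / l2norm v ^+ 2 = Gamma x j j.
  move=> ->; rewrite trmx_delta -rowE -colE !mxE l2norm_sqr (bigD1 j)//=.
  rewrite big1 ?addr0 => [|i ij]; last by rewrite mxE (negbTE ij) expr0n.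
  by rewrite mxE !eqxx expr1n divr1.
have d0 : (delta_mx j 0 : 'cV[R]_(p + N)) != 0.
  apply/eqP => /matrixP/(_ j 0); rewrite !mxE !eqxx => /eqP.
  by rewrite oner_eq0.
rewrite /kappa2 in k20 *; set Q := (X in inf X) in k20 *.
have Qj : Q (Gamma x j j).
  move: jJ quad d0; rewrite -(fintype.splitK j).
  case: (fintype.split j) => [k|k] /= jJ quad d0.
    rewrite joint_support_lshift in jJ.
    have E : col_mx (delta_mx k 0) 0 = delta_mx (lshift N k) 0 :> 'cV[R]_(p + N).
      apply/matrixP => a b; rewrite ord1 -(fintype.splitK a).
      case: (fintype.split a) => l /=; first by rewrite col_mxEu !mxE (inj_eq (@lshift_inj _ _)).
      by rewrite col_mxEd !mxE eq_rlshift.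
    exists [set k]%SET, finset.set0, (delta_mx k 0), 0; rewrite E; split => //.
    - by rewrite cards1 s1E card_gt0; apply/set0Pn; exists k.
    - by rewrite cards0.
    - by rewrite /kappa_cone l1C !l10 !mulr0 !addr0 !mulr_ge0.
    - by rewrite quad.
  rewrite joint_support_rshift in jJ.
  have E : col_mx 0 (delta_mx k 0) = delta_mx (rshift p k) 0 :> 'cV[R]_(p + N).
    apply/matrixP => a b; rewrite ord1 -(fintype.splitK a).
    case: (fintype.split a) => l /=; last by rewrite col_mxEd !mxE (inj_eq (@rshift_inj _ _)).
    by rewrite col_mxEu !mxE eq_lrshift.
  exists finset.set0, [set k]%SET, 0, (delta_mx k 0); rewrite E; split => //.
  - by rewrite cards0.
  - by rewrite cards1 s2E card_gt0; apply/set0Pn; exists k.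
  - by rewrite /kappa_cone l1C !l10 !mulr0 !add0r !mulr_ge0.
  - by rewrite quad.
apply: ge_inf => //.
have [[]//|/inf_out h] := pselect (has_inf Q).
by rewrite h ltxx in k20.
Qed.

End Support.

(** * Lower bounds on the estimation error *)

Lemma cauchy_schwarz_sum (R : realType) (O : finType) (a b : O -> R) :
  (\sum_o a o * b o) ^+ 2 <= (\sum_o a o ^+ 2) * (\sum_o b o ^+ 2).
Proof.
set A := \sum_o a o ^+ 2; set B := \sum_o b o ^+ 2; set D := \sum_o a o * b o.
have B0 : 0 <= B by apply: sumr_ge0 => o _; exact: sqr_ge0.
have : 0 <= B * (B * A - D ^+ 2).
  have -> : B * (B * A - D ^+ 2) = \sum_o (B * a o - D * b o) ^+ 2.
    transitivity (\sum_o (B ^+ 2 * a o ^+ 2 - 2 * B * D * (a o * b o)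
                          + D ^+ 2 * b o ^+ 2)).
      by rewrite big_split/= sumrB -!mulr_sumr -/A -/B -/D; ring.
    by apply: eq_bigr => o _; ring.
  by apply: sumr_ge0 => o _; exact: sqr_ge0.
have [B1|B1] := eqVneq B 0.
  move=> _; have b0 o : b o = 0.
    apply/eqP; rewrite -sqrf_eq0; apply/eqP; apply: (psumr_eq0P _ B1) => // i _.
    exact: sqr_ge0.
  by rewrite /D big1 ?expr0n/= ?B1 ?mulr0// => o _; rewrite b0 mulr0.
have Bp : 0 < B by rewrite lt_def B1.
by rewrite pmulr_rge0// subr_ge0 mulrC.
Qed.

Lemma probability_setC_union_ge (R : realType) d (Omega : measurableType d)
    (P : probability Omega R) (B1 B2 : set Omega) (b1 b2 : R) :
  measurable B1 -> measurable B2 -> (P B1 <= b1%:E)%E -> (P B2 <= b2%:E)%E ->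
  ((1 - b1 - b2)%:E <= P (~` (B1 `|` B2)))%E.
Proof.
move=> m1 m2 h1 h2; rewrite probability_setC; last exact: measurableU.
have := le_trans (measureU2 P m1 m2) (leeD h1 h2).
rewrite -EFinD => h.
have fin : P (B1 `|` B2) \is a fin_num by rewrite fin_num_measure//; exact: measurableU.
have qle : fine (P (B1 `|` B2)) <= b1 + b2 by rewrite -lee_fin fineK.
apply: (@le_trans _ _ (1 - (fine (P (B1 `|` B2)))%:E)%E); last by rewrite fineK.
by rewrite -EFinB lee_fin; lra.
Qed.

Section LassoError.
Context {R : realType} {d : measure_display} {Omega : measurableType d}.
Variable P : probability Omega R.
Variables N T p : nat.
Variable x : 'I_N -> {RV P >-> T.-tuple (p.-tuple R)}.
Variable eps : 'I_N -> {RV P >-> T.-tuple R}.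
Hypotheses (N0 : (0 < N)%N) (T0 : (0 < T)%N).
Variables (lam mu : R) (beta : 'cV[R]_p) (c : 'cV[R]_N).
Local Notation J := (joint_support beta c).
Local Notation gstar := (col_mx beta c).

Definition scaled_penalty (j : 'I_(p + N)) : R := penalty lam mu j / scale T j.

Definition scaled_error (g : 'cV[R]_(p + N)) : 'cV[R]_(p + N) :=
  \col_j (scale T j * (g - gstar) j 0).

Lemma fit_sum w (v : 'cV[R]_(p + N)) i t :
  fit x w v i t = \sum_j v j 0 * fit x w (delta_mx j 0) i t.
Proof.
have vE : v = \sum_j v j 0 *: delta_mx j 0.
  rewrite {1}[v]matrix_sum_delta; apply: eq_bigr => j _.
  by rewrite big_ord_recl big_ord0 addr0.
have f0 : fit x w 0 i t = 0.
  have := fitZ x w 0 0 i t; by rewrite scale0r mul0r.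
rewrite {1}vE (big_morph (fun u => fit x w u i t) (fun u v => fitD x w u v i t) f0).
by apply: eq_bigr => j _; rewrite fitZ.
Qed.

(** The stationarity conditions at the coordinates of J, paired with [v]. *)
Lemma score_stationarity w ghat (v : 'cV[R]_(p + N)) :
  is_panel_lasso x eps lam mu beta c w ghat -> supp ghat = J ->
  (forall j, j \notin J -> v j 0 = 0) ->
  noise x eps v w - \sum_i \sum_t score v i t (x i w)
                      * score (scaled_error ghat) i t (x i w)
  = \sum_j v j 0 * scaled_penalty j * Num.sg (ghat j 0).
Proof.
move=> opt gJ vJ; pose v' : 'cV[R]_(p + N) := \col_j (v j 0 / scale T j).
have vE : v = \col_j (scale T j * v' j 0).
  by apply/matrixP => j l; rewrite ord1 !mxE mulrC divfK// gt_eqF// scale_gt0.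
have sv i t : score v i t (x i w) = fit x w v' i t by rewrite vE score_fit.
have sd i t : score (scaled_error ghat) i t (x i w) = fit x w (ghat - gstar) i t.
  by rewrite -score_fit.
rewrite /noise; under eq_bigr do under eq_bigr do rewrite sv.
under [X in _ - X]eq_bigr do under eq_bigr do rewrite sv sd.
rewrite -sumrB; under eq_bigr do rewrite -sumrB.
transitivity (\sum_i \sum_t \sum_j v' j 0 * (fit x w (delta_mx j 0) i t
    * (err eps i t w - fit x w (ghat - gstar) i t))).
  apply: eq_bigr => i _; apply: eq_bigr => t _.
  rewrite -mulrBr (fit_sum w v') mulr_suml; apply: eq_bigr => j _.
  by rewrite mulrA.
under eq_bigr do rewrite exchange_big/=.
rewrite exchange_big/=; apply: eq_bigr => j _.
have -> : \sum_i \sum_t v' j 0 * (fit x w (delta_mx j 0) i t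
    * (err eps i t w - fit x w (ghat - gstar) i t))
  = v' j 0 * \sum_i \sum_t fit x w (delta_mx j 0) i t
    * (err eps i t w - fit x w (ghat - gstar) i t).
  by rewrite mulr_sumr; apply: eq_bigr => i _; rewrite mulr_sumr.
rewrite /v' mxE; have [jJ|jJ] := boolP (j \in J); last first.
  by rewrite (vJ _ jJ) !mul0r.
rewrite (lasso_stationarity opt); last by move: jJ; rewrite -gJ inE.
by rewrite /scaled_penalty -!mulrA; congr (_ * _); rewrite mulrCA mulrA.
Qed.

Lemma scaled_error_support ghat j : supp ghat = J -> j \notin J ->
  scaled_error ghat j 0 = 0.
Proof.
move=> gJ jJ; rewrite mxE.
have -> : (ghat - gstar) j 0 = ghat j 0 - gstar j 0.
  by rewrite mxE [X in _ + X]mxE.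
have -> : ghat j 0 = 0 by move: jJ; rewrite -gJ inE negbK => /eqP.
have -> : gstar j 0 = 0 by move: jJ; rewrite -joint_support_col_mx inE negbK => /eqP.
by rewrite subrr mulr0.
Qed.

Lemma l2norm_scaled_error ghat : supp ghat = J ->
  l2norm (submat J (Smat N T p) *m (subvec J ghat - subvec J gstar)) ^+ 2
  = \sum_j scaled_error ghat j 0 ^+ 2.
Proof.
move=> gJ; rewrite l2norm_sqr.
have entry (a : 'I_#|J|) :
    (submat J (Smat N T p) *m (subvec J ghat - subvec J gstar)) a 0
    = scaled_error ghat (enum_val a) 0.
  rewrite mxE (bigD1 a)//= big1 ?addr0 => [|b ba]; last first.
    rewrite mxE Smat_offdiag ?mul0r//.
    by rewrite (inj_eq enum_val_inj) eq_sym.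
  by rewrite /scaled_error /scale !mxE.
under eq_bigr do rewrite entry.
rewrite -(big_enum_val (fun j => scaled_error ghat j 0 ^+ 2)) big_mkcond/=.
apply: eq_bigr => j _; case: ifPn => // jJ.
by rewrite scaled_error_support// expr0n.
Qed.

(** By [score_stationarity] the left-hand side is the square of the inner product
    of Z S^-1 v and Z S^-1 d, with d the scaled error; both squared norms are
    energies. *)
Lemma error_lower_bound w ghat (v : 'cV[R]_(p + N)) (M : R) :
  is_panel_lasso x eps lam mu beta c w ghat -> supp ghat = J ->
  (forall j, j \notin J -> v j 0 = 0) ->
  (forall u : 'cV[R]_(p + N), (forall j, j \notin J -> u j 0 = 0) ->
     energy x u w <= M * \sum_j u j 0 ^+ 2) ->
  0 <= M ->
  (noise x eps v w - \sum_j v j 0 * scaled_penalty j * Num.sg (ghat j 0)) ^+ 2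
  <= M ^+ 2 * (\sum_j v j 0 ^+ 2) * \sum_j scaled_error ghat j 0 ^+ 2.
Proof.
move=> opt gJ vJ bound M0.
rewrite -(score_stationarity opt gJ vJ) opprB addrC subrK pair_bigA/=.
apply: (le_trans (cauchy_schwarz_sum _ _)).
have -> : \sum_(o : 'I_N * 'I_T) score v o.1 o.2 (x o.1 w) ^+ 2 = energy x v w.
  by rewrite /energy pair_bigA.
have -> : \sum_(o : 'I_N * 'I_T) score (scaled_error ghat) o.1 o.2 (x o.1 w) ^+ 2
    = energy x (scaled_error ghat) w.
  by rewrite /energy pair_bigA.
have e0 u : 0 <= energy x u w.
  by apply: sumr_ge0 => i _; apply: sumr_ge0 => t _; exact: sqr_ge0.
have -> : M ^+ 2 * (\sum_j v j 0 ^+ 2) * \sum_j scaled_error ghat j 0 ^+ 2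
  = (M * \sum_j v j 0 ^+ 2) * (M * \sum_j scaled_error ghat j 0 ^+ 2) by ring.
apply: ler_pM => //; apply: bound => //.
by move=> j jJ; exact: scaled_error_support.
Qed.

End LassoError.

Section Events.
Context {R : realType} {d : measure_display} {Omega : measurableType d}.
Variable P : probability Omega R.
Variables N T p : nat.
Variable x : 'I_N -> {RV P >-> T.-tuple (p.-tuple R)}.
Variable eps : 'I_N -> {RV P >-> T.-tuple R}.
Hypotheses (N0 : (0 < N)%N) (T0 : (0 < T)%N).
Variables (lam mu : R) (beta : 'cV[R]_p) (c : 'cV[R]_N).
Local Notation J := (joint_support beta c).
Variables (sigma2 M tau b : R).
Hypotheses (iid : iid_panel x eps) (s0 : 0 < sigma2) (exo : exogenous_panel x eps).
Hypothesis gauss : forall i, isotropic_normal P sigma2 (err eps i).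
Hypothesis M0 : 0 < M.
Hypothesis mbad : measurable [set w | gram_bad x tau w].
Hypothesis Pbad : (P [set w | gram_bad x tau w] <= b%:E)%E.
Hypothesis energy_bound : forall w, ~ gram_bad x tau w ->
  forall u : 'cV[R]_(p + N), (forall j, j \notin J -> u j 0 = 0) ->
  energy x u w <= M * \sum_j u j 0 ^+ 2.
Local Notation pen := (scaled_penalty T lam mu).

Definition penalty_energy : R := \sum_(j in J) pen j ^+ 2.

(** [A] is the set of ranks, in the enumeration of J, of the coordinates that get
    a positive sign, so that there are 2^|J| patterns. *)
Definition signed_penalty (A : {set 'I_#|J|}) : 'cV[R]_(p + N) :=
  \col_j (if j \in J then pen j * (-1) ^+ (j \notin (@enum_val _ (mem J)) @: A)
          else 0).

Lemma signed_penalty_support A j : j \notin J -> signed_penalty A j 0 = 0.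
Proof. by rewrite mxE => /negbTE ->. Qed.

Lemma signed_penalty_energy A :
  \sum_j signed_penalty A j 0 ^+ 2 = penalty_energy.
Proof.
rewrite /penalty_energy [RHS]big_mkcond/=; apply: eq_bigr => j _.
rewrite mxE; case: ifP => _; last by rewrite expr0n.
by rewrite exprMn sqrr_sign mulr1.
Qed.

Lemma signed_penalty_match (g : 'cV[R]_(p + N)) : supp g = J ->
  let A := [set a : 'I_#|J| | 0 < g (enum_val a) 0]%SET in
  \sum_j signed_penalty A j 0 * pen j * Num.sg (g j 0) = penalty_energy.
Proof.
move=> gJ A; rewrite /penalty_energy [RHS]big_mkcond/=; apply: eq_bigr => j _.
rewrite mxE; case: ifPn => jJ; last by rewrite !mul0r.
have gj : g j 0 != 0 by move: jJ; rewrite -gJ inE.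
have -> : (j \in (@enum_val _ (mem J)) @: A) = (0 < g j 0).
  rewrite -(enum_rankK_in jJ jJ) (mem_imset _ _ enum_val_inj) inE //.
case: (ltrgt0P (g j 0)) gj => // gs _.
  by rewrite gtr0_sg// !mulr1 expr2.
by rewrite ltr0_sg//= expr1; ring.
Qed.

(** The direction v is the vector of signed penalties itself.  Its signs depend on
    the sample, whence the union over all patterns, each exceptional with
    probability at most exp (- 2 |J|). *)
Lemma large_penalty_event : (0 < #|J|)%N ->
  16 * sigma2 * M * #|J|%:R <= penalty_energy ->
  exists E : set Omega,
    [/\ measurable E, ((1 - b - expR (- #|J|%:R))%:E <= P E)%E &
        forall w, E w -> forall g, is_panel_lasso x eps lam mu beta c w g ->
          supp g = J ->
          penalty_energy <= 4 * M ^+ 2 * \sum_j scaled_error T beta c g j 0 ^+ 2].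
Proof.
move=> J0 large; set rho := penalty_energy in large *.
have rho0 : 0 < rho by apply: lt_le_trans large; rewrite !mulr_gt0// ltr0n.
pose B2 A := [set w | (rho / 2 < noise x eps (signed_penalty A) w)%R
                      /\ (energy x (signed_penalty A) w <= M * rho)%R].
have mB2 A : measurable (B2 A) by exact: measurable_noise_exceeds.
have [mU PU] := union_bound P mB2.
exists (~` ([set w | gram_bad x tau w] `|` [set w | exists A, B2 A w])); split.
- by apply: measurableC; exact: measurableU.
- apply: probability_setC_union_ge => //; apply: (le_trans PU).
  pose q := expR (- (rho / (8 * sigma2 * M))).
  apply: (@le_trans _ _ (\sum_(A : {set 'I_#|J|}) q%:E)%E).
    by apply: lee_sum => A _; exact: noise_tail.
  have cardA : #|{: {set 'I_#|J|}}| = (2 ^ #|J|)%N.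
    by rewrite -cardsT -powersetT card_powerset cardsT card_ord.
  rewrite sumEFin sumr_const cardA lee_fin -[q *+ _]mulr_natl natrX.
  have e2 : (2 : R) <= expR 1 by have := expR_ge1Dx (1 : R); lra.
  apply: (@le_trans _ _ (expR #|J|%:R * q)).
    apply: ler_wpM2r; first exact: expR_ge0.
    rewrite -[X in expR X]mulr1 expRM_natl.
    by apply: lerXn2r => //; rewrite nnegrE// expR_ge0.
  rewrite /q -expRD ler_expR.
  have : 2 * #|J|%:R <= rho / (8 * sigma2 * M).
    rewrite ler_pdivlMr; last by rewrite !mulr_gt0.
    by apply: le_trans large; rewrite le_eqVlt; apply/orP; left; apply/eqP; ring.
  lra.
- move=> w /= Ew g opt gJ.
  have good : ~ gram_bad x tau w by move=> h; apply: Ew; left.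
  pose A := [set a : 'I_#|J| | 0 < g (enum_val a) 0]%SET.
  have small : noise x eps (signed_penalty A) w <= rho / 2.
    rewrite leNgt; apply/negP => h; apply: Ew; right; exists A; split => //.
    rewrite /rho -(signed_penalty_energy A); apply: energy_bound => // j.
    exact: signed_penalty_support.
  have := error_lower_bound N0 T0 opt gJ (@signed_penalty_support A)
    (energy_bound good) (ltW M0).
  rewrite (signed_penalty_match gJ) signed_penalty_energy -/rho.
  set S := \sum_j _ => h.
  have h2 : (rho / 2) ^+ 2 <= M ^+ 2 * rho * S.
    by apply: le_trans h; rewrite -[leRHS]sqrrN ler_sqr ?nnegrE; lra.
  rewrite -(ler_pM2l rho0); lra.
Qed.

Variables C K : R.
Hypotheses (C0 : 0 < C) (K0 : 0 < K) (sub : subgaussian_panel x eps C K).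

(** The direction v is a basis vector e_k: whatever its sign, the penalty at k is
    at distance at least the gap from the noise on the event of
    [coordinate_noise_anticoncentration]. *)
Lemma small_penalty_event k (q lmax : R) : k \in supp beta -> 0 < q ->
  q <= Gamma x (lshift N k) (lshift N k) ->
  0 <= pen (lshift N k) <= lmax ->
  exists E : set Omega,
    [/\ measurable E,
        ((two_point_mass (noise_scale C sigma2) (C / 32) q
            (square_mgf_bound C K) lmax - b)%:E <= P E)%E &
        forall w, E w -> forall g, is_panel_lasso x eps lam mu beta c w g ->
          supp g = J ->
          0 <= two_point_gap (noise_scale C sigma2) (C / 32) q lmax ->
          two_point_gap (noise_scale C sigma2) (C / 32) q lmax ^+ 2
          <= M ^+ 2 * \sum_j scaled_error T beta c g j 0 ^+ 2].
Proof.
move=> kb q0 qG penk; set gap := two_point_gap _ _ _ _.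
set mass := two_point_mass _ _ _ _ _.
pose G := [set w | (gap <= `| `|noise x eps (coord N k) w| - pen (lshift N k) |)%R].
have PG : (mass%:E <= P G)%E.
  exact: (coordinate_noise_anticoncentration C0 K0 N0 T0 iid sub s0 exo gauss q0 qG penk).
have mG : measurable G.
  apply: measurable_superlevel; apply: measurableT_comp => //.
  apply: measurable_funB => //; apply: measurableT_comp => //.
  exact: measurable_noise.
exists (~` ([set w | gram_bad x tau w] `|` ~` G)); split.
- by apply: measurableC; apply: measurableU => //; exact: measurableC.
- have -> : mass - b = 1 - b - (1 - mass) by ring.
  apply: probability_setC_union_ge => //; first exact: measurableC.
  rewrite probability_setC//.
  have fin : P G \is a fin_num by rewrite fin_num_measure.
  have massle : mass <= fine (P G) by rewrite -lee_fin fineK.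
  apply: (@le_trans _ _ (1 - (fine (P G))%:E)%E); first by rewrite fineK.
  by rewrite -EFinB lee_fin; lra.
- move=> w /= Ew g opt gJ gap0.
  have good : ~ gram_bad x tau w by move=> h; apply: Ew; left.
  have Gw : G w by apply: contrapT => h; apply: Ew; right.
  have kJ : lshift N k \in J by rewrite joint_support_lshift.
  have vJ j : j \notin J -> (coord N k : 'cV[R]_(p + N)) j 0 = 0.
    move=> jJ; rewrite mxE; case: eqVneq => // jk.
    by rewrite jk kJ in jJ.
  have := error_lower_bound N0 T0 opt gJ vJ (energy_bound good) (ltW M0).
  have -> : \sum_j (coord N k : 'cV[R]_(p + N)) j 0 ^+ 2 = 1.
    rewrite (bigD1 (lshift N k))//= big1 => [|j jk].
      by rewrite mxE !eqxx expr1n addr0.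
    by rewrite mxE (negbTE jk) expr0n.
  have -> : \sum_j (coord N k : 'cV[R]_(p + N)) j 0 * pen j * Num.sg (g j 0)
      = pen (lshift N k) * Num.sg (g (lshift N k) 0).
    rewrite (bigD1 (lshift N k))//= big1 => [|j jk].
      by rewrite mxE !eqxx mul1r addr0.
    by rewrite mxE (negbTE jk) !mul0r.
  rewrite mulr1; apply: le_trans.
  have gk : g (lshift N k) 0 != 0 by move: kJ; rewrite -gJ inE.
  rewrite -[leRHS]real_normK ?num_real// ler_sqr ?nnegrE//.
  apply: (le_trans Gw).
  have penE : `|pen (lshift N k) * Num.sg (g (lshift N k) 0)| = pen (lshift N k).
    by rewrite normrM normr_sg gk mulr1 ger0_norm//; case/andP: penk.
  by rewrite -[X in `|_ - X| <= _]penE; exact: ler_dist_dist.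
Qed.

End Events.

(** * Rates and constants *)

Section Rates.
Context {R : realType}.

Lemma powR_3_2_sqr (a : R) : 0 <= a -> (a `^ (3 / 2)) ^+ 2 = a ^+ 3.
Proof.
move=> a0; rewrite -powR_mulrn ?powR_ge0// -powRrM.
by rewrite (_ : 3 / 2 * 2%:R = 3%:R) ?powR_mulrn//; field.
Qed.

Lemma xi_NT_le N p (a k2 kmin rho : R) s1 s2 :
  1 <= ln a -> 1 <= ln p%:R :> R -> 1 <= ln N%:R :> R -> 0 < kmin <= k2 ->
  rho = 4 * ln a ^+ 3 * (s1%:R * ln p%:R ^+ 3 + s2%:R * ln N%:R ^+ 3) ->
  0 <= xi_NT N p a k2 s1 s2 /\
  xi_NT N p a k2 s1 s2 ^+ 2 <= (16 / kmin) ^+ 2 * rho.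
Proof.
move=> la lp lN /andP[kmin0 kk] rhoE; have k20 : 0 < k2 by apply: lt_le_trans kk.
rewrite /xi_NT; set u := ln a `^ _; set v1 := ln p%:R `^ _; set v2 := ln N%:R `^ _.
have u0 : 0 <= u by exact: powR_ge0.
have v10 : 0 <= v1 by exact: powR_ge0.
have v20 : 0 <= v2 by exact: powR_ge0.
have u2 : u ^+ 2 = ln a ^+ 3 by rewrite powR_3_2_sqr//; lra.
have v12 : v1 ^+ 2 = ln p%:R ^+ 3 by rewrite powR_3_2_sqr//; lra.
have v22 : v2 ^+ 2 = ln N%:R ^+ 3 by rewrite powR_3_2_sqr//; lra.
set r1 := Num.sqrt s1%:R; set r2 := Num.sqrt s2%:R.
have r10 : 0 <= r1 by exact: sqrtr_ge0.
have r20 : 0 <= r2 by exact: sqrtr_ge0.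
have r12 : r1 ^+ 2 = s1%:R by rewrite sqr_sqrtr.
have r22 : r2 ^+ 2 = s2%:R by rewrite sqr_sqrtr.
have num0 : 0 <= 16 * u * (v1 * r1 + v2 * r2).
  by rewrite !mulr_ge0// addr_ge0// mulr_ge0.
split; first by rewrite divr_ge0// ltW.
apply: (@le_trans _ _ ((16 * u * (v1 * r1 + v2 * r2) / kmin) ^+ 2)).
  have h1 := divr_ge0 num0 (ltW k20); have h2 := divr_ge0 num0 (ltW kmin0).
  rewrite ler_sqr ?nnegrE//.
  by apply: ler_wpM2l => //; rewrite lef_pV2.
have -> : rho = 4 * ((u * v1 * r1) ^+ 2 + (u * v2 * r2) ^+ 2).
  by rewrite rhoE !exprMn u2 v12 v22 r12 r22; ring.
have -> : (16 * u * (v1 * r1 + v2 * r2) / kmin) ^+ 2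
    = (16 / kmin) ^+ 2 * (u * v1 * r1 + u * v2 * r2) ^+ 2.
  by field; rewrite gt_eqF.
apply: ler_wpM2l; first exact: sqr_ge0.
set X := u * v1 * r1; set Y := u * v2 * r2.
have := sqr_ge0 (X - Y); have := sqr_ge0 X; have := sqr_ge0 Y; nra.
Qed.

Lemma max_ratio_ge1 (u v : R) : 0 < u -> 0 < v -> 1 <= Num.max (u / v) (v / u).
Proof.
move=> u0 v0; rewrite le_max !ler_pdivlMr// !mul1r.
by case/orP: (le_total v u) => ->; rewrite ?orbT.
Qed.

Lemma ln_ge1 (y : R) : expR 1 <= y -> 1 <= ln y.
Proof.
move=> h; rewrite -[leLHS](expRK 1) ler_ln// posrE ?expR_gt0//.
exact: lt_le_trans (expR_gt0 _) h.
Qed.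

Lemma cbrt_le (y : R) : 1 <= y -> y `^ 3^-1 <= y.
Proof.
move=> y1; rewrite -[leRHS]powRr1; last by lra.
by rewrite ler_powR//; lra.
Qed.

End Rates.

Section PenaltyEnergy.
Context {R : realType}.
Variables (N T p : nat) (a : R) (beta : 'cV[R]_p) (c : 'cV[R]_N).
Hypotheses (N0 : (0 < N)%N) (T0 : (0 < T)%N).
Hypotheses (la : 1 <= ln a) (lp : 1 <= ln p%:R :> R) (lN : 1 <= ln N%:R :> R).
Local Notation pen := (scaled_penalty T (lambda_NT N T p a) (mu_NT N T a)).

Lemma scaled_penalty_lshift (k : 'I_p) :
  0 <= pen (lshift N k) /\ pen (lshift N k) ^+ 2 = 4 * ln a ^+ 3 * ln p%:R ^+ 3.
Proof.
have l0 : 0 <= ln a := le_trans ler01 la.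
have p0 : 0 <= ln (p%:R : R) := le_trans ler01 lp.
rewrite /scaled_penalty /penalty (unsplitK (inl k)) scale_lshift; split.
  by rewrite divr_ge0 ?sqrtr_ge0.
rewrite exprMn exprVn !sqr_sqrtr//; last by rewrite !mulr_ge0// exprn_ge0.
by rewrite natrM; field; rewrite !pnatr_eq0 -!lt0n N0 T0.
Qed.

Lemma scaled_penalty_rshift (i : 'I_N) :
  pen (rshift p i) ^+ 2 = 4 * ln a ^+ 3 * ln N%:R ^+ 3.
Proof.
have l0 : 0 <= ln a := le_trans ler01 la.
have n0 : 0 <= ln (N%:R : R) := le_trans ler01 lN.
rewrite /scaled_penalty /penalty (unsplitK (inr i)) scale_rshift.
rewrite exprMn exprVn !sqr_sqrtr//; last by rewrite !mulr_ge0// exprn_ge0.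
by field; rewrite !pnatr_eq0 -!lt0n T0.
Qed.

Lemma penalty_energyE :
  penalty_energy T (lambda_NT N T p a) (mu_NT N T a) beta c
  = 4 * ln a ^+ 3 * (#|supp beta|%:R * ln p%:R ^+ 3 + #|supp c|%:R * ln N%:R ^+ 3).
Proof.
rewrite /penalty_energy big_mkcond/= big_split_ord/=.
have -> : \sum_(k < p) (if lshift N k \in joint_support beta c
    then pen (lshift N k) ^+ 2 else 0)
  = #|supp beta|%:R * (4 * ln a ^+ 3 * ln p%:R ^+ 3).
  rewrite mulr_natl -sumr_const [RHS]big_mkcond/=; apply: eq_bigr => k _.
  by rewrite joint_support_lshift; case: ifP => // _; case: (scaled_penalty_lshift k).
have -> : \sum_(i < N) (if rshift p i \in joint_support beta c
    then pen (rshift p i) ^+ 2 else 0)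
  = #|supp c|%:R * (4 * ln a ^+ 3 * ln N%:R ^+ 3).
  rewrite mulr_natl -sumr_const [RHS]big_mkcond/=; apply: eq_bigr => k _.
  by rewrite joint_support_rshift scaled_penalty_rshift.
ring.
Qed.

End PenaltyEnergy.

Section Constants.
Context {R : realType}.
Variables (C K sigma2 kmin phi_hi : R).
Hypotheses (C0 : 0 < C) (K0 : 0 < K) (s0 : 0 < sigma2) (k0 : 0 < kmin)
  (f0 : 0 < phi_hi).
Local Notation K1 := (square_mgf_bound C K).

(** A bound on the diagonal of Gamma, hence on kappa^2. *)
Definition kappa_cap : R := 1 + K1 / (C / 2).
Definition energy_factor : R := 2 * (phi_hi + kappa_cap + 1).
(** At rho >= L |J| with L = 16 sigma2 M, each sign pattern is exceptional with
    probability at most exp (- 2 |J|). *)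
Definition size_cutoff : R := 16 * sigma2 * energy_factor.
(** A bound on |J| <= 2 p when ln p <= L. *)
Definition support_cap : R := 2 * expR size_cutoff.
(** A bound on a penalty level whose square is at most L times the support cap;
    one is added because sqrt y <= 1 + y. *)
Definition penalty_cap : R := 1 + size_cutoff * support_cap.
Definition noise_gap : R :=
  two_point_gap (noise_scale C sigma2) (C / 32) kmin penalty_cap.
Definition noise_mass : R :=
  two_point_mass (noise_scale C sigma2) (C / 32) kmin K1 penalty_cap.
Definition event_rate : R := Num.min 1 (noise_mass / support_cap).
Definition tail_rate : R := deviation_slope C K kappa_cap / 2.
(** The second summand makes the exceptional probability at least one when
    ln N <= L, for then t^2 N <= kappa_cap^2 exp L. *)
Definition tail_factor : R :=
  2 + expR (tail_rate * (kappa_cap ^+ 2 * expR size_cutoff)).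
(** The norm of the penalty vector is at most [error_factor] times that of the
    scaled error; the two summands come from large and small penalties. *)
Definition error_factor : R :=
  2 * energy_factor + penalty_cap * energy_factor / noise_gap.

Lemma moment_ratio_gt0 : 0 < K1 / (C / 2).
Proof.
apply: divr_gt0; last exact: divr_gt0.
exact: lt_le_trans ltr01 (square_mgf_bound_ge1 C0 K0).
Qed.

Lemma kappa_cap_gt0 : 0 < kappa_cap.
Proof. by rewrite /kappa_cap; have := moment_ratio_gt0; lra. Qed.

Lemma energy_factor_gt0 : 0 < energy_factor.
Proof.
rewrite mulr_gt0// addr_gt0//; exact: addr_gt0 f0 kappa_cap_gt0.
Qed.

Lemma size_cutoff_gt0 : 0 < size_cutoff.
Proof. by apply: mulr_gt0; [exact: mulr_gt0|exact: energy_factor_gt0]. Qed.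

Lemma support_cap_gt0 : 0 < support_cap.
Proof. by rewrite mulr_gt0 ?expR_gt0. Qed.

Lemma penalty_cap_ge1 : 1 <= penalty_cap.
Proof.
by rewrite lerDl ltW// mulr_gt0 ?size_cutoff_gt0 ?support_cap_gt0.
Qed.

Lemma penalty_cap_gt0 : 0 < penalty_cap.
Proof. exact: lt_le_trans penalty_cap_ge1. Qed.

Lemma noise_scale_gt0 : 0 < noise_scale C sigma2.
Proof. by rewrite sqrtr_gt0 divr_gt0// mulr_gt0. Qed.

Lemma noise_gap_gt0 : 0 < noise_gap.
Proof.
rewrite lt_min ltr01 /=; apply: divr_gt0; first by rewrite mulr_gt0// divr_gt0.
by rewrite mulr_gt0 ?expR_gt0// noise_scale_gt0.
Qed.

Lemma noise_mass_gt0 : 0 < noise_mass.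
Proof.
apply: divr_gt0; first by rewrite exprn_gt0// mulr_gt0// exprn_gt0// mulr_gt0// divr_gt0.
rewrite mulr_gt0// ltr_wpDr ?expR_ge0//.
exact: lt_le_trans ltr01 (square_mgf_bound_ge1 C0 K0).
Qed.

Lemma event_rate_gt0 : 0 < event_rate.
Proof. by rewrite lt_min ltr01 divr_gt0 ?noise_mass_gt0 ?support_cap_gt0. Qed.

Lemma tail_rate_gt0 : 0 < tail_rate.
Proof. by rewrite divr_gt0// deviation_slope_gt0// kappa_cap_gt0. Qed.

Lemma tail_factor_ge2 : 2 <= tail_factor.
Proof. by rewrite lerDl expR_ge0. Qed.

Lemma tail_factor_gt0 : 0 < tail_factor.
Proof. by apply: lt_le_trans tail_factor_ge2. Qed.

Lemma error_factor_parts :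
  [/\ 0 <= 2 * energy_factor <= error_factor,
      0 <= penalty_cap * energy_factor / noise_gap <= error_factor &
      0 < error_factor].
Proof.
have e0 := energy_factor_gt0.
have g0 : 0 < penalty_cap * energy_factor / noise_gap.
  by rewrite divr_gt0 ?noise_gap_gt0// mulr_gt0 ?penalty_cap_gt0.
by rewrite /error_factor; split; [apply/andP; split; lra|apply/andP; split; lra|lra].
Qed.

End Constants.

Section Dimensions.
Context {R : realType}.

Lemma le_cubes (u v : R) : 1 <= u -> 1 <= v -> v <= u ^+ 3 * v ^+ 3.
Proof.
move=> u1 v1; have u3 : 1 <= u ^+ 3 by rewrite exprn_ege1.
have v3 : v <= v ^+ 3 by rewrite ler_eXnr.
apply: (le_trans v3); rewrite ler_peMl// exprn_ge0//.
exact: le_trans ler01 v1.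
Qed.

Lemma rate_t_bounds N p (k2 : R) s1 s2 :
  1 <= ln p%:R :> R -> 1 <= ln N%:R :> R -> 0 < k2 ->
  1 <= N%:R * rate_t N p k2 s1 s2 ^+ 2 ->
  [/\ (0 < s1 + s2)%N, 0 <= rate_t N p k2 s1 s2
    & rate_t N p k2 s1 s2 * (s1 + s2)%:R <= k2].
Proof.
move=> lp lN k20; rewrite /rate_t; set X := Num.max _ _ => Nt.
have X1 : 1 <= X by apply: max_ratio_ge1; exact: lt_le_trans ltr01 _.
have X3 : 1 <= X ^+ 3 by rewrite exprn_ege1.
have X30 : 0 < X ^+ 3 by exact: lt_le_trans X3.
have s0 : (0 < s1 + s2)%N.
  rewrite lt0n; apply/negP => /eqP s0.
  by move: Nt; rewrite s0 mul0r invr0 mulr0 expr0n mulr0 ler10.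
have sR : 0 < (s1 + s2)%:R :> R by rewrite ltr0n.
split => //; first by apply: divr_ge0; [exact: ltW|apply/ltW; exact: mulr_gt0].
rewrite invfM mulrA mulrAC divfK ?gt_eqF//.
by rewrite ler_pdivrMr// ler_peMr// ltW.
Qed.

(** All logarithms are at least one, so the larger part of the support, of size
    at least |J| / 2, contributes at least 2 |J| times its own logarithm to
    [rho]. *)
Lemma bounded_dimension (a lp lN L rho : R) (s1 s2 : nat) :
  1 <= a -> 1 <= lp -> 1 <= lN -> 0 < L ->
  rho = 4 * a ^+ 3 * (s1%:R * lp ^+ 3 + s2%:R * lN ^+ 3) ->
  rho < L * (s1 + s2)%:R ->
  if (s1 <= s2)%N then lN <= L else lp <= L.
Proof.
move=> a1 p1 N1 L0 rhoE small; rewrite natrD in small.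
have s1R : 0 <= s1%:R :> R by [].
have s2R : 0 <= s2%:R :> R by [].
have a3 : 0 <= a ^+ 3 by rewrite exprn_ge0// (le_trans ler01).
have p3 : 0 <= lp ^+ 3 by rewrite exprn_ge0// (le_trans ler01).
have N3 : 0 <= lN ^+ 3 by rewrite exprn_ge0// (le_trans ler01).
have h1 := ler_wpM2l s1R (le_cubes a1 p1).
have h2 := ler_wpM2l s2R (le_cubes a1 N1).
have h3 := mulr_ge0 s1R (mulr_ge0 a3 p3).
have h4 := mulr_ge0 s2R (mulr_ge0 a3 N3).
have L1 := mulr_ge0 (ltW L0) s1R.
have L2 := mulr_ge0 (ltW L0) s2R.
have [s12|s21] := leqP s1 s2.
  have s12R : s1%:R <= s2%:R :> R by rewrite ler_nat.
  have s2p : 0 < s2%:R :> R.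
    rewrite lt_def s2R andbT; apply/eqP => e.
    by move: small; rewrite rhoE; have := s12R; rewrite e; nra.
  rewrite -(ler_pM2l s2p); have := ler_wpM2l (ltW L0) s12R; lra.
have s21R : s2%:R <= s1%:R :> R by rewrite ler_nat ltnW.
have s1p : 0 < s1%:R :> R by rewrite ltr0n; exact: leq_ltn_trans s21.
rewrite -(ler_pM2l s1p); have := ler_wpM2l (ltW L0) s21R; lra.
Qed.

End Dimensions.

(** * The theorem *)

Section SparseLasso.
Context {R : realType} {d : measure_display} {Omega : measurableType d}.
Variable P : probability Omega R.
Variables C K sigma2 kmin phi_hi : R.
Hypotheses (C0 : 0 < C) (K0 : 0 < K) (s0 : 0 < sigma2) (k0 : 0 < kmin)
  (f0 : 0 < phi_hi).
Variables N T p : nat.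
Variable x : 'I_N -> {RV P >-> T.-tuple (p.-tuple R)}.
Variable eps : 'I_N -> {RV P >-> T.-tuple R}.
Variables (beta : 'cV[R]_p) (c : 'cV[R]_N) (a : R).
Local Notation s1 := #|supp beta|.
Local Notation s2 := #|supp c|.
Local Notation J := (joint_support beta c).
Local Notation lam := (lambda_NT N T p a).
Local Notation mu := (mu_NT N T a).
Local Notation k2 := (kappa2 x lam mu s1 s2).
Local Notation t := (rate_t N p k2 s1 s2).
Local Notation M := (energy_factor C K phi_hi).
Local Notation L := (size_cutoff C K sigma2 phi_hi).
Local Notation kcap := (kappa_cap C K).
Local Notation rho := (penalty_energy T lam mu beta c).
Local Notation Q := (error_factor C K sigma2 kmin phi_hi).
Local Notation c1 := (event_rate C K sigma2 kmin phi_hi).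
Hypotheses (N0 : (0 < N)%N) (T0 : (0 < T)%N) (p0 : (0 < p)%N).
Hypotheses (la : 1 <= ln a) (lp : 1 <= ln p%:R :> R) (lN : 1 <= ln N%:R :> R).
Hypotheses (iid : iid_panel x eps) (exo : exogenous_panel x eps).
Hypothesis sub : subgaussian_panel x eps C K.
Hypothesis gauss : forall i, isotropic_normal P sigma2 (err eps i).
Hypothesis kk : kmin <= k2.
Hypothesis phiJ : phi_max (submat J (Gamma x)) <= phi_hi.
Hypothesis Nt : 1 <= N%:R * t ^+ 2.

Definition exception_bound : R :=
  tail_factor C K sigma2 phi_hi * (p ^ 2 + N * p)%:R
  * expR (- tail_rate C K * (t ^+ 2 * N%:R) `^ 3^-1).

Lemma kappa2_gt0 : 0 < k2.
Proof. exact: lt_le_trans kk. Qed.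

Lemma support_gt0 : (0 < #|J|)%N.
Proof.
by rewrite card_joint_support; have [] := rate_t_bounds lp lN kappa2_gt0 Nt.
Qed.

Lemma rate_ge0 : 0 <= t.
Proof. by have [] := rate_t_bounds lp lN kappa2_gt0 Nt. Qed.

Lemma rate_support_le : t * #|J|%:R <= k2.
Proof.
by rewrite card_joint_support; have [] := rate_t_bounds lp lN kappa2_gt0 Nt.
Qed.

Lemma kappa2_le_support_diag j : j \in J -> k2 <= Gamma x j j.
Proof.
move=> jJ.
by apply: (kappa2_le_diag _ _ kappa2_gt0 jJ erefl erefl); exact: sqrtr_ge0.
Qed.

Lemma kappa2_le_cap : k2 <= kcap.
Proof.
have [j jJ] : exists j, j \in J by apply/set0Pn; rewrite -card_gt0 support_gt0.
apply: (le_trans (kappa2_le_support_diag jJ)).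
rewrite -(fintype.splitK j); case: (fintype.split j) => [k|i] /=.
  have c20 : 0 < C / 2 by rewrite divr_gt0.
  have := abs_mean_le_exp_moment c20 (measurable_sample_gram x k k)
    (sample_gram_exp_moment C0 K0 N0 T0 iid sub k k).
  have [_ ->] := has_mean_sample_gram C0 K0 N0 T0 iid sub k k.
  rewrite /= => /(le_trans (ler_norm _)) h.
  by apply: (le_trans h); rewrite /kappa_cap lerDr.
rewrite /Gamma block_mxEdr mxE eqxx mulr1n /kappa_cap lerDl ltW//.
exact: moment_ratio_gt0.
Qed.

Lemma rate_le_cap : t <= kcap.
Proof.
apply: le_trans kappa2_le_cap; apply: le_trans rate_support_le.
by rewrite ler_peMr ?rate_ge0// ler1n support_gt0.
Qed.

Lemma rate_effective_ge1 : 1 <= t ^+ 2 * N%:R.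
Proof. by rewrite mulrC. Qed.

Lemma tail_exponent_le :
  expR (- tail_rate C K * (t ^+ 2 * N%:R))
  <= expR (- tail_rate C K * (t ^+ 2 * N%:R) `^ 3^-1).
Proof.
rewrite ler_expR !mulNr lerN2 ler_pM2l ?tail_rate_gt0//.
exact: cbrt_le rate_effective_ge1.
Qed.

Lemma gram_exception : measurable [set w | gram_bad x t w] /\
  (P [set w | gram_bad x t w] <= exception_bound%:E)%E.
Proof.
have tcap : 0 <= t <= kcap by rewrite rate_ge0 rate_le_cap.
have [m Pb] := gram_bad_prob C0 K0 T0 iid sub N0 (kappa_cap_gt0 C0 K0) tcap.
split => //; apply: (le_trans Pb); rewrite lee_fin /exception_bound.
rewrite mulrCA mulrA.
apply: ler_pM; [by rewrite mulr_ge0|exact: expR_ge0| |exact: tail_exponent_le].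
by apply: ler_pM => //; [exact: tail_factor_ge2|rewrite ler_nat leq_addr].
Qed.

Lemma gram_good_energy w : ~ gram_bad x t w -> forall u : 'cV[R]_(p + N),
  (forall j, j \notin J -> u j 0 = 0) -> energy x u w <= M * \sum_j u j 0 ^+ 2.
Proof.
move=> good u uJ.
apply: (le_trans (energy_le T0 phiJ (ltW f0) rate_ge0 good uJ)).
apply: ler_wpM2r; first by apply: sumr_ge0 => j _; exact: sqr_ge0.
rewrite /energy_factor ler_pM2l// lerD2r lerD2l.
exact: le_trans rate_support_le kappa2_le_cap.
Qed.

(** When N is bounded, so is t^2 N. *)
Lemma exception_trivial : ln N%:R <= L -> 1 <= exception_bound.
Proof.
move=> NL; have NLR : N%:R <= expR L.
  by rewrite -[leLHS]lnK ?ler_expR// posrE ltr0n.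
have y_le : t ^+ 2 * N%:R <= kcap ^+ 2 * expR L.
  apply: ler_pM => //; first exact: sqr_ge0.
  by rewrite ler_sqr ?nnegrE ?rate_ge0 ?rate_le_cap// ltW// kappa_cap_gt0.
set z := tail_rate C K * (kcap ^+ 2 * expR L).
have e1 : expR (- z) <= expR (- tail_rate C K * (t ^+ 2 * N%:R) `^ 3^-1).
  apply: le_trans tail_exponent_le.
  by rewrite ler_expR mulNr lerN2 ler_pM2l ?tail_rate_gt0.
have ez : expR z * expR (- z) = 1 by rewrite -expRD subrr expR0.
rewrite -[leLHS]ez /exception_bound; apply: ler_pM e1; rewrite ?expR_ge0//.
apply: (@le_trans _ _ (tail_factor C K sigma2 phi_hi * 1)).
  by rewrite mulr1 lerDr.
rewrite ler_pM2l ?tail_factor_gt0//.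
by rewrite ler1n addn_gt0 expn_gt0 p0.
Qed.

Definition error_event (E : set Omega) : Prop :=
  [/\ measurable E,
      ((1 - expR (- c1 * #|J|%:R) - exception_bound)%:E <= P E)%E &
      forall w, E w -> forall g, is_panel_lasso x eps lam mu beta c w g ->
        supp g = J -> rho <= Q ^+ 2 * \sum_j scaled_error T beta c g j 0 ^+ 2].

Lemma sum_scaled_error_ge0 g :
  0 <= \sum_j scaled_error T beta c g j 0 ^+ 2 :> R.
Proof. by apply: sumr_ge0 => j _; exact: sqr_ge0. Qed.

Lemma error_factor_absorb (q S : R) : 0 <= q <= Q -> 0 <= S ->
  rho <= q ^+ 2 * S -> rho <= Q ^+ 2 * S.
Proof.
move=> /andP[q0 qQ] S0 h; apply: (le_trans h); apply: ler_wpM2r => //.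
by rewrite ler_sqr ?nnegrE// (le_trans q0).
Qed.

Lemma error_event_large_penalty : L * #|J|%:R <= rho -> exists E, error_event E.
Proof.
move=> large; have [mbad Pbad] := gram_exception.
have [E [mE PE HE]] := large_penalty_event N0 T0 iid s0 exo gauss
  (energy_factor_gt0 C0 K0 f0) mbad Pbad gram_good_energy support_gt0 large.
exists E; split => //.
  apply: le_trans PE; rewrite lee_fin addrAC lerD2l lerN2.
  by rewrite ler_expR mulNr lerN2 ler_piMl// ge_min lexx.
move=> w Ew g opt gJ; have [q _ _] := error_factor_parts C0 K0 s0 k0 f0.
apply: (error_factor_absorb q (sum_scaled_error_ge0 g)).
have -> : (2 * M) ^+ 2 = 4 * M ^+ 2 by ring.
exact: (HE w Ew g opt gJ).
Qed.

Lemma error_event_few_individuals : ln N%:R <= L -> exists E, error_event E.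
Proof.
move=> NL; exists set0; split => //; rewrite measure0 lee_fin.
rewrite -addrA -opprD subr_le0; apply: le_trans (exception_trivial NL) _.
by rewrite lerDr expR_ge0.
Qed.

(** Both |J| and the penalty level at a coordinate k of the support are bounded, so
    one coordinate controls the whole penalty vector up to a constant factor. *)
Lemma error_event_few_regressors : (s2 < s1)%N -> ln p%:R <= L ->
  rho < L * #|J|%:R -> exists E, error_event E.
Proof.
move=> s21 lpL small; have [mbad Pbad] := gram_exception.
have pL : p%:R <= expR L by rewrite -[leLHS]lnK ?ler_expR// posrE ltr0n.
have L0 := size_cutoff_gt0 C0 K0 s0 f0.
have Jcap : #|J|%:R <= support_cap C K sigma2 phi_hi.
  apply: (@le_trans _ _ (2 * p%:R)); last by rewrite ler_pM2l.
  rewrite -natrM ler_nat card_joint_support mul2n -addnn.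
  have sp : (s1 <= p)%N by apply: leq_trans (max_card _) _; rewrite card_ord.
  by apply: leq_add => //; exact: leq_trans (ltnW s21) sp.
have rhoL : rho <= L * support_cap C K sigma2 phi_hi.
  by apply: ltW; apply: (lt_le_trans small); rewrite ler_pM2l.
have [k kb] : exists k, k \in supp beta.
  by apply/set0Pn; rewrite -card_gt0; exact: leq_ltn_trans s21.
have kJ : lshift N k \in J by rewrite joint_support_lshift.
have [pen0 _] := scaled_penalty_lshift N0 T0 la lp k.
have penl : 0 <= scaled_penalty T lam mu (lshift N k)
            <= penalty_cap C K sigma2 phi_hi.
  rewrite pen0 /=; set v := scaled_penalty _ _ _ _ in pen0 *.
  have v2 : v ^+ 2 <= rho.
    rewrite /penalty_energy (bigD1 (lshift N k))//= lerDl.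
    by apply: sumr_ge0 => j _; exact: sqr_ge0.
  have v2' := le_trans v2 rhoL.
  rewrite /penalty_cap; apply: (@le_trans _ _ (1 + v ^+ 2)); last by rewrite lerD2l.
  have := sqr_ge0 (v - 1); have := sqr_ge0 v; lra.
have [E [mE PE HE]] := small_penalty_event N0 T0 iid s0 exo gauss
  (energy_factor_gt0 C0 K0 f0) mbad Pbad gram_good_energy C0 K0 sub kb k0
  (le_trans kk (kappa2_le_support_diag kJ)) penl.
have J0 := support_cap_gt0 C K sigma2 phi_hi.
have mass0 := noise_mass_gt0 sigma2 phi_hi C0 K0 k0.
have gap0 : 0 < noise_gap C K sigma2 kmin phi_hi by exact: noise_gap_gt0.
exists E; split => //.
  apply: le_trans PE; rewrite lee_fin lerD2r -/(noise_mass C K sigma2 kmin phi_hi).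
  rewrite lerBlDr -lerBlDl; apply: le_trans (expR_ge1Dx _).
  rewrite lerD2l mulNr lerN2.
  apply: (@le_trans _ _ (noise_mass C K sigma2 kmin phi_hi
    / support_cap C K sigma2 phi_hi * support_cap C K sigma2 phi_hi)); last first.
    by rewrite divfK ?gt_eqF.
  by apply: ler_pM => //; [exact/ltW/event_rate_gt0|rewrite ge_min lexx orbT].
move=> w Ew g opt gJ; have [_ q _] := error_factor_parts C0 K0 s0 k0 f0.
apply: (error_factor_absorb q (sum_scaled_error_ge0 g)).
have := HE w Ew g opt gJ (ltW gap0); rewrite -/(noise_gap C K sigma2 kmin phi_hi).
set S := \sum_j _; set cap := penalty_cap _ _ _ _; set gap := noise_gap _ _ _ _ _ in gap0 *.
move=> h; apply: (le_trans rhoL); apply: (@le_trans _ _ (cap ^+ 2)).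
  apply: (@le_trans _ _ cap); first by rewrite /cap /penalty_cap lerDr.
  by rewrite ler_eXnr// penalty_cap_ge1.
have -> : (cap * M / gap) ^+ 2 * S = cap ^+ 2 * (M ^+ 2 * S / gap ^+ 2).
  by field; rewrite gt_eqF.
by rewrite ler_peMr ?sqr_ge0// ler_pdivlMr ?mul1r// exprn_gt0.
Qed.

Lemma error_event_exists : exists E, error_event E.
Proof.
have [large|small] := lerP (L * #|J|%:R) rho.
  exact: error_event_large_penalty.
have L0 := size_cutoff_gt0 C0 K0 s0 f0.
have rhoE := penalty_energyE beta c N0 T0 la lp lN.
have := small; rewrite card_joint_support => /(bounded_dimension la lp lN L0 rhoE).
case: leqP => [_|s21] dimL; first exact: error_event_few_individuals.
exact: error_event_few_regressors.
Qed.

End SparseLasso.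

Theorem theorem4 (R : realType) (C K sigma2 kmin phi_lo phi_hi : R)
    (hC : 0 < C) (hK : 0 < K) (hsigma2 : 0 < sigma2)
    (hkmin : 0 < kmin) (hphi_lo : 0 < phi_lo) (hphi_hi : 0 < phi_hi) :
  exists c1 c2 A B : R,
    [/\ 0 < c1, 0 < c2, 0 < A & 0 < B] /\
    forall (d : measure_display) (Omega : measurableType d)
      (P : probability Omega R) (N T p : nat)
      (x : 'I_N -> {RV P >-> T.-tuple (p.-tuple R)})
      (eps : 'I_N -> {RV P >-> T.-tuple R})
      (beta : 'cV[R]_p) (c : 'cV[R]_N)
      (a : R) (ghat : Omega -> 'cV[R]_(p + N)),
      let gstar := col_mx beta c in
      let s1 := #|supp beta| in
      let s2 := #|supp c| in
      let J := joint_support beta c in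
      let lam := lambda_NT N T p a in
      let mu := mu_NT N T a in
      let k2 := kappa2 x lam mu s1 s2 in
      let t := rate_t N p k2 s1 s2 in
      expR 1 <= p%:R :> R ->
      expR 1 <= N%:R :> R ->
      (0 < T)%N ->
      expR 1 <= a ->
      iid_panel x eps ->
      exogenous_panel x eps ->
      mds_panel eps ->
      subgaussian_panel x eps C K ->
      (forall i, isotropic_normal P sigma2 (err eps i)) ->
      kmin <= k2 ->
      phi_lo <= phi_min (submat J (Gamma x)) ->
      phi_max (submat J (Gamma x)) <= phi_hi ->
      1 <= N%:R * t ^+ 2 ->
      (forall w, is_panel_lasso x eps lam mu beta c w (ghat w)) ->
      exists E : set Omega,
        [/\ measurable E,
            ((1 - expR (- c1 * #|J|%:R)
              - A * (p ^ 2 + N * p)%:R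
                  * expR (- B * (t ^+ 2 * N%:R) `^ 3^-1))%:E <= P E)%E &
            forall w, E w -> supp (ghat w) = J ->
              c2 * xi_NT N p a k2 s1 s2
              <= l2norm (submat J (Smat N T p)
                           *m (subvec J (ghat w) - subvec J gstar))].
Proof.
pose Q := error_factor C K sigma2 kmin phi_hi.
have [_ _ Q0] := error_factor_parts hC hK hsigma2 hkmin hphi_hi.
exists (event_rate C K sigma2 kmin phi_hi), (kmin / 16 / Q),
  (tail_factor C K sigma2 phi_hi), (tail_rate C K); split.
  split; [exact: event_rate_gt0|by rewrite !divr_gt0|exact: tail_factor_gt0|].
  exact: tail_rate_gt0.
move=> d Omega P N T p x eps beta c a ghat gstar s1 s2 J lam mu k2 t
  p_ge N_ge T0 a_ge iid exo _ sub gauss kk _ phiJ Nt opt.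
have lp := ln_ge1 p_ge; have lN := ln_ge1 N_ge; have la := ln_ge1 a_ge.
have N0 : (0 < N)%N by rewrite -(ltr0n R); exact: lt_le_trans (expR_gt0 _) N_ge.
have p0 : (0 < p)%N by rewrite -(ltr0n R); exact: lt_le_trans (expR_gt0 _) p_ge.
have [E [mE PE HE]] := error_event_exists hC hK hsigma2 hkmin hphi_hi N0 T0 p0
  la lp lN iid exo sub gauss kk phiJ Nt.
exists E; split => // w Ew gJ.
have rhoE := penalty_energyE beta c N0 T0 la lp lN.
have kk2 : 0 < kmin <= k2 by rewrite hkmin.
have [xi0 xi2] := xi_NT_le la lp lN kk2 rhoE.
have := HE w Ew _ (opt w) gJ.
rewrite -(l2norm_scaled_error T gJ).
set nrm := l2norm _; set rho := penalty_energy _ _ _ _ _ in xi2 *.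
set xi := xi_NT _ _ _ _ _ _ in xi0 xi2 * => h.
have nrm0 : 0 <= nrm by exact: sqrtr_ge0.
have c20 : 0 <= kmin / 16 / Q by rewrite ltW// !divr_gt0.
suff : (kmin / 16 / Q * xi) ^+ 2 <= nrm ^+ 2.
  by rewrite ler_sqr ?nnegrE//; exact: mulr_ge0.
rewrite exprMn.
apply: (@le_trans _ _ ((kmin / 16 / Q) ^+ 2
    * ((16 / kmin) ^+ 2 * (Q ^+ 2 * nrm ^+ 2)))).
  apply: ler_wpM2l; first exact: sqr_ge0.
  by apply: (le_trans xi2); apply: ler_wpM2l; first exact: sqr_ge0.
rewrite le_eqVlt; apply/orP; left; apply/eqP.
by field; rewrite !gt_eqF.
Qed.
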